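(* Let $A$ be a UHF $C^*$-algebra such that $A\otimes A\cong A$. Then any two universal UHF flows on $A$ are almost conjugate. In particular, a cocycle perturbation of a universal UHF flow $\gamma$ on $A$ is almost conjugate to $\gamma$.
   Context: A flow on a unital $C^*$-algebra is a strongly continuous one-parameter group of *-automorphisms. For flows $\alpha$ on $A$ and $\beta$ on $B$, $\alpha\otimes\beta$ is the flow $t\mapsto\alpha_t\otimes\beta_t$ on $A\otimes B$. A flow $\alpha$ on a UHF algebra $A$ is a UHF flow if there is an increasing sequence $(A_n)$ of full matrix $C^*$-subalgebras of $A$ with $1_A\in A_1$, $A=\overline{\bigcup_nA_n}$ and $\alpha_t(A_n)=A_n$ for all $n$ and $t$. Given a flow $\alpha$ on $A$, an $\alpha$-cocycle is a norm-continuous family $u=(u_t)_{t\in\mathbb R}$ of unitaries of $A$ with $u_s\alpha_s(u_t)=u_{s+t}$ for all $s,t$; the flow $t\mapsto \mathrm{Ad}\,u_t\circ\alpha_t$, where $\mathrm{Ad}\,u(x)=uxu^*$, is then called a cocycle perturbation of $\alpha$. A flow $\alpha$ on $A$ is cocycle conjugate to a flow $\beta$ on $B$ if there is an isomorphism $\varphi:A\to B$ such that $\alpha$ is a cocycle perturbation of $t\mapsto\varphi^{-1}\beta_t\varphi$. For a UHF algebra $A$ with $A\otimes A\cong A$, a UHF flow $\gamma$ on $A$ is universal if $\gamma\otimes\alpha$ is cocycle conjugate to $\gamma$ for every UHF flow $\alpha$ on $A$. A flow $\alpha$ on $A$ is almost conjugate to a flow $\beta$ on $B$ if for any $\epsilon>0$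 there is an isomorphism $\varphi$ of $A$ onto $B$ such that $\|\alpha_t-\varphi^{-1}\beta_t\varphi\|<\epsilon$ for all $t\in[-1,1]$ (norm of bounded linear maps on $A$). *)

(* Defs.v *)
From HB Require Import structures.
From mathcomp Require Import all_boot all_order all_algebra.
From mathcomp Require Import complex.
From mathcomp Require Import all_classical all_reals all_analysis.

Set Implicit Arguments.
Unset Strict Implicit.
Unset Printing Implicit Defensive.

Import Order.TTheory GRing.Theory Num.Theory.
Import numFieldNormedType.Exports.

Local Open Scope classical_set_scope.
Local Open Scope complex_scope.
Local Open Scope ring_scope.

(* Algebras are nonzero: [algType] requires 1 != 0. *)
HB.mixin Record isStarNormed (R : realType) A of GRing.Algebra R[i] A := {
  star : A -> A;
  cnorm : A -> R;
  starK : involutive star;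
  starD : {morph star : x y / x + y};
  starZ : forall (c : R[i]) (x : A), star (c *: x) = Num.conj c *: star x;
  starM : forall x y : A, star (x * y) = star y * star x;
  cnormD_le : forall x y : A, cnorm (x + y) <= cnorm x + cnorm y;
  cnormZ : forall (c : R[i]) (x : A),
    (cnorm (c *: x))%:C = `|c| * (cnorm x)%:C;
  cnorm0_eq0 : forall x : A, cnorm x = 0 -> x = 0;
  cnormM_le : forall x y : A, cnorm (x * y) <= cnorm x * cnorm y;
  cstar_identity : forall x : A, cnorm (star x * x) = cnorm x ^+ 2
}.

#[short(type="starNormedAlgType")]
HB.structure Definition StarNormedAlgebra (R : realType) :=
  { A of GRing.Algebra R[i] A & isStarNormed R A }.

(* The library has no normed algebras, and its normed modules cannot be joined
   with its rings (their only declared common descendants are number domains).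
   So the norm topology of [A] is carried by the copy [normed A], a normed
   module over R[i] with `|x| = (cnorm x)%:C. *)
Definition normed (R : realType) (A : starNormedAlgType R) : Type := A.

Section NormedCopy.
Variables (R : realType) (A : starNormedAlgType R).

HB.instance Definition _ := GRing.Lmodule.on (normed A).

Let nrm (x : normed A) : R[i] := (cnorm (x : A))%:C.

Let nrmD x y : nrm (x + y) <= nrm x + nrm y.
Proof. by rewrite /nrm -rmorphD /= lecR; apply: cnormD_le. Qed.

Let nrmZ (c : R[i]) x : nrm (c *: x) = `|c| * nrm x.
Proof. exact: cnormZ. Qed.

Let nrm0 x : nrm x = 0 -> x = 0.
Proof. by move=> /(congr1 (@complex.Re R)) /= /cnorm0_eq0. Qed.

HB.instance Definition _ :=
  @Lmodule_isNormed.Build R[i] (normed A) nrm nrmD nrmZ nrm0.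

End NormedCopy.

HB.mixin Record isCStarComplete (R : realType) A of StarNormedAlgebra R A := {
  cstar_complete : forall F : set_system (normed A),
    ProperFilter F -> cauchy F -> cvg F
}.

#[short(type="cstarAlgType")]
HB.structure Definition CStarAlgebra (R : realType) :=
  { A of StarNormedAlgebra R A & isCStarComplete R A }.

HB.instance Definition _ (R : realType) (A : cstarAlgType R) :=
  Uniform_isComplete.Build (normed A) (@cstar_complete R A).

Definition unitary (R : realType) (A : cstarAlgType R) (u : A) : Prop :=
  star u * u = 1 /\ u * star u = 1.

Definition star_morphism (R : realType) (A B : cstarAlgType R)
    (f : A -> B) : Prop :=
  [/\ linear f, {morph f : x y / x * y}, f 1 = 1 & {morph f : x / star x}].

Record star_isomorphism (R : realType) (A B : cstarAlgType R) := StarIso {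
  star_iso_fun :> A -> B;
  star_iso_inv : B -> A;
  star_iso_morphism : star_morphism star_iso_fun;
  star_iso_funK : cancel star_iso_fun star_iso_inv;
  star_iso_invK : cancel star_iso_inv star_iso_fun
}.

Definition isomorphic (R : realType) (A B : cstarAlgType R) : Prop :=
  exists _ : star_isomorphism A B, True.

Definition opnorm (R : realType) (A : cstarAlgType R) (f : A -> A) : \bar R :=
  ereal_sup [set (cnorm (f x))%:E | x in [set x : A | cnorm x <= 1]].

Record flow (R : realType) (A : cstarAlgType R) := Flow {
  flow_fun :> R -> A -> A;
  flow_morphism : forall t, star_morphism (flow_fun t);
  flow_bij : forall t, bijective (flow_fun t);
  flow0 : forall x, flow_fun 0 x = x;
  flowD : forall s t x, flow_fun (s + t) x = flow_fun s (flow_fun t x);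
  flow_continuous : forall x, continuous (fun t : R => flow_fun t x : normed A)
}.

(* [S] is the range of an injective *-homomorphism M_k(C) -> A with k > 0,
   which need not map the unit matrix to the unit of A. *)
Definition full_matrix_subalgebra (R : realType) (A : cstarAlgType R)
    (S : set A) : Prop :=
  exists (k : nat) (e : 'M[R[i]]_k -> A),
    [/\ (0 < k)%N, linear e, injective e & range e = S] /\
    [/\ forall M N, e (M *m N) = e M * e N &
        forall M, e (map_mx Num.conj M^T) = star (e M)].

Definition matrix_tower (R : realType) (A : cstarAlgType R)
    (An : nat -> set A) : Prop :=
  [/\ forall n, full_matrix_subalgebra (An n),
      forall n, An n `<=` An n.+1,
      An 0%N 1 &
      dense (\bigcup_n An n : set (normed A))].

Definition UHF_algebra (R : realType) (A : cstarAlgType R) : Prop :=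
  exists An : nat -> set A, matrix_tower An.

Definition UHF_flow (R : realType) (A : cstarAlgType R) (alpha : flow A)
    : Prop :=
  exists2 An : nat -> set A, matrix_tower An &
    forall n t, alpha t @` An n = An n.

Definition lin_indep (R : realType) (A : cstarAlgType R) (n : nat)
    (a : 'I_n -> A) : Prop :=
  forall c : 'I_n -> R[i], \sum_(k < n) c k *: a k = 0 -> forall k, c k = 0.

(* A realisation of A (x) B: a C*-algebra containing the algebraic tensor
   product ([tens_inj]) as a dense *-subalgebra.  When A or B is nuclear, in
   particular UHF, the algebraic tensor product has only one C*-norm, so the
   realisation is unique up to a unique isomorphism preserving [tens]. *)
Record tensor_product (R : realType) (A B : cstarAlgType R) := TensorProduct {
  tens_alg :> cstarAlgType R;
  tens : A -> B -> tens_alg;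
  tens_linear_l : forall b, linear (fun a => tens a b);
  tens_linear_r : forall a, linear (tens a);
  tensM : forall a a' b b', tens (a * a') (b * b') = tens a b * tens a' b';
  tens11 : tens 1 1 = 1;
  tens_star : forall a b, tens (star a) (star b) = star (tens a b);
  tens_inj : forall (n : nat) (a : 'I_n -> A) (b : 'I_n -> B),
    lin_indep a -> \sum_(k < n) tens (a k) (b k) = 0 -> forall k, b k = 0;
  tens_dense : dense [set x : normed tens_alg | exists (n : nat)
    (a : 'I_n -> A) (b : 'I_n -> B), x = \sum_(k < n) tens (a k) (b k)]
}.

(* [delta] is alpha (x) beta; at most one flow satisfies this, by density. *)
Definition is_tensor_flow (R : realType) (A B : cstarAlgType R)
    (T : tensor_product A B) (alpha : flow A) (beta : flow B)
    (delta : flow T) : Prop :=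
  forall t a b, delta t (tens T a b) = tens T (alpha t a) (beta t b).

(* Cocycles, perturbations and conjugates are defined for families of maps, so
   that a perturbed or conjugated flow need not be repackaged as a [flow]. *)
Definition cocycle (R : realType) (A : cstarAlgType R) (alpha : R -> A -> A)
    (u : R -> A) : Prop :=
  [/\ forall t, unitary (u t),
      continuous (u : R -> normed A) &
      forall s t, u s * alpha s (u t) = u (s + t)].

Definition perturb (R : realType) (A : cstarAlgType R) (alpha : R -> A -> A)
    (u : R -> A) : R -> A -> A :=
  fun t x => u t * alpha t x * star (u t).

Definition conj_by (R : realType) (A B : cstarAlgType R)
    (phi : star_isomorphism A B) (beta : R -> B -> B) : R -> A -> A :=
  fun t x => star_iso_inv phi (beta t (phi x)).

Definition cocycle_conjugate (R : realType) (A B : cstarAlgType R)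
    (alpha : R -> A -> A) (beta : R -> B -> B) : Prop :=
  exists (phi : star_isomorphism A B) (u : R -> A),
    cocycle (conj_by phi beta) u /\
    forall t x, alpha t x = perturb (conj_by phi beta) u t x.

Definition universal_UHF_flow (R : realType) (A : cstarAlgType R)
    (AA : tensor_product A A) (gamma : flow A) : Prop :=
  UHF_flow gamma /\
  forall alpha : flow A, UHF_flow alpha ->
    exists2 delta : flow AA, is_tensor_flow gamma alpha delta &
      cocycle_conjugate delta gamma.

Definition almost_conjugate (R : realType) (A B : cstarAlgType R)
    (alpha : R -> A -> A) (beta : R -> B -> B) : Prop :=
  forall eps : R, 0 < eps -> exists phi : star_isomorphism A B,
    forall t : R, -1 <= t <= 1 ->
      (opnorm (fun x => (alpha t x - conj_by phi beta t x)%R) < eps%:E)%E.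

(* Main.v *)
(* Let alpha be a UHF flow on A in which every finite list of rational eigenvalues
   occurs again and again along the tower: at level n the flow on the relative
   commutant of A_n in A_(n+1) is diagonal with spectrum a prescribed list repeated
   periodically. A universal flow gamma is cocycle conjugate to gamma (x) alpha,
   which leaves a tower of matrix algebras invariant. A cocycle of a flow with an
   invariant tower is uniformly close on [-1,1] to a cocycle lying in one algebra of
   the tower, so that, up to a small error, every cocycle perturbation of gamma is
   conjugate to a flow with an invariant tower which still contains, arbitrarily far
   out, any finite spectrum up to epsilon. Two such flows are intertwined back and
   forth: a diagonal matrix subalgebra of one flow is matched with one of the other
   flow whose eigenvalues differ by a summable error, and the limit isomorphism is
   the required almost conjugacy. *)
Require Import Defs.
From HB Require Import structures.
From mathcomp Require Import all_boot all_order all_algebra.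
From mathcomp Require Import complex spectral.
From mathcomp Require Import all_classical all_reals all_analysis.
From mathcomp Require Import ring lra.

Set Implicit Arguments.
Unset Strict Implicit.
Unset Printing Implicit Defensive.

Import Order.TTheory GRing.Theory Num.Theory.
Import numFieldNormedType.Exports.

Local Open Scope classical_set_scope.
Local Open Scope complex_scope.
Local Open Scope ring_scope.

(** A cocycle is only norm continuous, whereas one inside an invariant matrix algebra is built from
    exponentials. Comparing the two on [-1,1] through their values at one short time [tau]
    multiplies the error by about 1 / [tau], so that this error must be o([tau]). Hence the
    smoothing: after a coboundary close to 1 the cocycle equals 1 + [tau] H at time [tau], where the
    bound on H does not depend on [tau] and the flow hardly moves H up to that time. The
    approximating cocycle lies in one level of the tower, hence commutes with every spectral pattern
    placed beyond that level. This is why the patterns have to recur arbitrarily far out, and why a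
    perturbation does not destroy them. Rational eigenvalues make the finite lists countable, so one
    tower can carry each of them infinitely often. The isomorphism of A (x) A with A acts through
    sizes: the square of the size of a level divides the size of a later one, which leaves room in
    the relative commutant for whole repetitions of a pattern. The only spectral theory used is the
    diagonalisation of normal matrices; sharp norm bounds come from the C*-identity applied to
    2^n-th powers. *)

Module NcRing.

(** * Equalities in noncommutative rings by reflection *)

Section NcRing.
Variable A : pzRingType.

Inductive expr := Var of nat | Zero | One | Add of expr & expr | Opp of expr
  | Mul of expr & expr.

Fixpoint eval (env : seq A) e : A := match e with
  | Var i => env`_i | Zero => 0 | One => 1
  | Add a b => eval env a + eval env b
  | Opp a => - eval env a
  | Mul a b => eval env a * eval env b
  end.

Fixpoint norm e : seq (bool * seq nat) := match e with
  | Var i => [:: (false, [:: i])] | Zero => [::] | One => [:: (false, [::])]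
  | Add a b => norm a ++ norm b
  | Opp a => [seq (~~ m.1, m.2) | m <- norm a]
  | Mul a b => [seq (m.1 (+) m'.1, m.2 ++ m'.2) | m <- norm a, m' <- norm b]
  end.

Definition mono env (m : bool * seq nat) : A :=
  (-1) ^+ m.1 * \prod_(i <- m.2) env`_i.

Lemma norm_eval env e : eval env e = \sum_(m <- norm e) mono env m.
Proof.
elim: e => /=.
- by move=> i; rewrite big_seq1 /mono big_seq1 expr0 mul1r.
- by rewrite big_nil.
- by rewrite big_seq1 /mono big_nil expr0 mulr1.
- by move=> a -> b ->; rewrite big_cat.
- move=> a ->; rewrite big_map -sumrN; apply: eq_bigr => -[s m] _.
  by rewrite /mono signrN mulNr.
- move=> a -> b ->; rewrite big_allpairs_dep mulr_suml; apply: eq_bigr => -[s m] _.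
  rewrite mulr_sumr; apply: eq_bigr => -[s' m'] _ /=.
  rewrite /mono signr_addb big_cat /= -!mulrA; congr (_ * _).
  by rewrite !mulrA; congr (_ * _); rewrite mulr_sign; case: s'; rewrite ?expr0 ?expr1 ?mulr1 ?mulrN1.
Qed.

(** The expanded difference of two expressions vanishes if its monomials cancel in pairs of opposite
    sign. [n] is fuel; each step removes two monomials, so the length of the list is enough. *)
Fixpoint cancel_all (l : seq (bool * seq nat)) n := if n is n'.+1 then
  if l is m :: l' then
    if (~~ m.1, m.2) \in l' then cancel_all (rem (~~ m.1, m.2) l') n'
    else false
  else true else nilp l.

Lemma cancel_allP env l n : cancel_all l n -> \sum_(m <- l) mono env m = 0.
Proof.
elim: n l => [|n IH] [|m l] //=; try by rewrite big_nil.
case: ifP => // hm /IH h; rewrite big_cons (perm_big _ (perm_to_rem hm)) /= big_cons h addr0.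
by rewrite /mono /= signrN mulNr subrr.
Qed.

Lemma eqP env a b : (let l := norm (Add a (Opp b)) in cancel_all l (size l)) ->
  eval env a = eval env b.
Proof.
by move/(cancel_allP env); rewrite -norm_eval /= => /eqP; rewrite subr_eq0 => /eqP.
Qed.
End NcRing.

(* Atoms are compared by conversion: the same term may carry different paths
   through the algebraic hierarchy. *)
Ltac pos x l := lazymatch l with
  | cons ?y ?l' => match constr:(Set) with
    | _ => let _ := match goal with _ => unify x y end in constr:(Some 0%N)
    | _ => lazymatch pos x l' with Some ?n => constr:(Some (S n)) | None => constr:(@None nat) end
    end
  | _ => constr:(@None nat) end.
Ltac atoms l t := lazymatch t with
  | (?a + ?b)%R => let l' := atoms l a in atoms l' b
  | (- ?a)%R => atoms l a
  | (?a * ?b)%R => let l' := atoms l a in atoms l' b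
  | 0%R => l | 1%R => l
  | _ => lazymatch pos t l with Some _ => l | None => constr:(cons t l) end end.
Ltac quote l t := lazymatch t with
  | (?a + ?b)%R => let a' := quote l a in let b' := quote l b in constr:(Add a' b')
  | (- ?a)%R => let a' := quote l a in constr:(Opp a')
  | (?a * ?b)%R => let a' := quote l a in let b' := quote l b in constr:(Mul a' b')
  | 0%R => constr:(Zero) | 1%R => constr:(One)
  | _ => lazymatch pos t l with Some ?n => constr:(Var n) end end.
End NcRing.

Ltac ncring := lazymatch goal with |- ?x = ?y :> ?T =>
  let l := NcRing.atoms (@nil T) x in let l := NcRing.atoms l y in
  let a := NcRing.quote l x in let b := NcRing.quote l y in
  exact: (@NcRing.eqP _ l a b isT) end.

(** * C*-norms *)

Section Norm.
Variables (R : realType) (A : cstarAlgType R).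
Implicit Types (x y z : A) (c : R[i]).

Lemma normedE (x : normed A) : `|x| = (cnorm (x : A))%:C.
Proof. by []. Qed.

Lemma cnormZE c x : cnorm (c *: x) = Normc.normc c * cnorm x.
Proof. have /(congr1 (@complex.Re R)) := cnormZ c x. by rewrite /= !mulr0 subr0. Qed.

Lemma cnorm0 : cnorm (0 : A) = 0.
Proof. by rewrite -(scale0r (0:A)) cnormZE Normc.normc0 mul0r. Qed.

Lemma cnormN x : cnorm (- x) = cnorm x.
Proof. by rewrite -scaleN1r cnormZE normcN Normc.normc1 mul1r. Qed.

Lemma cnorm_ge0 x : 0 <= cnorm x.
Proof. by have := cnormD_le x (- x); rewrite subrr cnorm0 cnormN; lra. Qed.

Lemma cnormB x y : cnorm (x - y) = cnorm (y - x).
Proof. by rewrite -cnormN opprB. Qed.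

Lemma cnormB_le x y : cnorm (x - y) <= cnorm x + cnorm y.
Proof. by rewrite -(cnormN y) cnormD_le. Qed.

Lemma cdist_tri z x y : cnorm (x - y) <= cnorm (x - z) + cnorm (z - y).
Proof. by rewrite -[x - y](subrKA z) cnormD_le. Qed.

Lemma lerB_cnorm x y : `|cnorm x - cnorm y| <= cnorm (x - y).
Proof.
have := cnormD_le (x - y) y; have := cnormD_le (y - x) x.
by rewrite !subrK cnormB ler_norml => *; apply/andP; split; lra.
Qed.

Lemma cnorm_sum (I : Type) (r : seq I) (P : pred I) (F : I -> A) :
  cnorm (\sum_(i <- r | P i) F i) <= \sum_(i <- r | P i) cnorm (F i).
Proof.
elim/big_ind2 : _ => [|a b a' b' h h'|//]; first by rewrite cnorm0.
by rewrite (le_trans (cnormD_le _ _))// lerD.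
Qed.

Lemma cnorm1 : cnorm (1 : A) = 1.
Proof.
have h0 : cnorm (1 : A) != 0.
  by apply/negP => /eqP/cnorm0_eq0/eqP; rewrite oner_eq0.
have s1 : star (1 : A) = 1.
  by have := starM (star 1) (1:A); rewrite mulr1 !starK mulr1.
have := cstar_identity (1 : A); rewrite s1 mulr1 expr2 => /esym e.
by apply: (mulfI h0); rewrite mulr1.
Qed.

Lemma star1 : star (1 : A) = 1.
Proof. by have := starM (star 1) (1:A); rewrite mulr1 !starK mulr1. Qed.

Lemma star0 : star (0 : A) = 0.
Proof. by have := starZ 0 (0:A); rewrite scale0r conjC0 scale0r. Qed.

Lemma starN x : star (- x) = - star x.
Proof. by rewrite -scaleN1r starZ rmorphN1 scaleN1r. Qed.

Lemma starB x y : star (x - y) = star x - star y.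
Proof. by rewrite starD starN. Qed.

Lemma star_sum (I : Type) (r : seq I) (P : pred I) (F : I -> A) :
  star (\sum_(i <- r | P i) F i) = \sum_(i <- r | P i) star (F i).
Proof. exact: (big_morph _ starD star0). Qed.

Lemma cnorm_star x : cnorm (star x) = cnorm x.
Proof.
suff h y : cnorm y <= cnorm (star y) by apply/le_anti; rewrite h andbT -{2}(starK x) h.
have [->|y0] := eqVneq (cnorm y) 0; first exact: cnorm_ge0.
have yp : 0 < cnorm y by rewrite lt_neqAle eq_sym y0 cnorm_ge0.
by rewrite -(ler_pM2r yp) -expr2 -cstar_identity cnormM_le.
Qed.

Lemma cnormMl_le x y k : cnorm x <= k -> cnorm (x * y) <= k * cnorm y.
Proof. by move=> h; rewrite (le_trans (cnormM_le _ _))// ler_wpM2r// cnorm_ge0. Qed.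

Lemma cnormMr_le x y k : cnorm y <= k -> cnorm (x * y) <= cnorm x * k.
Proof. by move=> h; rewrite (le_trans (cnormM_le _ _))// ler_wpM2l// cnorm_ge0. Qed.

Lemma cnormMM_le x y k l : cnorm x <= k -> cnorm y <= l -> cnorm (x * y) <= k * l.
Proof.
by move=> h h'; rewrite (le_trans (cnormM_le _ _))// ler_pM ?cnorm_ge0.
Qed.

Lemma cnorm_eq0 x : (cnorm x == 0) = (x == 0).
Proof. by apply/eqP/eqP => [/cnorm0_eq0|->]; rewrite ?cnorm0. Qed.

Lemma small_eq0 x : (forall e : R, 0 < e -> cnorm x <= e) -> x = 0.
Proof.
move=> h; apply: cnorm0_eq0; apply/eqP; rewrite eq_le cnorm_ge0 andbT.
by apply/ler_addgt0Pl => e /h; rewrite addr0.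
Qed.

Lemma small_eq x y : (forall e : R, 0 < e -> cnorm (x - y) <= e) -> x = y.
Proof. by move=> /small_eq0/eqP; rewrite subr_eq0 => /eqP. Qed.

Lemma ball_cnorm (x y : normed A) (e : R) :
  ball x (e%:C) y <-> cnorm ((x : A) - y) < e.
Proof. by rewrite -ball_normE /ball_ /= normedE ltcR. Qed.

Lemma posC (e : R[i]) : 0 < e -> exists2 r : R, 0 < r & e = r%:C.
Proof.
case: e => a b; rewrite ltcE /= => /andP[/eqP b0 a0].
by exists a; rewrite // b0.
Qed.

Lemma dense_cnorm (S : set A) :
  dense (S : set (normed A)) <->
  forall x (e : R), 0 < e -> exists2 y, S y & cnorm (x - y) < e.
Proof.
split => h.
  move=> x e e0.
  have e0' : 0 < (e%:C : R[i]) by rewrite ltcR.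
  have [|y [/ball_cnorm ? ?]] := h (ball (x : normed A) e%:C) _ (ball_open (x : normed A) e%:C).
    by exists x; exact: ballxx.
  by exists y.
move=> O [x Ox] Oop.
have : nbhs (x : normed A) O by apply: open_nbhs_nbhs.
rewrite nbhs_ballP => -[e /posC[r r0 ->] sub].
have [y Sy ylt] := h x r r0.
by exists y; split => //; apply: sub; apply/ball_cnorm.
Qed.

(** The form in which completeness is used: the fixed points and the extended isomorphisms below are
    limits obtained from it. *)
Lemma complete_seq (x : nat -> A) :
  (forall e : R, 0 < e -> exists N, forall m n, (N <= m)%N -> (N <= n)%N ->
     cnorm (x m - x n) <= e) ->
  exists l, forall e : R, 0 < e -> exists N, forall n, (N <= n)%N ->
     cnorm (x n - l) <= e.
Proof.
move=> h.
have cx : cauchy ((x : nat -> normed A) @ \oo).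
  apply/cauchy_ballP => e /posC[r r0 ->].
  have [N hN] := h (r / 2) ltac:(lra).
  exists ([set y | exists2 n, (N <= n)%N & y = x n],
          [set y | exists2 n, (N <= n)%N & y = x n]) => /=.
    by split; exists N => // n /= Nn; exists n.
  move=> [y z] /= [[m Nm ->] [n Nn ->]]; apply/ball_cnorm.
  by rewrite (le_lt_trans (hN _ _ Nm Nn))//; lra.
have /cvg_ballP cl : (x : nat -> normed A) @ \oo --> lim ((x : nat -> normed A) @ \oo) by exact: (@cstar_complete R A _ _ cx).
exists (lim ((x : nat -> normed A) @ \oo)) => e e0.
have e0' : 0 < (e%:C : R[i]) by rewrite ltcR.
have [N _ hN] := cl _ e0'.
exists N => n Nn; rewrite cnormB; apply: ltW.
by apply/ball_cnorm; apply: hN.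
Qed.

Lemma continuous_cnorm (f : R -> A) :
  continuous (f : R -> normed A) <->
  forall t e, 0 < e -> exists2 d, 0 < d & forall s, `|t - s| < d ->
    cnorm (f t - f s) < e.
Proof.
split => h t.
  move=> e e0; have e0' : 0 < (e%:C : R[i]) by rewrite ltcR.
  have /cvg_ballP/(_ _ e0') := h t.
  rewrite near_simpl => /nbhs_ballP[d /= d0 hd]; exists d => // s ts.
  by apply/ball_cnorm; apply: (hd s).
apply/cvg_ballP => e /posC[r r0 ->].
have [d d0 hd] := h t r r0.
apply/nbhs_ballP; exists d => //= s ts.
by apply/ball_cnorm; exact: hd.
Qed.

Lemma geo_small (r e : R) : 0 < e -> exists N, forall n, (N <= n)%N -> r / 2 ^+ n <= e.
Proof.
move=> e0; have [N hN] : exists N, `|r| / e < N%:R.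
  by exists (Num.bound (`|r| / e)); rewrite archi_boundP// divr_ge0// ltW.
exists N => n Nn; rewrite ler_pdivrMr ?exprn_gt0//.
rewrite (le_trans (ler_norm r))// -ler_pdivrMl// mulrC ltW// (lt_le_trans hN)//.
rewrite -natrX ler_nat (leq_trans Nn)// ltnW// ltn_expl//.
Qed.

(** Contraction principle on a closed ball. It takes the place of power series in the construction
    of square roots and inverses near 1. *)
Lemma fixpoint (T : A -> A) (r : R) : 0 <= r ->
  (forall x, cnorm x <= r -> cnorm (T x) <= r) ->
  (forall x y, cnorm x <= r -> cnorm y <= r ->
     cnorm (T x - T y) <= cnorm (x - y) / 2) ->
  exists2 p, cnorm p <= r & T p = p.
Proof.
move=> r0 Tr Tc; pose x n := iter n T 0.
have xr n : cnorm (x n) <= r by elim: n => [|n IH]; rewrite /x /= ?cnorm0 ?Tr.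
have xc n k : cnorm (x (n + k)%N - x n) <= r / 2 ^+ n.
  elim: n => [|n IH]; first by rewrite expr0 divr1 subr0.
  rewrite addSn /= (le_trans (Tc _ _ (xr _) (xr _)))// exprSr invfM mulrA.
  by rewrite ler_pM2r// invr_gt0.
have [e e0|p hp] := complete_seq (x := x).
  have [N hN] := geo_small r e0; exists N => m n.
  wlog nm : m n / (n <= m)%N => [hw Nm Nn|Nm Nn].
    by case: (leqP n m) => [|/ltnW] h; [|rewrite cnormB]; apply: hw.
  by rewrite -(subnKC nm) (le_trans (xc _ _)) ?hN.
have pr : cnorm p <= r.
  apply/ler_addgt0Pr => e /hp[N /(_ _ (leqnn N)) h].
  by have := cnormD_le (x N) (p - x N); rewrite subrKC cnormB; have := xr N; lra.
exists p => //; apply: small_eq => e e0.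
have [|N hN] := hp (e / 2); first lra.
rewrite (le_trans (cdist_tri (x N.+1) _ _))//.
have := hN _ (leqnn N); have := hN _ (leqnSn N).
by have := Tc p (x N) pr (xr N); rewrite (cnormB p) /=; lra.
Qed.

End Norm.

(** * Square roots, inverses and powers *)

Section Near1.
Variables (R : realType) (A : cstarAlgType R).
Implicit Types (x y z a b h : A) (c : R[i]).

Lemma normc_half : Normc.normc (2^-1 : R[i]) = 2^-1.
Proof.
by rewrite Normc.normcV; congr (_^-1); rewrite (normcMn 1 2) Normc.normc1.
Qed.

Lemma half_half x : (2^-1 : R[i]) *: x + (2^-1 : R[i]) *: x = x.
Proof.
by rewrite -scalerDl -mulr2n -[2^-1 *+ 2]mulr_natr mulVf ?scale1r// pnatr_eq0.
Qed.

(* The equation [a k + k b = e] determines [k] when [a] and [b] are near 1. *)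
Lemma sylvester_bound a b k : cnorm (a - 1) <= 4^-1 -> cnorm (b - 1) <= 4^-1 ->
  cnorm k <= cnorm (a * k + k * b).
Proof.
move=> ha hb; have -> : a * k + k * b = (k + k) - (((1 - a) * k) + k * (1 - b)).
  by ncring.
have h1 : cnorm (k + k) = 2 * cnorm k.
  by rewrite -mulr2n -scaler_nat cnormZE (normcMn 1 2) Normc.normc1.
have := lerB_cnorm (k + k) ((1 - a) * k + k * (1 - b)).
rewrite h1 ler_norml => /andP[_].
have h2 : cnorm ((1 - a) * k) <= 4^-1 * cnorm k by rewrite cnormMl_le// cnormB.
have h3 : cnorm (k * (1 - b)) <= cnorm k * 4^-1 by rewrite cnormMr_le// cnormB.
have := cnormD_le ((1 - a) * k) (k * (1 - b)); have := cnorm_ge0 k.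
lra.
Qed.

(** Writing [a] as 1 + x turns the equation into x = (b - 1 - x x) / 2, a contraction of the ball of
    radius [cnorm (b - 1)]. Self-adjointness and commutation are uniqueness statements: [star a - a]
    and [h * a - a * h] solve a homogeneous Sylvester equation, so [sylvester_bound] makes them
    vanish. *)
Lemma sqrt_near1 b : cnorm (b - 1) <= 4^-1 -> exists a,
  [/\ a * a = b, cnorm (a - 1) <= cnorm (b - 1), star b = b -> star a = a &
      forall h, h * b = b * h -> h * a = a * h].
Proof.
move=> hb; set r := cnorm (b - 1) in hb *.
pose T x := (2^-1 : R[i]) *: (b - 1 - x * x).
have r0 : 0 <= r by exact: cnorm_ge0.
have [x xr|x y xr yr|x xr Tx] := fixpoint (T := T) r0.
- rewrite cnormZE normc_half; have := cnormB_le (b - 1) (x * x).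
  have := cnormMM_le xr xr; rewrite -/r.
  have : r * r <= r by nra. lra.
- rewrite /T -scalerBr cnormZE normc_half opprD addrACA subrr add0r opprK.
  have -> : - (x * x) + y * y = (y - x) * y + x * (y - x).
    by ncring.
  have := cnormD_le ((y - x) * y) (x * (y - x)).
  have := cnormMr_le (y - x) yr; have := cnormMl_le (y - x) xr.
  rewrite (cnormB x y); have := cnorm_ge0 (y - x); nra.
have e : (1 + x) * (1 + x) = b.
  have : x + x + x * x = b - 1 by rewrite -[in x + x]Tx half_half subrK.
  by move/eqP; rewrite eq_sym subr_eq => /eqP ->; ncring.
have x1 : cnorm (1 + x - 1) = cnorm x by rewrite addrAC subrr add0r.
have a4 : cnorm (1 + x - 1) <= 4^-1 by rewrite x1; lra.
exists (1 + x); split => //; first by rewrite x1.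
- move=> sb; apply/eqP; rewrite -subr_eq0; apply/eqP; apply: cnorm0_eq0.
  set a := 1 + x in e a4 *.
  have a4' : cnorm (star a - 1) <= 4^-1.
    by rewrite -(star1 A) -starB cnorm_star.
  have := sylvester_bound (star a - a) a4' a4.
  rewrite mulrBr mulrBl -starM e addrA subrK sb subrr cnorm0 => ?.
  by apply/eqP; rewrite eq_le cnorm_ge0 andbT.
- move=> h hbC; apply/eqP; rewrite -subr_eq0; apply/eqP; apply: cnorm0_eq0.
  set a := 1 + x in e a4 *.
  have := sylvester_bound (h * a - a * h) a4 a4.
  rewrite mulrBr mulrBl -!mulrA e !mulrA e hbC addrA subrK subrr cnorm0 => ?.
  by apply/eqP; rewrite eq_le cnorm_ge0 andbT.
Qed.

(** One fixed point is a right inverse and another a left inverse; associativity identifies them.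
    The radius 2 is the sum of the geometric series of ratio 1/2. *)
Lemma inv_near1 a : cnorm (a - 1) <= 2^-1 ->
  exists z, [/\ z * a = 1, a * z = 1 & cnorm z <= 2].
Proof.
move=> ha.
have h2 : 0 <= 2 :> R by [].
have ha' : cnorm (1 - a) <= 2^-1 by rewrite cnormB.
have [z zr|z z' zr zr'|z zr Tz] := fixpoint (T := fun z => 1 + (1 - a) * z) h2.
- have := cnormMM_le ha' zr; have := cnormD_le 1 ((1 - a) * z).
  rewrite cnorm1; lra.
- rewrite opprD addrACA subrr add0r -mulrBr.
  by rewrite (le_trans (cnormMl_le _ ha'))// mulrC.
have [y yr|y y' yr yr'|y yr Ty] := fixpoint (T := fun z => 1 + z * (1 - a)) h2.
- have := cnormMM_le yr ha'; have := cnormD_le 1 (y * (1 - a)).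
  rewrite cnorm1; lra.
- rewrite opprD addrACA subrr add0r -mulrBl.
  by rewrite (le_trans (cnormMr_le _ ha')).
have az : a * z = 1.
  have -> : a * z = 1 - ((1 + (1 - a) * z) - z) by ncring.
  by rewrite Tz subrr subr0.
have ya : y * a = 1.
  have -> : y * a = 1 - ((1 + y * (1 - a)) - y) by ncring.
  by rewrite Ty subrr subr0.
have zy : y = z by rewrite -[y]mulr1 -az mulrA ya mul1r.
by exists z; split => //; rewrite -zy.
Qed.

Lemma bernoulli (d : R) n : 0 <= d -> 1 + n%:R * d <= (1 + d) ^+ n.
Proof.
move=> d0; elim: n => [|n IH]; first by rewrite mul0r addr0 expr0.
rewrite exprSr -natr1; have : 0 <= n%:R * d by rewrite mulr_ge0.
nra.
Qed.

(** If x / y exceeded 1, its powers would be unbounded by Bernoulli. This plays the role of the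
    spectral radius formula: a crude norm estimate with a constant, valid for all 2^n-th powers,
    becomes a sharp one. *)
Lemma pow2_le (x y k : R) : 0 <= x -> 0 <= y ->
  (forall n, x ^+ (2 ^ n) <= k * y ^+ (2 ^ n)) -> x <= y.
Proof.
move=> x0 y0 h; rewrite leNgt; apply/negP => yx.
have [y00|yn] := eqVneq y 0.
  by have := h 0%N; rewrite expn0 !expr1 y00 mulr0; lra.
have yp : 0 < y by rewrite lt_neqAle eq_sym yn.
pose d := x / y - 1.
have d0 : 0 < d by rewrite subr_gt0 ltr_pdivlMr// mul1r.
have hk n : n%:R * d <= k.
  have : (1 + d) ^+ (2 ^ n) <= k.
    rewrite subrKC expr_div_n ler_pdivrMr ?exprn_gt0//.
  have := bernoulli (2 ^ n) (ltW d0).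
  have : n%:R * d <= (2 ^ n)%:R * d.
    by rewrite ler_pM2r// ler_nat ltnW// ltn_expl.
  lra.
have := hk (Num.bound (k / d)).+1.
have kd : 0 <= k by have := hk 0%N; rewrite mul0r.
have := archi_boundP (divr_ge0 kd (ltW d0)).
rewrite ltr_pdivrMr// -natr1 => *; nra.
Qed.

Lemma cnorm_sa x : star x = x -> forall n, cnorm (x ^+ (2 ^ n)) = cnorm x ^+ (2 ^ n).
Proof.
move=> sx n; elim: n x sx => [|n IH] x sx; first by rewrite expn0 !expr1.
rewrite expnS !exprM IH; last by rewrite expr2 starM sx.
by rewrite -cstar_identity sx expr2.
Qed.

End Near1.

(** * Contractivity of homomorphisms *)

Section Morphism.
Variables (R : realType) (A B : cstarAlgType R) (f : A -> B).
Hypothesis fm : star_morphism f.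
Implicit Types (x y : A) (c : R[i]).

Lemma smZD c x y : f (c *: x + y) = c *: f x + f y.
Proof. by case: fm => h _ _ _; exact: h. Qed.

Lemma smD x y : f (x + y) = f x + f y.
Proof. by have := smZD 1 x y; rewrite !scale1r. Qed.

Lemma sm0 : f 0 = 0.
Proof. by apply: (addrI (f 0)); rewrite -smD !addr0. Qed.

Lemma smZ c x : f (c *: x) = c *: f x.
Proof. by have := smZD c x 0; rewrite !addr0 sm0 addr0. Qed.

Lemma smN x : f (- x) = - f x.
Proof. by rewrite -scaleN1r smZ scaleN1r. Qed.

Lemma smB x y : f (x - y) = f x - f y.
Proof. by rewrite smD smN. Qed.

Lemma smM x y : f (x * y) = f x * f y.
Proof. by case: fm => _ h _ _; exact: h. Qed.

Lemma sm1 : f 1 = 1.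
Proof. by case: fm. Qed.

Lemma smS x : f (star x) = star (f x).
Proof. by case: fm => _ _ _ h; exact: h. Qed.

Lemma smX x n : f (x ^+ n) = f x ^+ n.
Proof. by elim: n => [|n IH]; rewrite ?expr0 ?sm1// !exprS smM IH. Qed.

Lemma sm_sum (I : Type) (r : seq I) (P : pred I) (F : I -> A) :
  f (\sum_(i <- r | P i) F i) = \sum_(i <- r | P i) f (F i).
Proof. exact: (big_morph _ smD sm0). Qed.

Lemma cnorm_isom (u : B) : star u * u = 1 -> cnorm u = 1.
Proof.
move=> h; have := cstar_identity u; rewrite h cnorm1 => /esym/eqP.
by rewrite sqrf_eq1 => /orP[/eqP//|/eqP e]; have := cnorm_ge0 u; rewrite e; lra.
Qed.

(* [h] is the real part of the unitary [h + i sqrt (1 - h ^+ 2)], whose image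
   is again unitary, hence of norm 1. *)
Lemma sm_small h : star h = h -> cnorm h <= 2^-1 -> cnorm (f h) <= 1.
Proof.
move=> sh hh.
have [|s [ss _ sa sC]] := sqrt_near1 (b := 1 - h * h).
  by rewrite addrAC subrr add0r cnormN; have := cnormMM_le hh hh; lra.
have {}sa : star s = s by apply: sa; rewrite starB starM sh star1.
have {}sC : h * s = s * h by apply: sC; rewrite mulrBr mulrBl mulr1 mul1r mulrA.
pose U := h + 'i *: s; pose U' := h - 'i *: s.
have sU : star U = U' by rewrite starD starZ sh sa conjCi scaleNr.
have U1 : star U * U = 1.
  rewrite sU mulrDl !mulrDr -!scalerAr mulNr -scalerAl sC.
  have i2 : 'i *: ('i *: (s * s)) = - (s * s).
    by rewrite scalerA -expr2 sqrCi scaleN1r.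
  by rewrite mulNr -scalerAl scalerN i2 ss; ncring.
have U2 : cnorm (f U) = 1 by apply: cnorm_isom; rewrite -smS -smM U1 sm1.
have -> : h = (2^-1 : R[i]) *: (U + star U).
  by rewrite sU addrACA subrr addr0 scalerDr half_half.
rewrite smZ smD smS cnormZE normc_half.
by have := cnormD_le (f U) (star (f U)); rewrite cnorm_star U2; lra.
Qed.

Lemma conjR (r : R) : Num.conj (r%:C : R[i]) = r%:C.
Proof. exact: conjc_real. Qed.

Lemma normcR (r : R) : Normc.normc r%:C = `|r|.
Proof. by rewrite /= expr0n /= addr0 sqrtr_sqr. Qed.

(** Rescaling to norm 1/2 in [sm_small] gives the bound with a factor 2 for self-adjoint elements.
    Their 2^n-th powers remove the factor, and the C*-identity passes from [star x * x] to [x]. *)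
Lemma sm_contr x : cnorm (f x) <= cnorm x.
Proof.
have sa h : star h = h -> cnorm (f h) <= 2 * cnorm h.
  move=> sh; have [->|h0] := eqVneq h 0; first by rewrite sm0 !cnorm0 mulr0.
  have hp : 0 < cnorm h by rewrite lt_neqAle cnorm_ge0 eq_sym cnorm_eq0 h0.
  have := @sm_small (((2 * cnorm h)^-1)%:C *: h).
  rewrite starZ sh conjR smZ !cnormZE normcR ger0_norm ?invr_ge0 ?mulr_ge0 ?cnorm_ge0//.
  have -> : (2 * cnorm h)^-1 * cnorm h = 2^-1.
    by rewrite invfM -mulrA mulVf ?mulr1// gt_eqF.
  by move=> /(_ erefl (lexx _)); rewrite mulrC ler_pdivrMr ?mulr_gt0// mul1r.
have sa' h : star h = h -> cnorm (f h) <= cnorm h.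
  move=> sh; apply: (@pow2_le _ _ _ 2) => [||n]; try exact: cnorm_ge0.
  rewrite -!cnorm_sa//; last by rewrite -smS sh.
  rewrite -smX sa//; elim: (2 ^ n)%N => [|k IH]; first by rewrite expr0 star1.
  by rewrite exprS starM IH sh -exprSr -exprS.
rewrite -(@ler_pXn2r _ 2)// ?nnegrE ?cnorm_ge0//.
by rewrite -!cstar_identity -smS -smM sa'// starM starK.
Qed.

End Morphism.

Lemma normc_ge0 (R : realType) (c : R[i]) : 0 <= Normc.normc c.
Proof. by case: c => a b; exact: sqrtr_ge0. Qed.

(** The indices range over a finite type, so that products, subtypes and relative commutants give
    new units without renumbering. The diagonal units need not sum to 1: corners of the algebra are
    covered too. *)
Definition munits (R : realType) (A : cstarAlgType R) (I : finType)
    (e : I -> I -> A) : Prop :=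
  [/\ forall i j k l, e i j * e k l = if j == k then e i l else 0,
      forall i j, star (e i j) = e j i & forall i, e i i != 0].

Definition mx_comb (R : realType) (A : cstarAlgType R) (I : finType)
  (e : I -> I -> A) (c : I -> I -> R[i]) : A := \sum_i \sum_j c i j *: e i j.

Definition mspan (R : realType) (A : cstarAlgType R) (I : finType)
  (e : I -> I -> A) : set A := [set x | exists c, x = mx_comb e c].

Definition unital (R : realType) (A : cstarAlgType R) (I : finType)
  (e : I -> I -> A) : Prop := \sum_i e i i = 1.

(** * Matrix units *)

Section MatrixUnits.
Variables (R : realType) (A : cstarAlgType R) (I : finType) (e : I -> I -> A).
Hypothesis em : munits e.
Implicit Types (c d : I -> I -> R[i]) (x y : A).

Lemma muM i j k l : e i j * e k l = if j == k then e i l else 0.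
Proof. by case: em. Qed.

Lemma muMM i j l : e i j * e j l = e i l.
Proof. by rewrite muM eqxx. Qed.

Lemma muS i j : star (e i j) = e j i.
Proof. by case: em. Qed.

Lemma mu_neq0 i j : e i j != 0.
Proof.
case: em => _ _ h; apply/negP => /eqP e0.
by have := h i; rewrite -(muMM i j i) e0 mul0r eqxx.
Qed.

Lemma mu_norm i j : cnorm (e i j) = 1.
Proof.
have h k : cnorm (e k k) = 1.
  have := cstar_identity (e k k); rewrite muS muMM expr2 => h.
  have n0 : cnorm (e k k) != 0 by rewrite cnorm_eq0 mu_neq0.
  by apply: (mulfI n0); rewrite -h mulr1.
have := cstar_identity (e i j); rewrite muS muMM h => /esym/eqP.
by rewrite sqrf_eq1 => /orP[/eqP//|/eqP e1]; have := cnorm_ge0 (e i j); rewrite e1; lra.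
Qed.

Lemma mx_combE c i j k l : e k i * mx_comb e c * e j l = c i j *: e k l.
Proof.
rewrite /mx_comb mulr_sumr mulr_suml (bigD1 i)//= [X in _ + X]big1 ?addr0.
  rewrite mulr_sumr mulr_suml (bigD1 j)//= [X in _ + X]big1 ?addr0.
    by rewrite -scalerAr -scalerAl !muMM.
  by move=> b /negPf bj; rewrite -scalerAr -scalerAl -mulrA (muM i b) bj !mulr0 scaler0.
move=> a /negPf ai; rewrite mulr_sumr mulr_suml big1// => b _.
by rewrite -scalerAr -scalerAl muM eq_sym ai mul0r scaler0.
Qed.

Lemma mx_comb_coef c i j : Normc.normc (c i j) <= cnorm (mx_comb e c).
Proof.
rewrite -[leLHS]mulr1 -(mu_norm i j) -cnormZE -mx_combE.
rewrite (le_trans (cnormMr_le _ (lexx _)))// mu_norm mulr1.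
by rewrite (le_trans (cnormMl_le _ (lexx _)))// mu_norm mul1r.
Qed.

Lemma mx_comb_inj c d : mx_comb e c = mx_comb e d -> forall i j, c i j = d i j.
Proof.
move=> h i j; have := mx_combE c i j i j; rewrite h mx_combE => /eqP.
rewrite -subr_eq0 -scalerBl scaler_eq0 (negPf (mu_neq0 _ _)) orbF subr_eq0.
by move/eqP.
Qed.

Lemma eq_mx_comb c d : (forall i j, c i j = d i j) -> mx_comb e c = mx_comb e d.
Proof. by move=> h; apply: eq_bigr => i _; apply: eq_bigr => j _; rewrite h. Qed.

Lemma mx_combD c d : mx_comb e c + mx_comb e d = mx_comb e (fun i j => c i j + d i j).
Proof.
rewrite -big_split; apply: eq_bigr => i _ /=; rewrite -big_split.
by apply: eq_bigr => j _; rewrite scalerDl.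
Qed.

Lemma mx_combZ (a : R[i]) c : a *: mx_comb e c = mx_comb e (fun i j => a * c i j).
Proof.
rewrite scaler_sumr; apply: eq_bigr => i _; rewrite scaler_sumr.
by apply: eq_bigr => j _; rewrite scalerA.
Qed.

Lemma mx_combM c d :
  mx_comb e c * mx_comb e d = mx_comb e (fun i j => \sum_k c i k * d k j).
Proof.
rewrite mulr_suml; apply: eq_bigr => i _.
under [RHS]eq_bigr do rewrite scaler_suml.
rewrite exchange_big mulr_suml; apply: eq_bigr => k _ /=.
rewrite mulr_sumr (bigD1 k)//= [X in _ + X]big1 ?addr0 => [|l /negPf lk].
  by rewrite mulr_sumr; apply: eq_bigr => j _; rewrite -scalerAr -scalerAl muMM scalerA mulrC.
rewrite mulr_sumr big1// => j _.
by rewrite -scalerAr -scalerAl muM eq_sym lk !scaler0.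
Qed.

Lemma mx_combS c : star (mx_comb e c) = mx_comb e (fun i j => Num.conj (c j i)).
Proof.
rewrite star_sum; under eq_bigr do rewrite star_sum.
rewrite exchange_big; apply: eq_bigr => i _ /=; apply: eq_bigr => j _.
by rewrite starZ muS.
Qed.

Lemma mx_comb_delta i j : mx_comb e (fun k l => ((k == i) && (l == j))%:R) = e i j.
Proof.
rewrite /mx_comb (bigD1 i)//= [X in _ + X]big1 ?addr0 => [|k /negPf ki].
  rewrite (bigD1 j)//= [X in _ + X]big1 ?addr0 => [|k /negPf kj].
    by rewrite !eqxx scale1r.
  by rewrite kj andbF scale0r.
by rewrite big1// => l _; rewrite ki scale0r.
Qed.

Lemma mx_comb_le c : cnorm (mx_comb e c) <= \sum_i \sum_j Normc.normc (c i j).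
Proof.
rewrite (le_trans (cnorm_sum _ _ _))// ler_sum// => i _.
rewrite (le_trans (cnorm_sum _ _ _))// ler_sum// => j _.
by rewrite cnormZE mu_norm mulr1.
Qed.

Lemma mspanD x y : mspan e x -> mspan e y -> mspan e (x + y).
Proof. by move=> [c ->] [d ->]; rewrite mx_combD; eexists. Qed.

Lemma mspanZ (a : R[i]) x : mspan e x -> mspan e (a *: x).
Proof. by move=> [c ->]; rewrite mx_combZ; eexists. Qed.

Lemma mspan0 : mspan e 0.
Proof.
exists (fun _ _ => 0); rewrite /mx_comb big1// => i _; rewrite big1// => j _.
by rewrite scale0r.
Qed.

Lemma mspanN x : mspan e x -> mspan e (- x).
Proof. by move=> h; rewrite -scaleN1r; exact: mspanZ. Qed.

Lemma mspanB x y : mspan e x -> mspan e y -> mspan e (x - y).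
Proof. by move=> hx hy; apply: mspanD => //; exact: mspanN. Qed.

Lemma mspanM x y : mspan e x -> mspan e y -> mspan e (x * y).
Proof. by move=> [c ->] [d ->]; rewrite mx_combM; eexists. Qed.

Lemma mspanS x : mspan e x -> mspan e (star x).
Proof. by move=> [c ->]; rewrite mx_combS; eexists. Qed.

Lemma mspan_sum (K : Type) (r : seq K) (P : pred K) (F : K -> A) :
  (forall k, P k -> mspan e (F k)) -> mspan e (\sum_(k <- r | P k) F k).
Proof. by move=> h; apply: big_ind => //; [exact: mspan0|exact: mspanD]. Qed.

Lemma mspan_mu i j : mspan e (e i j).
Proof. by rewrite -mx_comb_delta; eexists. Qed.

Lemma mspanP (S : set A) : S 0 -> (forall x y, S x -> S y -> S (x + y)) ->
  (forall (c : R[i]) x, S x -> S (c *: x)) -> (forall i j, S (e i j)) ->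
  mspan e `<=` S.
Proof.
move=> S0 SD SZ Se _ [c ->]; apply: (big_ind S) => // i _.
by apply: (big_ind S) => // j _; exact: SZ.
Qed.

Lemma mspan_comm y : (forall i j, e i j * y = y * e i j) ->
  forall x, mspan e x -> x * y = y * x.
Proof.
move=> h; apply: mspanP.
- by rewrite mul0r mulr0.
- by move=> x z hx hz; rewrite mulrDl mulrDr hx hz.
- by move=> c x hx; rewrite -scalerAl -scalerAr hx.
- exact: h.
Qed.

Lemma mu1_l i j : (\sum_k e k k) * e i j = e i j.
Proof.
rewrite mulr_suml (bigD1 i)//= muMM big1 ?addr0// => k /negPf ki.
by rewrite muM ki.
Qed.

Lemma mu1_r i j : e i j * (\sum_k e k k) = e i j.
Proof.
rewrite mulr_sumr (bigD1 j)//= muMM big1 ?addr0// => k /negPf kj.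
by rewrite muM eq_sym kj.
Qed.

Lemma mspan1_l x : mspan e x -> (\sum_k e k k) * x = x.
Proof.
apply: (mspanP (S := fun x => _ * x = x)).
- by rewrite mulr0.
- by move=> y z hy hz; rewrite mulrDr hy hz.
- by move=> c y hy; rewrite -scalerAr hy.
- exact: mu1_l.
Qed.

Lemma mspan1_r x : mspan e x -> x * (\sum_k e k k) = x.
Proof.
apply: (mspanP (S := fun x => x * _ = x)).
- by rewrite mul0r.
- by move=> y z hy hz; rewrite mulrDl hy hz.
- by move=> c y hy; rewrite -scalerAl hy.
- exact: mu1_r.
Qed.

Definition mu_diag (z : I -> R[i]) := \sum_i z i *: e i i.

Lemma mspan_diag z : mspan e (mu_diag z).
Proof. by apply: mspan_sum => i _; apply: mspanZ; exact: mspan_mu. Qed.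

Lemma mu_diagMl z i j : mu_diag z * e i j = z i *: e i j.
Proof.
rewrite mulr_suml (bigD1 i)//= -scalerAl muMM big1 ?addr0// => k /negPf ki.
by rewrite -scalerAl muM ki scaler0.
Qed.

Lemma mu_diagMr z i j : e i j * mu_diag z = z j *: e i j.
Proof.
rewrite mulr_sumr (bigD1 j)//= -scalerAr muMM big1 ?addr0// => k /negPf kj.
by rewrite -scalerAr muM eq_sym kj scaler0.
Qed.

Lemma mu_diagM w z : mu_diag w * mu_diag z = mu_diag (fun i => w i * z i).
Proof.
rewrite {1 3}/mu_diag mulr_suml; apply: eq_bigr => i _.
by rewrite -scalerAl mu_diagMr scalerA.
Qed.

Lemma mu_diagS z : star (mu_diag z) = mu_diag (fun i => Num.conj (z i)).
Proof. by rewrite star_sum; apply: eq_bigr => i _; rewrite starZ muS. Qed.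

Lemma mu_diagB w z : mu_diag w - mu_diag z = mu_diag (fun i => w i - z i).
Proof. by rewrite -sumrB; apply: eq_bigr => i _; rewrite scalerBl. Qed.

Lemma mu_diagZ (c : R[i]) z : c *: mu_diag z = mu_diag (fun i => c * z i).
Proof. by rewrite scaler_sumr; apply: eq_bigr => i _; rewrite scalerA. Qed.

Lemma mu_diag_coef z i : Normc.normc (z i) <= cnorm (mu_diag z).
Proof.
rewrite -[leLHS]mulr1 -(mu_norm i i) -cnormZE -mu_diagMl.
by rewrite (le_trans (cnormMr_le _ (lexx _)))// mu_norm mulr1.
Qed.

Lemma mu_diag_inj w z : mu_diag w = mu_diag z -> w =1 z.
Proof.
move=> h i; have := mu_diagMl w i i; rewrite h mu_diagMl => /eqP.
rewrite -subr_eq0 -scalerBl scaler_eq0 (negPf (mu_neq0 _ _)) orbF subr_eq0.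
by move/eqP.
Qed.

Lemma normcX (c : R[i]) n : Normc.normc (c ^+ n) = Normc.normc c ^+ n.
Proof. by elim: n => [|n IH]; rewrite ?expr0 ?Normc.normc1// !exprS Normc.normcM IH. Qed.

Lemma normc_conj (c : R[i]) : Normc.normc (Num.conj c) = Normc.normc c.
Proof. by case: c => a b /=; rewrite sqrrN. Qed.

(** The triangle inequality loses a factor [#|I|]. Applied to the 2^n-th powers of the diagonal
    self-adjoint element [star x * x], it loses nothing in the limit by [pow2_le]. *)
Lemma mu_diag_le z k : 0 <= k -> (forall i, Normc.normc (z i) <= k) ->
  cnorm (mu_diag z) <= k.
Proof.
move=> k0 hz; rewrite -(@ler_pXn2r _ 2)// ?nnegrE ?cnorm_ge0//.
rewrite -cstar_identity mu_diagS mu_diagM.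
set y := fun i : I => _; pose r := #|I|%:R : R.
apply: (@pow2_le _ _ _ r) => [||n]; rewrite ?cnorm_ge0 ?exprn_ge0//.
rewrite -cnorm_sa; last first.
  by rewrite mu_diagS; apply: eq_bigr => i _; rewrite /y rmorphM /= conjCK mulrC.
have yX m : mu_diag y ^+ m.+1 = mu_diag (fun i => y i ^+ m.+1).
  elim: m => [|m IH]; first by rewrite expr1.
  by rewrite exprS IH mu_diagM; apply: eq_bigr => i _; rewrite -exprS.
rewrite -(prednK (_ : 0 < 2 ^ n)%N) ?expn_gt0// yX.
rewrite (le_trans (cnorm_sum _ _ _))// /r mulr_natl -sumr_const ler_sum// => i _.
rewrite cnormZE mu_norm mulr1 normcX lerXn2r ?nnegrE ?normc_ge0 ?exprn_ge0//.
by rewrite Normc.normcM normc_conj -expr2 lerXn2r ?nnegrE ?normc_ge0.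
Qed.
End MatrixUnits.

(** * Uniqueness of the C*-norm on a matrix algebra *)

Section NormUnique.
Variables (R : realType) (A B : cstarAlgType R) (I : finType).
Variables (e : I -> I -> A) (f : I -> I -> B).
Hypotheses (em : munits e) (fm : munits f).

Let same (x : A) (y : B) := exists c, x = mx_comb e c /\ y = mx_comb f c.

Let sameM x y x' y' : same x y -> same x' y' -> same (x * x') (y * y').
Proof.
move=> [c [-> ->]] [d [-> ->]]; rewrite !mx_combM//.
by exists (fun i j => \sum_k c i k * d k j).
Qed.

Lemma mx_comb_norm_le c : cnorm (mx_comb e c) <= cnorm (mx_comb f c).
Proof.
pose k : R := \sum_(i : I) \sum_(j : I) 1.
have bound d : cnorm (mx_comb e d) <= k * cnorm (mx_comb f d).
  rewrite (le_trans (mx_comb_le em _))// mulr_suml ler_sum// => i _.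
  by rewrite mulr_suml ler_sum// => j _; rewrite mul1r mx_comb_coef.
(* The constant [k] of [bound] disappears on taking [2 ^ n]-th roots of the norms
   of the powers of a self-adjoint element. *)
have sa x y : star x = x -> star y = y -> same x y -> cnorm x <= cnorm y.
  move=> sx sy sxy; apply: (@pow2_le _ _ _ k) => [||n]; rewrite ?cnorm_ge0//.
  rewrite -!cnorm_sa// -(prednK (_ : 0 < 2 ^ n)%N) ?expn_gt0//.
  have [d [-> ->]] : same (x ^+ (2 ^ n).-1.+1) (y ^+ (2 ^ n).-1.+1).
    elim: (2 ^ n).-1 => [|m IH]; first by rewrite !expr1.
    by rewrite exprS [y ^+ _]exprS; exact: sameM.
  exact: bound.
rewrite -(@ler_pXn2r _ 2)// ?nnegrE ?cnorm_ge0// -!cstar_identity.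
apply: sa; rewrite ?starM ?starK//; apply: sameM; last by exists c.
by rewrite !mx_combS//; eexists.
Qed.

End NormUnique.

Lemma mx_comb_norm (R : realType) (A B : cstarAlgType R) (I : finType)
    (e : I -> I -> A) (f : I -> I -> B) c : munits e -> munits f ->
  cnorm (mx_comb e c) = cnorm (mx_comb f c).
Proof. by move=> em fm; apply/le_anti; rewrite !mx_comb_norm_le. Qed.

(** * Diagonalisation of normal elements *)

Section Spectral.
Variables (R : realType) (A : cstarAlgType R) (I : finType) (e : I -> I -> A).
Hypothesis em : munits e.
Local Open Scope sesquilinear_scope.

Let E (M : 'M[R[i]]_#|I|) : A :=
  mx_comb e (fun i j => M (enum_rank i) (enum_rank j)).

Let EM M N : E (M *m N) = E M * E N.
Proof.
rewrite /E mx_combM//; apply: eq_mx_comb => i j.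
by rewrite mxE (reindex enum_rank) //; exists enum_val => k _; rewrite ?enum_rankK ?enum_valK.
Qed.

Let ES M : star (E M) = E (M^t*).
Proof. by rewrite /E mx_combS//; apply: eq_mx_comb => i j; rewrite !mxE. Qed.

Let ED M N : E (M + N) = E M + E N.
Proof. by rewrite /E mx_combD; apply: eq_mx_comb => i j; rewrite !mxE. Qed.

Let EZ a M : E (a *: M) = a *: E M.
Proof. by rewrite /E mx_combZ; apply: eq_mx_comb => i j; rewrite !mxE. Qed.

Let E_surj x : mspan e x -> exists M, x = E M.
Proof.
move=> [c ->]; exists (\matrix_(a, b) c (enum_val a) (enum_val b)).
by apply: eq_mx_comb => i j; rewrite mxE !enum_rankK.
Qed.

Let E_inj M N : E M = E N -> M = N.
Proof.
move=> /(mx_comb_inj em) h; apply/matrixP => a b.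
by have := h (enum_val a) (enum_val b); rewrite !enum_valK.
Qed.

Let Edelta i j : E (delta_mx (enum_rank i) (enum_rank j)) = e i j.
Proof.
rewrite -(mx_comb_delta e); apply: eq_mx_comb => k l.
by rewrite mxE !(inj_eq enum_rank_inj).
Qed.

Let E1 : E 1%:M = \sum_i e i i.
Proof.
rewrite /E /mx_comb; apply: eq_bigr => i _; rewrite (bigD1 i)//= big1 ?addr0.
  by rewrite mxE eqxx scale1r.
by move=> j /negPf ji; rewrite mxE (inj_eq enum_rank_inj) eq_sym ji scale0r.
Qed.

(** The spectral theorem for complex matrices transported by [E]: the new units are the old ones
    conjugated by the diagonalising unitary. The sum of the diagonal units is tracked because it is
    the unit of the span, which may differ from 1. *)
Lemma normal_diag x : mspan e x -> x * star x = star x * x ->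
  exists (g : I -> I -> A) (z : I -> R[i]),
    [/\ munits g, mspan g = mspan e, \sum_i g i i = \sum_i e i i &
        x = mu_diag g z].
Proof.
move=> /E_surj[M ->]; rewrite ES -!EM => /E_inj/normalmxP/orthomx_spectralP.
set P := spectralmx M; set s := spectral_diag M => MP.
have PU : P \is unitarymx := spectral_unitarymx M.
have PV : P *m P^t* = 1%:M by apply/unitarymxP.
have VP : P^t* *m P = 1%:M by rewrite -invmx_unitary// mulVmx// spectral_unit.
pose D i j : 'M[R[i]]_#|I| := delta_mx (enum_rank i) (enum_rank j).
pose G N := E (P^t* *m N *m P).
have GM N N' : G N * G N' = G (N *m N').
  by rewrite /G -EM; congr E; rewrite !mulmxA -(mulmxA _ P) PV mulmx1.
have GD N N' : G (N + N') = G N + G N' by rewrite /G mulmxDr mulmxDl ED.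
have GZ a N : G (a *: N) = a *: G N by rewrite /G -scalemxAr -scalemxAl EZ.
have G0 : G 0 = 0 by have := GZ 0 0; rewrite !scale0r.
have G_sum (K : finType) (F : K -> 'M[R[i]]_#|I|) : G (\sum_k F k) = \sum_k G (F k).
  exact: (big_morph _ GD G0).
have G1 : G 1%:M = \sum_i e i i by rewrite /G mulmx1 VP E1.
have GS N : star (G N) = G (N^t*).
  by rewrite /G ES !trmx_mul !map_mxM !mulmxA trmxCK.
pose g i j := G (D i j).
have D1 : \sum_i D i i = 1%:M :> 'M[R[i]]_#|I|.
  rewrite mx1_sum_delta (reindex enum_rank) //.
  by exists enum_val => k _; rewrite ?enum_rankK ?enum_valK.
have gM i j k l : g i j * g k l = if j == k then g i l else 0.
  rewrite /g GM mul_delta_mx_cond (inj_eq enum_rank_inj).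
  by case: eqP => _; rewrite ?mulr1n ?mulr0n.
have gG N : mspan g (G N).
  rewrite (matrix_sum_delta N) G_sum; apply: mspan_sum => a _.
  rewrite G_sum; apply: mspan_sum => b _; rewrite GZ; apply: mspanZ.
  by rewrite -[a]enum_valK -[b]enum_valK; exact: mspan_mu.
have EG N : E N = G (P *m N *m P^t*).
  by rewrite /G !mulmxA VP mul1mx -mulmxA VP mulmx1.
have spane : mspan g = mspan e.
  apply/seteqP; split.
    apply: mspanP; [exact: mspan0|exact: mspanD|exact: mspanZ|].
    by move=> i j; eexists.
  by move=> _ /E_surj[N ->]; rewrite EG; exact: gG.
exists g, (fun i => s 0 (enum_rank i)); split => //.
- split => //.
    move=> i j; rewrite /g GS; congr G; apply/matrixP => a b.
    by rewrite !mxE rmorph_nat andbC.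
  (* One vanishing diagonal unit kills all of them, hence [G 1%:M], hence every [G N]; but [e i i]
     has this form. *)
  move=> i; apply/negP => /eqP gi.
  have : e i i = 0.
    rewrite -Edelta EG; set N := _ *m _ *m _.
    have gk k : G (D k k) = 0.
      have h1 : g k i * g i i = g k i by rewrite gM eqxx.
      have h2 : g k i * g i k = g k k by have := gM k i i k; rewrite eqxx.
      by rewrite -/(g k k) -h2 -h1 gi mulr0 mul0r.
    have G10 : G 1%:M = 0.
      by rewrite -D1 G_sum; apply: big1 => k _; exact: gk.
    by have := GM 1%:M N; rewrite G10 mul0r mul1mx => <-.
  by move/eqP; rewrite (negPf (mu_neq0 em i i)).
- by rewrite -G1 -D1 G_sum.
- rewrite [in LHS]MP invmx_unitary// -/(G _) diag_mx_sum_delta G_sum.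
  rewrite (reindex enum_rank) /=; last first.
    by exists enum_val => k _; rewrite ?enum_rankK ?enum_valK.
  by apply: eq_bigr => i _; rewrite GZ.
Qed.

End Spectral.

(** * Products of commuting matrix units *)

Section Product.
Variables (R : realType) (A : cstarAlgType R) (I J : finType).

Definition mu_prod (e : I -> I -> A) (g : J -> J -> A) : I * J -> I * J -> A :=
  fun p q => e p.1 q.1 * g p.2 q.2.

Variables (e : I -> I -> A) (g : J -> J -> A).
Hypotheses (em : munits e) (gm : munits g) (e1 : unital e) (g1 : unital g).
Hypothesis eg : forall i j p q, e i j * g p q = g p q * e i j.

Lemma mu_prod_unital : unital (mu_prod e g).
Proof.
rewrite /unital -(pair_bigA _ (fun i j => e i i * g j j)) /=.
by under eq_bigr do rewrite -mulr_sumr g1 mulr1.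
Qed.

Lemma mu_prodM i j k l p q r s :
  (e i j * g p q) * (e k l * g r s) = (e i j * e k l) * (g p q * g r s).
Proof. by rewrite -!mulrA; congr (_ * _); rewrite !mulrA eg. Qed.

Lemma mu_prod_munits : munits (mu_prod e g).
Proof.
split.
- move=> [i p] [j q] [k r] [l s]; rewrite /mu_prod /= mu_prodM !muM//.
  rewrite xpair_eqE; case: (j == k); rewrite ?mul0r//=.
  by case: (q == r); rewrite ?mulr0.
- by move=> [i p] [j q]; rewrite /mu_prod /= starM !muS.
- move=> [i p]; rewrite /mu_prod /=; apply/negP => /eqP h.
  (* The vanishing unit is a factor of each [e j j * g q q], and these sum to 1. *)
  have : 1 = 0 :> A.
    rewrite -mu_prod_unital; apply: big1 => -[j q] _; rewrite /mu_prod /=.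
    have -> : e j j * g q q = (e j i * g q p) * ((e i i * g p p) * (e i j * g p q)).
      by rewrite (mu_prodM i i i j) !muMM// mu_prodM !muMM.
    by rewrite h mul0r mulr0.
  by move/eqP; rewrite oner_eq0.
Qed.

Lemma mu_prod_l i j : e i j = \sum_p mu_prod e g (i, p) (j, p).
Proof. by rewrite /mu_prod /= -mulr_sumr g1 mulr1. Qed.

Lemma mu_prod_r p q : g p q = \sum_i mu_prod e g (i, p) (i, q).
Proof. by rewrite /mu_prod /= -mulr_suml e1 mul1r. Qed.

End Product.

(** * Flows on matrix subalgebras *)

Section Circle.
Variable R : realType.
Implicit Types (x y t : R).

Definition expi x : R[i] := cos x +i* sin x.

Lemma expi0 : expi 0 = 1.
Proof. by rewrite /expi cos0 sin0. Qed.

Lemma expiD x y : expi (x + y) = expi x * expi y.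
Proof. by apply/eqP; rewrite /expi cosD sinD eq_complex /= (addrC (cos x * sin y)) !eqxx. Qed.

Lemma expiN x : expi (- x) = Num.conj (expi x).
Proof. by rewrite /expi cosN sinN. Qed.

Lemma expiB x y : expi (x - y) = expi x * Num.conj (expi y).
Proof. by rewrite expiD expiN. Qed.

Lemma normc_expi x : Normc.normc (expi x) = 1.
Proof. by rewrite /= cos2Dsin2 sqrtr1. Qed.

Lemma normc_le (a b : R) : Normc.normc (a +i* b) <= `|a| + `|b|.
Proof.
rewrite -(@ler_pXn2r _ 2)// ?nnegrE ?addr_ge0// ?sqrtr_ge0//.
rewrite sqr_sqrtr ?addr_ge0 ?sqr_ge0// sqrrD !real_normK ?num_real//.
have : 0 <= `|a| * `|b| by rewrite mulr_ge0.
by rewrite mulr2n; lra.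
Qed.

Lemma derive_eps (f : R -> R) x df : is_derive x 1 f df ->
  forall e : R, 0 < e -> exists2 d : R, 0 < d & forall h, `|h| < d ->
    `|f (h + x) - f x - h * df| <= e * `|h|.
Proof.
move=> [fd fE] e e0.
have := fd; rewrite /derivable -/(derive f x 1) => /cvg_ballP/(_ e e0).
rewrite -/('D_1 f x) fE => /nbhs_ballP[d /= d0 hd]; exists d => // h hh.
have [->|h0] := eqVneq h 0; first by rewrite add0r subrr mul0r subr0 normr0 mulr0.
have hb : ball (0 : R) d h by rewrite -ball_normE /ball_ /= sub0r normrN.
have := hd h hb h0.
rewrite /ball /= /shift /= [h *: 1]mulr1 => /ltW hle.
have -> : f (h + x) - f x - h * df = - (h * (df - h^-1 * (f (h + x) - f x))).
  by rewrite mulrBr mulVKf//; ring.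
by rewrite normrN normrM mulrC ler_wpM2r.
Qed.

Lemma expi_derive (e : R) : 0 < e -> exists2 d : R, 0 < d & forall h, `|h| < d ->
  Normc.normc (expi h - 1 - 'i * h%:C) <= e * `|h|.
Proof.
move=> e0; have e2 : 0 < e / 2 by lra.
have [d1 d10 h1] := derive_eps (is_derive_cos 0) e2.
have [d2 d20 h2] := derive_eps (is_derive_sin 0) e2.
exists (Num.min d1 d2); first by rewrite lt_min d10.
move=> h; rewrite lt_min => /andP[/h1 + /h2].
rewrite sin0 cos0 !addr0 oppr0 mulr0 !subr0 mulr1 ?addr0.
have -> : expi h - 1 - 'i * h%:C = (cos h - 1) +i* (sin h - h).
  by apply/eqP; rewrite eq_complex /=; apply/andP; split; apply/eqP; ring.
have := normc_le (cos h - 1) (sin h - h); lra.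
Qed.

Lemma expi_cont (e : R) : 0 < e -> exists2 d : R, 0 < d & forall h, `|h| < d ->
  Normc.normc (expi h - 1) <= e.
Proof.
move=> e0; have [d d0 hd] := expi_derive ltr01.
exists (Num.min d (e / 2)); first by rewrite lt_min d0; lra.
move=> h; rewrite lt_min => /andP[/hd h1 h2].
have -> : expi h - 1 = (expi h - 1 - 'i * h%:C) + 'i * h%:C by rewrite subrK.
rewrite (le_trans (le_normcD _ _))// Normc.normcM normcR.
have -> : Normc.normc ('i : R[i]) = 1 by rewrite /= expr0n expr1n add0r sqrtr1.
lra.
Qed.

Lemma expi_dist x y : Normc.normc (expi x - expi y) = Normc.normc (expi (x - y) - 1).
Proof.
have -> : expi x - expi y = (expi (x - y) - 1) * expi y.
  by rewrite mulrBl mul1r -expiD subrK.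
by rewrite Normc.normcM normc_expi mulr1.
Qed.

Lemma expi_arg (z : R[i]) : Normc.normc z = 1 -> 0 <= complex.Re z ->
  exists2 x, `|x| <= pi / 2 & z = expi x.
Proof.
case: z => a b /= /(congr1 (fun x => x ^+ 2)).
rewrite expr1n sqr_sqrtr ?addr_ge0 ?sqr_ge0// => ab a0.
have b1 : -1 <= b <= 1 by have := sqr_ge0 a; rewrite expr2 in ab *; nra.
exists (asin b).
  by rewrite ler_norml asin_geNpi2// asin_lepi2.
rewrite /expi cos_asin// asinK ?in_itv//=.
have -> : 1 - b ^+ 2 = a ^+ 2 by lra.
by rewrite sqrtr_sqr ger0_norm.
Qed.

(** Separates the two square roots of a phase: when [flow_diag] halves the time, this excludes the
    root opposite to the expected one. *)
Lemma normc_1Dexpi x : `|x| <= pi / 2 -> 1 <= Normc.normc (1 + expi x).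
Proof.
rewrite ler_norml => /cos_ge0_pihalf c0 /=.
rewrite -(@ler_pXn2r _ 2)// ?nnegrE ?sqrtr_ge0// sqr_sqrtr ?addr_ge0 ?sqr_ge0//.
have := cos2Dsin2 x; rewrite expr1n add0r !expr2; nra.
Qed.

Lemma dyadic_dense (tau t d : R) : 0 < tau -> 0 <= t -> 0 < d ->
  exists m k, `|t - (tau / 2 ^+ m) *+ k| < d.
Proof.
move=> tau0 t0 d0; have d2 : 0 < d / 2 by lra.
have [m /(_ m (leqnn m)) hm] := geo_small tau d2.
have q0 : 0 < tau / 2 ^+ m by rewrite divr_gt0// exprn_gt0.
set q := tau / 2 ^+ m in hm q0 *.
exists m, (Num.truncn (t / q)).
have /andP[] := truncn_itv (divr_ge0 t0 (ltW q0)).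
set k := Num.truncn _; rewrite ler_pdivlMr// ltr_pdivrMr// -natr1 -[q *+ k]mulr_natl.
move=> h1 h2; rewrite ger0_norm; lra.
Qed.

Lemma finite_radius (K : finType) (P : K -> R -> Prop) :
  (forall k, exists2 d : R, 0 < d & forall s, `|s| < d -> P k s) ->
  exists2 d : R, 0 < d & forall k s, `|s| < d -> P k s.
Proof.
move=> h.
have [d d0 hd] : exists2 d : R, 0 < d & forall k, k \in enum K -> forall s, `|s| < d -> P k s.
  elim: (enum K) => [|k l [d d0 IH]]; first by exists 1.
  have [d' d'0 hd'] := h k.
  exists (Num.min d d') => [|j]; first by rewrite lt_min d0.
  rewrite inE => /orP[/eqP ->|/IH hj] s; rewrite lt_min => /andP[sd sd'].
    exact: hd'.
  exact: hj.
by exists d => // k; apply: hd; rewrite mem_enum.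
Qed.

End Circle.

Section FlowBasics.
Variables (R : realType) (A : cstarAlgType R) (f : flow A).
Implicit Types (x y : A) (s t : R).

Lemma flowZ t (c : R[i]) x : f t (c *: x) = c *: f t x.
Proof. exact: (smZ (flow_morphism f t)). Qed.
Lemma flowDD t x y : f t (x + y) = f t x + f t y.
Proof. exact: (smD (flow_morphism f t)). Qed.
Lemma flowB t x y : f t (x - y) = f t x - f t y.
Proof. exact: (smB (flow_morphism f t)). Qed.
Lemma flowM t x y : f t (x * y) = f t x * f t y.
Proof. exact: (smM (flow_morphism f t)). Qed.
Lemma flowS t x : f t (star x) = star (f t x).
Proof. exact: (smS (flow_morphism f t)). Qed.
Lemma flow1 t : f t 1 = 1.
Proof. exact: (sm1 (flow_morphism f t)). Qed.
Lemma flow_z t : f t 0 = 0.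
Proof. exact: (sm0 (flow_morphism f t)). Qed.
Lemma flow_sum t (I : Type) (r : seq I) (P : pred I) (F : I -> A) :
  f t (\sum_(i <- r | P i) F i) = \sum_(i <- r | P i) f t (F i).
Proof. exact: (sm_sum (flow_morphism f t)). Qed.

Lemma flowK t x : f (- t) (f t x) = x.
Proof. by rewrite -flowD addNr flow0. Qed.
Lemma flowVK t x : f t (f (- t) x) = x.
Proof. by rewrite -flowD subrr flow0. Qed.

Lemma flow_cnorm t x : cnorm (f t x) = cnorm x.
Proof.
apply/le_anti; rewrite (sm_contr (flow_morphism f t))/=.
by rewrite -{1}(flowK t x) (sm_contr (flow_morphism f (- t))).
Qed.

Lemma flow_cont x t (e : R) : 0 < e ->
  exists2 d : R, 0 < d & forall s, `|t - s| < d -> cnorm (f t x - f s x) < e.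
Proof. by move=> e0; have /continuous_cnorm := @flow_continuous R A f x; exact. Qed.

Lemma flow_cont0 x (e : R) : 0 < e ->
  exists2 d : R, 0 < d & forall s, `|s| < d -> cnorm (f s x - x) < e.
Proof.
move=> e0; have [d d0 hd] := flow_cont x 0 e0; exists d => // s sd.
by rewrite cnormB -[x in x - _](flow0 f); apply: hd; rewrite sub0r normrN.
Qed.

(** Strong continuity is uniform on a finite-dimensional span, since only finitely many units have
    to move little and the norm dominates the coefficients. The successor in [N] keeps the divisor
    positive when [I] is empty. *)
Lemma flow_near_id (I : finType) (e : I -> I -> A) (k : R) : munits e -> 0 < k ->
  exists2 d : R, 0 < d & forall s, `|s| < d -> forall x, mspan e x ->
    cnorm (f s x - x) <= k * cnorm x.
Proof.
move=> em k0; pose N : R := (#|I| ^ 2).+1%:R.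
have N0 : 0 < N by rewrite ltr0Sn.
have [d d0 hd] := @finite_radius R (I * I)%type
  (fun ij s => cnorm (f s (e ij.1 ij.2) - e ij.1 ij.2) < k / N)
  (fun ij => flow_cont0 (e ij.1 ij.2) (divr_gt0 k0 N0)).
exists d => // s sd x [c ->].
have -> : f s (mx_comb e c) - mx_comb e c =
    \sum_i \sum_j c i j *: (f s (e i j) - e i j).
  rewrite /mx_comb flow_sum -sumrB; apply: eq_bigr => i _.
  by rewrite flow_sum -sumrB; apply: eq_bigr => j _; rewrite flowZ scalerBr.
rewrite (le_trans (cnorm_sum _ _ _))//.
apply: (@le_trans _ _ (\sum_(i : I) \sum_(j : I) (k / N * cnorm (mx_comb e c)))).
  apply: ler_sum => i _; rewrite (le_trans (cnorm_sum _ _ _))// ler_sum// => j _.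
  rewrite cnormZE mulrC ler_pM ?cnorm_ge0 ?normc_ge0 ?mx_comb_coef//.
  exact/ltW/(hd (i, j)).
rewrite !sumr_const -mulrnA -[_ *+ _]mulr_natl !mulrA.
rewrite ler_wpM2r ?cnorm_ge0// ler_pdivrMr// mulrC ler_pM2l//.
by rewrite ler_nat mulnn.
Qed.

End FlowBasics.

Section FlowDiagonal.
Variables (R : realType) (A : cstarAlgType R) (f : flow A).
Variables (I : finType) (e : I -> I -> A).
Hypothesis em : munits e.
Hypothesis fe : forall t x, mspan e x -> mspan e (f t x).
Implicit Types (x y : A) (s t : R).

Let P : A := \sum_i e i i.

Let P_span : mspan e P.
Proof. by apply: mspan_sum => i _; exact: mspan_mu. Qed.

Lemma flow_unit t : f t P = P.
Proof.
have h x : mspan e x -> f t P * x = x.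
  move=> hx; rewrite -{1}(flowVK f t x) -flowM mspan1_l ?flowVK//; exact: fe.
by rewrite -[RHS](h P P_span) mspan1_r//; exact: fe.
Qed.

Lemma corner_scalar i x : mspan e x -> exists c : R[i], e i i * x * e i i = c *: e i i.
Proof. by move=> [c ->]; exists (c i i); rewrite mx_combE. Qed.

(* A flow that is near the identity at time [t] is implemented there by a
   multiple of a unitary near 1, which is then diagonalised. *)
Lemma flow_small_diag t : (#|I| > 0)%N ->
  (forall x, mspan e x -> cnorm (f t x - x) <= (4 * #|I|%:R)^-1 * cnorm x) ->
  exists (g : I -> I -> A) (a : I -> R),
    [/\ munits g, mspan g = mspan e, \sum_i g i i = P &
        (forall i, `|a i| <= pi / 2) /\
        forall i j, f t (g i j) = expi (a i - a j) *: g i j].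
Proof.
move=> I0 near.
have N0 : 0 < #|I|%:R :> R by rewrite ltr0n.
have N1 : 1 <= #|I|%:R :> R by rewrite ler1n.
have /card_gt0P[i0 _] := I0.
have near_mu i j : cnorm (f t (e i j) - e i j) <= (4 * #|I|%:R)^-1.
  by have := near _ (mspan_mu e i j); rewrite mu_norm// mulr1.
(* Averaging over the units makes [U] intertwine the flow at time [t] with the identity on the span
   ([Ucomm]). *)
pose U := \sum_i f t (e i i0) * e i0 i.
have Uspan : mspan e U.
  by apply: mspan_sum => i _; apply: mspanM => //; [apply: fe|]; exact: mspan_mu.
have Ucomm i j : f t (e i j) * U = U * e i j.
  rewrite mulr_sumr (bigD1 j)//= [X in _ + X]big1 ?addr0 => [|k /negPf kj].
    rewrite mulr_suml (bigD1 i)//= [X in _ = _ + X]big1 ?addr0 => [|k /negPf ki].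
      by rewrite mulrA -flowM -mulrA !muMM.
    by rewrite -mulrA muM// ki mulr0.
  by rewrite mulrA -flowM muM// eq_sym kj flow_z mul0r.
have Ucomm' i j : star U * f t (e i j) = e i j * star U.
  by rewrite -(muS em j i) flowS -!starM Ucomm.
have UP : U * P = U by rewrite mspan1_r.
have PU : P * U = U by rewrite mspan1_l.
(* Such an average lies in the centre of the span; both [star U * U] and [U * star U] reduce to
   it. *)
have scalar x : mspan e x -> exists c, \sum_i e i i0 * x * e i0 i = c *: P.
  move=> hx; have [c hc] := corner_scalar i0 hx; exists c.
  rewrite scaler_sumr; apply: eq_bigr => i _.
  rewrite -(muMM em i i0 i0) -(muMM em i0 i0 i) -!mulrA (mulrA x) (mulrA (e i0 i0)).
  by rewrite (mulrA (e i0 i0)) hc -scalerAl -scalerAr !muMM.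
have [c SU] : exists c, star U * U = c *: P.
  have [c hc] := scalar U Uspan; exists c.
  rewrite star_sum mulr_suml -hc; apply: eq_bigr => i _.
  by rewrite starM -flowS !muS// -!mulrA Ucomm.
have [c' US] : exists c', U * star U = c' *: P.
  have [c' hc] := scalar _ (fe (- t) (mspanS em Uspan)); exists c'.
  rewrite -(flow_unit t) -flowZ -hc flow_sum [in LHS]/U mulr_suml.
  by apply: eq_bigr => i _; rewrite !flowM flowVK -!mulrA Ucomm'.
have UUP : cnorm (U - P) <= 4^-1.
  have -> : U - P = \sum_i (f t (e i i0) - e i i0) * e i0 i.
    by rewrite /U /P -sumrB; apply: eq_bigr => i _; rewrite mulrBl muMM.
  rewrite (le_trans (cnorm_sum _ _ _))//.
  apply: (@le_trans _ _ (\sum_(i : I) (4 * #|I|%:R)^-1)).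
    apply: ler_sum => i _; rewrite -[leRHS]mulr1 cnormMM_le ?near_mu//.
    by rewrite mu_norm.
  by rewrite sumr_const -[_ *+ _]mulr_natl invfM mulrCA mulfV ?mulr1// gt_eqF.
(* Compare the two bracketings of U U* U; [U] is not zero because it is close to [P]. Hence [U] is
   normal and can be diagonalised. *)
have cc' : c = c'.
  have : c *: U = c' *: U.
    by rewrite -{1}UP scalerAr -SU mulrA US -scalerAl PU.
  move/eqP; rewrite -subr_eq0 -scalerBl scaler_eq0 subr_eq0.
  case/orP => /eqP // U0; exfalso.
  have := cnormM_le P (e i0 i0); rewrite mu1_l// mu_norm// mulr1.
  by move: UUP; rewrite U0 sub0r cnormN; lra.
have [|g [z [gm ge g1 Uz]]] := normal_diag em Uspan; first by rewrite SU US cc'.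
have zr i : Normc.normc (z i - 1) <= 4^-1.
  rewrite (le_trans _ UUP)// Uz -[P]g1.
  have -> : \sum_i g i i = mu_diag g (fun=> 1).
    by apply: eq_bigr => k _; rewrite scale1r.
  by rewrite mu_diagB (mu_diag_coef gm (fun k => z k - 1)).
have zc i : z i * Num.conj (z i) = c.
  have := US; rewrite Uz mu_diagS// mu_diagM// -cc' /P -g1.
  have -> : c *: \sum_i g i i = mu_diag g (fun=> c) by rewrite scaler_sumr.
  by move/(mu_diag_inj gm)/(_ i).
have normc2 (w : R[i]) : w * Num.conj w = ((Normc.normc w) ^+ 2)%:C.
  case: w => a b; rewrite /= sqr_sqrtr ?addr_ge0 ?sqr_ge0//.
  by apply/eqP; rewrite eq_complex /=; apply/andP; split; apply/eqP; ring.
have z4 i : 3 / 4 <= Normc.normc (z i).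
  have := le_normcD (z i) (1 - z i); rewrite subrKC Normc.normc1.
  by rewrite -(normcN (1 - _)) opprB; have := zr i; lra.
pose r := Normc.normc (z i0).
have r0 : 0 < r by rewrite /r (lt_le_trans _ (z4 i0)).
have cr : c = (r ^+ 2)%:C by rewrite -(zc i0) normc2.
have zn i : Normc.normc (z i) = r.
  apply/eqP; rewrite -(@eqrXn2 _ 2)// ?normc_ge0//.
  by have := normc2 (z i); rewrite zc cr => /complexI ->.
have aP i : exists a, `|a| <= pi / 2 /\ (r^-1)%:C * z i = expi a.
  have [||a a2 ->] := @expi_arg R ((r^-1)%:C * z i); last by exists a.
    by rewrite Normc.normcM normcR zn ger0_norm ?invr_ge0 ?ltW// mulVf ?gt_eqF.
  have : 0 <= complex.Re (z i).
    have := zr i; case: (z i) => a b /=; rewrite -(@ler_pXn2r _ 2) ?nnegrE ?sqrtr_ge0 ?invr_ge0//.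
    by rewrite sqr_sqrtr ?addr_ge0 ?sqr_ge0// !expr2; nra.
  by case: (z i) => a b /= h; rewrite mul0r subr0 mulr_ge0// invr_ge0 ltW.
have [a ha] := choice aP.
exists g, a; split => //; split => [i|i j]; first by case: (ha i).
have gs : mspan e (g i j) by rewrite -ge; exact: mspan_mu.
have comm : f t (g i j) * U = U * g i j.
  move: gs; apply: (mspanP (S := fun x => f t x * U = U * x)) => //.
  - by rewrite flow_z mul0r mulr0.
  - by move=> x y hx hy; rewrite flowDD mulrDl mulrDr hx hy.
  - by move=> k x hx; rewrite flowZ -scalerAl -scalerAr hx.
have c0 : c != 0 by rewrite cr (inj_eq (@complexI _)) sqrf_eq0 gt_eqF.
have hcomm : c *: f t (g i j) = (z i * Num.conj (z j)) *: g i j.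
  rewrite -{1}(mspan1_r em (fe t gs)) -/P scalerAr cc' -US mulrA comm Uz.
  by rewrite mu_diagS// mu_diagMl// -scalerAl mu_diagMr// scalerA.
rewrite -[LHS](scalerK c0) hcomm scalerA; congr (_ *: _).
rewrite expiB -(ha i).2 -(ha j).2 rmorphM /= -/(Num.conj _) cr.
rewrite rmorphXn /= conjR fmorphV.
have rC : (r%:C : R[i]) != 0 by rewrite (inj_eq (@complexI _)) gt_eqF.
by field.
Qed.

(** Units that diagonalise the flow at one small time [tau] also do so at [tau / 2 ^ m], where the
    phase is the small square root of the previous one. Multiples of these times are dense in the
    half-line; continuity and the group law give all times. *)
Lemma flow_diag : exists (g : I -> I -> A) (a : I -> R),
  [/\ munits g, mspan g = mspan e, \sum_i g i i = P &
      forall t i j, f t (g i j) = expi (t * (a i - a j)) *: g i j].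
Proof.
have [I0|I0] := posnP #|I|.
  by exists e, (fun=> 0); split => // t i; have := fintype0 i I0.
have N0 : 0 < #|I|%:R :> R by rewrite ltr0n.
have N1 : 1 <= #|I|%:R :> R by rewrite ler1n.
have [|d d0 hd] := flow_near_id f em (k := (4 * #|I|%:R)^-1).
  by rewrite invr_gt0 mulr_gt0.
have [tau tau0 taud] : exists2 tau, 0 < tau & tau < d by exists (d / 2); lra.
have [|g [phi [gm ge g1 [phib hg]]]] := @flow_small_diag tau I0.
  by have := hd tau; rewrite ger0_norm ?ltW//; exact.
have gspan i j : mspan e (g i j) by rewrite -ge; exact: mspan_mu.
have half m i j : f (tau / 2 ^+ m) (g i j) = expi ((phi i - phi j) / 2 ^+ m) *: g i j.
  elim: m => [|m IH]; first by rewrite !expr0 !divr1.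
  set s := tau / 2 ^+ m.+1; set psi := (phi i - phi j) / 2 ^+ m.+1.
  have p2 : (2 : R) ^+ m.+1 != 0 by rewrite expf_neq0.
  have p2' : (2 : R) ^+ m != 0 by rewrite expf_neq0.
  have ss : s + s = tau / 2 ^+ m by rewrite /s exprS; field.
  have pp : psi + psi = (phi i - phi j) / 2 ^+ m by rewrite /psi exprS; field.
  have ge1 : 1 <= 2 ^+ m :> R by rewrite exprn_ege1// ler1n.
  have psib : `|psi| <= pi / 2.
    rewrite normrM normfV (ger0_norm (exprn_ge0 _ _))// ler_pdivrMr ?exprn_gt0//.
    have := ler_normB (phi i) (phi j); have := phib i; have := phib j.
    by rewrite exprS; have := pi_gt0 R; nra.
  set z := expi psi.
  (* [w] measures the failure of the root [z]. The flow sends it to [- z *: w], at distance at least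
     [cnorm w] from [w], whereas at time [s] it moves the span by at most a quarter of the norm. *)
  pose w := f s (g i j) - z *: g i j.
  have wspan : mspan e w by apply: mspanB; [exact: fe|exact: mspanZ].
  have fw : f s w = - (z *: w).
    rewrite /w flowB flowZ -flowD ss IH -pp expiD scalerBr scalerA -/z.
    by rewrite opprB.
  have sb : 0 <= s <= tau.
    apply/andP; split; first by rewrite /s divr_ge0 ?exprn_ge0// ltW.
    by rewrite /s ler_pdivrMr ?exprn_gt0// exprS; nra.
  have fw2 : cnorm (f s w - w) <= (4 * #|I|%:R)^-1 * cnorm w.
    by apply: hd => //; rewrite ger0_norm; lra.
  have k4 : (4 * #|I|%:R)^-1 <= 4^-1 :> R.
    by rewrite lef_pV2 ?posrE ?mulr_gt0//; lra.
  have w0 : cnorm w <= 4^-1 * cnorm w.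
    apply: le_trans (le_trans fw2 _); last by rewrite ler_wpM2r ?cnorm_ge0.
    have -> : f s w - w = - ((1 + z) *: w) by rewrite fw scalerDl scale1r; ncring.
    rewrite cnormN cnormZE -[leLHS]mul1r ler_wpM2r ?cnorm_ge0//.
    exact: normc_1Dexpi.
  have /cnorm0_eq0/eqP : cnorm w = 0 by have := cnorm_ge0 w; lra.
  by rewrite subr_eq0 => /eqP.
have mult m k i j : f (tau / 2 ^+ m *+ k) (g i j) =
    expi ((phi i - phi j) / 2 ^+ m *+ k) *: g i j.
  elim: k => [|k IH]; first by rewrite !mulr0n flow0 expi0 scale1r.
  rewrite (mulrS (tau / 2 ^+ m)) (mulrS ((phi i - phi j) / 2 ^+ m)).
  by rewrite flowD IH flowZ half scalerA -expiD addrC.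
pose a i := phi i / tau.
have pos t i j : 0 <= t -> f t (g i j) = expi (t * (a i - a j)) *: g i j.
  move=> t0; apply: small_eq => k k0.
  have k2 : 0 < k / 2 by lra.
  have [d1 d10 h1] := flow_cont f (g i j) t k2.
  have [d2 d20 h2] := expi_cont k2.
  set b := a i - a j.
  have b0 : 0 < `|b| + 1 by rewrite ltr_pwDr.
  have dd : 0 < Num.min d1 (d2 / (`|b| + 1)) by rewrite lt_min d10 divr_gt0.
  have [m [n]] := dyadic_dense tau0 t0 dd; rewrite lt_min => /andP[/h1 n1].
  rewrite ltr_pdivlMr// => n2; set q := _ *+ n in n1 n2.
  have fq : f q (g i j) = expi (q * b) *: g i j.
    rewrite /q mult; congr (expi _ *: _).
    rewrite /b /a -mulrBl -mulrnAl -[in RHS]mulr_natl -[in LHS]mulr_natl.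
    by field; rewrite expf_neq0// gt_eqF.
  rewrite (le_trans (cdist_tri (f q (g i j)) _ _))//.
  rewrite fq -scalerBl cnormZE mu_norm// mulr1 expi_dist -fq.
  have : Normc.normc (expi (q * b - t * b) - 1) <= k / 2.
    apply: h2; rewrite -mulrBl normrM distrC (le_lt_trans _ n2)//.
    by rewrite ler_wpM2l//; lra.
  by move: n1; lra.
exists g, a; split => // t i j.
have [t0|/ltW t0] := leP 0 t; first exact: pos.
have nt : 0 <= - t by lra.
have := congr1 (f t) (pos _ i j nt); rewrite flowVK flowZ => h.
by rewrite {2}h scalerA -expiD mulNr subrr expi0 scale1r.
Qed.

End FlowDiagonal.

(** * Relative commutants in an invariant matrix algebra *)

Section Complement.
Variables (R : realType) (A : cstarAlgType R) (f : flow A).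
Variables (I K : finType) (e : I -> I -> A) (E : K -> K -> A) (b : K -> R).
Hypotheses (em : munits e) (e1 : unital e).
Hypothesis fe : forall t x, mspan e x -> mspan e (f t x).
Hypotheses (Em : munits E) (E1 : unital E).
Hypothesis Ee : forall k l, mspan e (E k l).
Hypothesis fE : forall t k l, f t (E k l) = expi (t * (b k - b l)) *: E k l.

Lemma unital_nonempty (L : finType) (g : L -> L -> A) : unital g -> L.
Proof.
move=> g1; have [//|h] := pickP (fun _ : L => true).
by exfalso; have := oner_neq0 A; rewrite -g1 big_pred0 ?eqxx// => i.
Qed.

(** The corner cut out by a diagonal unit p = E o o is again a matrix algebra, invariant because the
    flow fixes p. Units [h] diagonalising the flow on the corner are copied along the diagonal of
    [E]; the copies commute with [E], and the phases of [E k o] and [E o k] cancel, so the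
    eigenvalues are those of [h]. *)
Lemma flow_complement : exists (J : finType) (H : J -> J -> A) (c : J -> R),
  [/\ munits H /\ unital H, forall k l p q, E k l * H p q = H p q * E k l,
      forall p q, mspan e (H p q), mspan (mu_prod E H) = mspan e &
      forall t p q, f t (H p q) = expi (t * (c p - c q)) *: H p q].
Proof.
pose o := unital_nonempty E1.
pose p := E o o.
have pp : p * p = p by rewrite /p muMM.
have ps : star p = p by rewrite /p muS.
have [|g [z [gm ge g1 pz]]] := normal_diag em (Ee o o); first by rewrite -/p ps.
rewrite -/p in pz.
have zz i : z i * z i = z i.
  by have := pp; rewrite pz mu_diagM// => /(mu_diag_inj gm)/(_ i).
(* A projection has eigenvalues 0 and 1; the units with both indices of eigenvalue 1 span the
   corner. *)
pose J : finType := {i : I | z i == 1}.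
have z1 (i : J) : z (val i) = 1 by apply/eqP; exact: valP i.
have z0 i : z i != 1 -> z i = 0.
  move=> zi; apply/eqP; move/eqP: (zz i); rewrite -subr_eq0.
  by rewrite -{3}[z i]mulr1 -mulrBr mulf_eq0 subr_eq0 (negPf zi) orbF.
pose fJ (i j : J) := g (val i) (val j).
have fm : munits fJ.
  case: gm => h1 h2 h3; split => [i j k l|i j|i]; last exact: h3.
    by rewrite /fJ h1 (inj_eq val_inj).
  exact: h2.
have fJ1 : \sum_i fJ i i = p.
  rewrite pz /mu_diag (bigID (fun i => z i == 1))/= [X in _ + X]big1 ?addr0; last first.
    by move=> i /z0 ->; rewrite scale0r.
  rewrite (reindex_omap (val : J -> I) insub) /=; last first.
    by move=> i zi; rewrite insubT.
  rewrite [RHS](eq_bigl xpredT) => [|i]; last by rewrite z1 eqxx valK eqxx.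
  by apply: eq_bigr => i _; rewrite z1 scale1r.
have spanJ x : mspan fJ x <-> mspan e x /\ p * x * p = x.
  split => [hx|[]].
    split; last by rewrite -fJ1 mspan1_l// mspan1_r.
    move: hx; apply: mspanP; [exact: mspan0|exact: mspanD|exact: mspanZ|].
    by move=> i j; rewrite -ge; exact: mspan_mu.
  rewrite -ge => -[c ->] <-.
  have -> : p * mx_comb g c * p = \sum_i \sum_j (z i * c i j * z j) *: g i j.
    move: (mu_diagMl gm z) (mu_diagMr gm z); rewrite pz.
    move: (mu_diag g z) => D Dl Dr.
    rewrite /mx_comb mulr_sumr mulr_suml; apply: eq_bigr => i _.
    rewrite mulr_sumr mulr_suml; apply: eq_bigr => j _.
    rewrite -scalerAr -scalerAl Dl -scalerAl Dr !scalerA.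
    by congr (_ *: _); congr (_ * _); rewrite mulrC.
  apply: mspan_sum => i _; apply: mspan_sum => j _.
  have [zi|/z0 ->] := eqVneq (z i) 1; last by rewrite !mul0r scale0r; exact: mspan0.
  have [zj|/z0 ->] := eqVneq (z j) 1; last by rewrite mulr0 scale0r; exact: mspan0.
  by apply: mspanZ; exact: (mspan_mu fJ (exist _ i (introT eqP zi)) (exist _ j (introT eqP zj))).
have fp t : f t p = p by rewrite fE subrr mulr0 expi0 scale1r.
have fJf t x : mspan fJ x -> mspan fJ (f t x).
  move=> /spanJ[h1 h2]; apply/spanJ; split; first exact: fe.
  by rewrite -[in LHS](fp t) -!flowM h2.
have [h [c [hm hf h1 hc]]] := flow_diag fm fJf.
rewrite fJ1 in h1.
have hp x y : h x y * p = h x y by rewrite -h1 mu1_r.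
have ph x y : p * h x y = h x y by rewrite -h1 mu1_l.
pose H x y := \sum_k E k o * h x y * E o k.
have EH k l x y : E k l * H x y = E k o * h x y * E o l.
  rewrite mulr_sumr (bigD1 l)//= [X in _ + X]big1 ?addr0; last first.
    by move=> m /negPf ml; rewrite !mulrA (muM Em) eq_sym ml !mul0r.
  by rewrite !mulrA muMM.
have HE k l x y : H x y * E k l = E k o * h x y * E o l.
  rewrite mulr_suml (bigD1 k)//= [X in _ + X]big1 ?addr0; last first.
    by move=> m /negPf ml; rewrite -!mulrA (muM Em) ml !mulr0.
  by rewrite -!mulrA muMM.
have hin x y : mspan e (h x y).
  have : mspan fJ (h x y) by rewrite -hf; exact: mspan_mu.
  by move/spanJ => [].
have Hm : munits H.
  split.
  - move=> x y u v; rewrite [in LHS]/H mulr_suml.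
    under eq_bigr => k _.
      rewrite -mulrA EH !mulrA -(mulrA _ (h x y) (E o o)) hp -(mulrA _ (h x y)) (muM hm).
      over.
    case: ifP => // _.
    by rewrite big1// => k _; rewrite mulr0 mul0r.
  - move=> x y; rewrite star_sum; apply: eq_bigr => k _.
    by rewrite !starM !muS// mulrA.
  - move=> x; apply/negP => /eqP H0.
    have := EH o o x x; rewrite H0 mulr0 -/p ph hp => /esym/eqP.
    by rewrite (negPf (mu_neq0 hm x x)).
have H1 : unital H.
  rewrite /unital exchange_big /= -E1; apply: eq_bigr => k _.
  by rewrite -mulr_suml -mulr_sumr h1 -mulrA !muMM.
exists J, H, c; split => //.
- by move=> k l x y; rewrite EH HE.
- by move=> x y; apply: mspan_sum => k _; apply: mspanM => //; apply: mspanM.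
- apply/seteqP; split.
    apply: mspanP; [exact: mspan0|exact: mspanD|exact: mspanZ|].
    move=> [k x] [l y]; apply: mspanM => //=.
    by apply: mspan_sum => m _; apply: mspanM => //; apply: mspanM.
  move=> x hx; rewrite -[x]mul1r -[1 * x]mulr1 -[1]E1 mulr_suml mulr_suml.
  apply: mspan_sum => k _; rewrite mulr_sumr; apply: mspan_sum => l _.
  have : mspan h (E o k * x * E l o).
    rewrite hf; apply/spanJ; split; first by apply: mspanM => //; apply: mspanM.
    by rewrite /p !mulrA (muMM Em) -mulrA (muMM Em).
  have -> : E k k * x * E l l = E k o * (E o k * x * E l o) * E o l.
    by rewrite !mulrA (muMM Em) -(mulrA _ (E l o)) (muMM Em).
  move=> [d ->]; rewrite mulr_sumr mulr_suml; apply: mspan_sum => u _.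
  rewrite mulr_sumr mulr_suml; apply: mspan_sum => v _.
  rewrite -scalerAr -scalerAl; apply: mspanZ; rewrite -EH.
  exact: (mspan_mu (mu_prod E H) (k, u) (l, v)).
- move=> t x y; rewrite flow_sum scaler_sumr; apply: eq_bigr => k _.
  rewrite !flowM !fE hc -!scalerAl -!scalerAr -!scalerAl !scalerA -!expiD.
  by congr (expi _ *: _); ring.
Qed.

End Complement.

(** * Isomorphisms of towers of matrix algebras *)

Section Extension.
Variable R : realType.

(** The graph of an isometric homomorphism between dense subalgebras. A relation avoids choosing a
    level and coefficients for each element. Density is required on the left only; the right side
    comes from the same record for the converse relation. *)
Record isometric_rel (A B : cstarAlgType R) (S : A -> B -> Prop) : Prop := IsoRel {
  irD : forall x y x' y', S x y -> S x' y' -> S (x + x') (y + y');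
  irZ : forall (c : R[i]) x y, S x y -> S (c *: x) (c *: y);
  irM : forall x y x' y', S x y -> S x' y' -> S (x * x') (y * y');
  irS : forall x y, S x y -> S (star x) (star y);
  ir1 : S 1 1;
  irN : forall x y, S x y -> cnorm x = cnorm y;
  ir_dense : forall x (e : R), 0 < e -> exists a b, S a b /\ cnorm (x - a) <= e
}.

Section Closure.
Variables (A B : cstarAlgType R) (S : A -> B -> Prop).
Hypothesis Si : isometric_rel S.

Definition rel_closure (x : A) (y : B) : Prop := forall e : R, 0 < e ->
  exists a b, [/\ S a b, cnorm (x - a) <= e & cnorm (y - b) <= e].
Local Notation G := rel_closure.

Lemma rel_closureD x y x' y' : G x y -> G x' y' -> G (x + x') (y + y').
Proof.
move=> h h' e e0; have e2 : 0 < e / 2 by lra.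
have [a [b [s n1 n2]]] := h _ e2; have [a' [b' [s' n1' n2']]] := h' _ e2.
exists (a + a'), (b + b'); split; first exact: irD.
  by rewrite opprD addrACA (le_trans (cnormD_le _ _))//; lra.
by rewrite opprD addrACA (le_trans (cnormD_le _ _))//; lra.
Qed.

Lemma rel_closureZ (c : R[i]) x y : G x y -> G (c *: x) (c *: y).
Proof.
move=> h e e0; have c0 : 0 < Normc.normc c + 1 by have := normc_ge0 c; lra.
have [a [b [s n1 n2]]] := h _ (divr_gt0 e0 c0).
exists (c *: a), (c *: b); split; first exact: irZ.
  rewrite -scalerBr cnormZE (le_trans _ (_ : (Normc.normc c + 1) * cnorm (x - a) <= _))//.
    by rewrite ler_wpM2r ?cnorm_ge0//; lra.
  by rewrite mulrC -ler_pdivlMr.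
rewrite -scalerBr cnormZE (le_trans _ (_ : (Normc.normc c + 1) * cnorm (y - b) <= _))//.
  by rewrite ler_wpM2r ?cnorm_ge0//; lra.
by rewrite mulrC -ler_pdivlMr.
Qed.

Lemma rel_closureS x y : G x y -> G (star x) (star y).
Proof.
move=> h e e0; have [a [b [s n1 n2]]] := h _ e0.
by exists (star a), (star b); rewrite -!starB !cnorm_star; split => //; exact: irS.
Qed.

Lemma mul_close (D : cstarAlgType R) (x x' a a' : D) (e : R) : 0 < e -> e <= 1 ->
  cnorm (x - a) <= e -> cnorm (x' - a') <= e ->
  cnorm (x * x' - a * a') <= e * (cnorm x + cnorm x' + 1).
Proof.
move=> e0 e1 h h'.
have -> : x * x' - a * a' = (x - a) * x' + a * (x' - a') by ncring.
have an : cnorm a <= cnorm x + 1.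
  by have := cnormD_le x (a - x); rewrite subrKC cnormB; lra.
have := cnormD_le ((x - a) * x') (a * (x' - a')).
have := cnormMl_le x' h; have := cnormMM_le an h'.
lra.
Qed.

Lemma rel_closureM x y x' y' : G x y -> G x' y' -> G (x * x') (y * y').
Proof.
move=> h h' e e0.
pose k := cnorm x + cnorm x' + 1 + (cnorm y + cnorm y' + 1).
have k0 : 0 < k.
  by rewrite /k; have := (cnorm_ge0 x, cnorm_ge0 x', cnorm_ge0 y, cnorm_ge0 y') => -[[[]]]; lra.
pose d := Num.min 1 (e / k).
have d0 : 0 < d by rewrite lt_min ltr01 divr_gt0.
have d1 : d <= 1 by rewrite ge_min lexx.
have dk : d * k <= e by rewrite -ler_pdivlMr// ge_min lexx orbT.
have [a [b [s n1 n2]]] := h _ d0; have [a' [b' [s' n1' n2']]] := h' _ d0.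
exists (a * a'), (b * b'); split; first exact: irM.
  apply: le_trans (le_trans (mul_close d0 d1 n1 n1') _) dk.
  by rewrite ler_pM2l// /k; have := cnorm_ge0 y; have := cnorm_ge0 y'; lra.
apply: le_trans (le_trans (mul_close d0 d1 n2 n2') _) dk.
by rewrite ler_pM2l// /k; have := cnorm_ge0 x; have := cnorm_ge0 x'; lra.
Qed.

Lemma rel_closure_uniq x y y' : G x y -> G x y' -> y = y'.
Proof.
move=> h h'; apply/eqP; rewrite -subr_eq0 -cnorm_eq0 eq_le cnorm_ge0 andbT.
apply/ler_addgt0Pr => e e0; have e4 : 0 < e / 4 by lra.
have [a [b [s n1 n2]]] := h _ e4; have [a' [b' [s' n1' n2']]] := h' _ e4.
have sd : S (a - a') (b - b').
  by rewrite -scaleN1r -[- b']scaleN1r; apply: (irD Si) => //; exact: irZ.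
have := cdist_tri b y y'; have := cdist_tri b' b y'; rewrite -(irN Si sd).
by have := cdist_tri x a a'; rewrite (cnormB a x) (cnormB b' y'); lra.
Qed.

Lemma rel_closure_total x : exists y, G x y.
Proof.
have pos n : 0 < (2 ^+ n)^-1 :> R by rewrite invr_gt0 exprn_gt0.
have /choice[a ha] n : exists ab : A * B, S ab.1 ab.2 /\ cnorm (x - ab.1) <= (2 ^+ n)^-1.
  by have [a [b h]] := ir_dense Si x (pos n); exists (a, b).
have [e e0|y hy] := complete_seq (x := fun n => (a n).2).
  have e2 : 0 < e / 2 by lra.
  have [N hN] := geo_small 1 e2; exists N => m n Nm Nn.
  have sd : S ((a m).1 - (a n).1) ((a m).2 - (a n).2).
    rewrite -scaleN1r -[- (a n).2]scaleN1r; apply: (irD Si); first by case: (ha m).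
    by apply: (irZ Si); case: (ha n).
  rewrite -(irN Si sd) (le_trans (cdist_tri x _ _))// (cnormB _ x).
  have := hN m Nm; have := hN n Nn; rewrite !mul1r.
  by have := (ha m).2; have := (ha n).2; lra.
exists y => e e0; have [N hN] := hy e e0; have [N' hN'] := geo_small 1 e0.
exists (a (maxn N N')).1, (a (maxn N N')).2; split; first by case: (ha (maxn N N')).
  by have := hN' _ (leq_maxr N N'); rewrite mul1r; apply: le_trans; case: (ha (maxn N N')).
by rewrite cnormB hN// leq_maxl.
Qed.

End Closure.

Lemma isometric_rel_ext (A B : cstarAlgType R) (S : A -> B -> Prop) :
  isometric_rel S -> isometric_rel (fun y x => S x y) ->
  exists phi : star_isomorphism A B, forall x y, S x y -> phi x = y.
Proof.
move=> Si Si'; pose G := rel_closure S.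
have GC x y : rel_closure (fun y x => S x y) y x -> G x y.
  by move=> h e e0; have [b [a [s n1 n2]]] := h e e0; exists a, b.
have GC' x y : G x y -> rel_closure (fun y x => S x y) y x.
  by move=> h e e0; have [b [a [s n1 n2]]] := h e e0; exists a, b.
have /choice[phi hphi] := rel_closure_total Si.
have /choice[psi hpsi] := rel_closure_total Si'.
have phiE x y : G x y -> phi x = y by move=> h; exact: (rel_closure_uniq Si (hphi x)).
have psiE x y : G x y -> psi y = x.
  by move=> /GC' h; exact: (rel_closure_uniq Si' (hpsi y)).
have SG x y : S x y -> G x y.
  by move=> h e e0; exists x, y; rewrite !subrr !cnorm0 ltW.
have phim : star_morphism phi.
  split.
  - by move=> c x y; apply: phiE; apply: (rel_closureD Si); [apply: (rel_closureZ Si)|]; exact: hphi.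
  - by move=> x y; apply: phiE; apply: (rel_closureM Si); exact: hphi.
  - by apply: phiE; apply: SG; exact: ir1.
  - by move=> x; apply: phiE; apply: (rel_closureS Si); exact: hphi.
have phiK : cancel phi psi by move=> x; apply: psiE; exact: hphi.
have psiK : cancel psi phi by move=> x; apply: phiE; apply: GC; exact: hpsi.
by exists (StarIso phim phiK psiK) => x y /SG; exact: phiE.
Qed.

Section TowerIso.
Variables (A B : cstarAlgType R) (K : nat -> finType).
Variables (E : forall n, K n -> K n -> A) (F : forall n, K n -> K n -> B).

Definition tower_rel (x : A) (y : B) :=
  exists n c, x = mx_comb (@E n) c /\ y = mx_comb (@F n) c.

Hypotheses (Em : forall n, munits (@E n)) (Fm : forall n, munits (@F n)).
Hypotheses (E1 : forall n, unital (@E n)) (F1 : forall n, unital (@F n)).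
Hypothesis EF : forall n i j, exists c,
  @E n i j = mx_comb (@E n.+1) c /\ @F n i j = mx_comb (@F n.+1) c.
Hypothesis Ed : forall x (e : R), 0 < e ->
  exists2 a, (exists n, mspan (@E n) a) & cnorm (x - a) <= e.

Lemma tower_rel_up n m c : (n <= m)%N -> exists d,
  mx_comb (@E n) c = mx_comb (@E m) d /\ mx_comb (@F n) c = mx_comb (@F m) d.
Proof.
elim: m => [|m IH]; first by rewrite leqn0 => /eqP <-; exists c.
rewrite leq_eqVlt => /orP[/eqP <-|]; first by exists c.
rewrite ltnS => /IH[d [-> ->]].
have /choice[g hg] (ij : K m * K m) := EF ij.1 ij.2.
exists (fun k l => \sum_i \sum_j d i j * g (i, j) k l).
have aux (D : cstarAlgType R) (X : K m -> K m -> D) (Y : K m.+1 -> K m.+1 -> D) :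
    (forall i j, X i j = mx_comb Y (g (i, j))) ->
    mx_comb X d = mx_comb Y (fun k l => \sum_i \sum_j d i j * g (i, j) k l).
  move=> h; rewrite {1}/mx_comb.
  under eq_bigr => i _ do under eq_bigr => j _ do rewrite h mx_combZ.
  rewrite pair_big /= {1}/mx_comb exchange_big /=; apply: eq_bigr => k _.
  rewrite exchange_big /=; apply: eq_bigr => l _.
  by rewrite pair_big scaler_suml.
by split; apply: aux => i j; have [h1 h2] := hg (i, j).
Qed.

Lemma tower_rel_iso : isometric_rel tower_rel.
Proof.
have common x y x' y' : tower_rel x y -> tower_rel x' y' -> exists n c d,
    [/\ x = mx_comb (@E n) c, y = mx_comb (@F n) c,
        x' = mx_comb (@E n) d & y' = mx_comb (@F n) d].
  move=> [n [c [-> ->]]] [m [d [-> ->]]]; exists (maxn n m).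
  have [c' [-> ->]] := tower_rel_up c (leq_maxl n m).
  have [d' [-> ->]] := tower_rel_up d (leq_maxr n m).
  by exists c', d'.
split.
- move=> x y x' y' h h'; have [n [c [d [-> -> -> ->]]]] := common _ _ _ _ h h'.
  by rewrite !mx_combD; do 2 eexists.
- by move=> a x y [n [c [-> ->]]]; rewrite !mx_combZ; do 2 eexists.
- move=> x y x' y' h h'; have [n [c [d [-> -> -> ->]]]] := common _ _ _ _ h h'.
  by rewrite !mx_combM//; do 2 eexists.
- by move=> x y [n [c [-> ->]]]; rewrite !mx_combS//; do 2 eexists.
- exists 0%N, (fun i j => (i == j)%:R).
  have aux (D : cstarAlgType R) (X : K 0%N -> K 0%N -> D) : unital X ->
      1 = mx_comb X (fun i j => (i == j)%:R).
    move=> <-; apply: eq_bigr => i _; rewrite (bigD1 i)//= big1 ?addr0.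
      by rewrite eqxx scale1r.
    by move=> j /negPf ji; rewrite eq_sym ji scale0r.
  by split; exact: aux.
- by move=> x y [n [c [-> ->]]]; exact: mx_comb_norm.
- move=> x e e0; have [a [n [c ->]] h] := Ed x e0.
  by exists (mx_comb (@E n) c), (mx_comb (@F n) c); split => //; exists n, c.
Qed.

End TowerIso.

(** Matching equal coefficients is consistent between levels, since both towers have the same
    inclusions, and isometric, since a matrix algebra has only one C*-norm ([mx_comb_norm]). The
    closure of this graph is the isomorphism. *)
Lemma tower_iso (A B : cstarAlgType R) (K : nat -> finType)
    (E : forall n, K n -> K n -> A) (F : forall n, K n -> K n -> B) :
  (forall n, munits (@E n)) -> (forall n, munits (@F n)) ->
  (forall n, unital (@E n)) -> (forall n, unital (@F n)) ->
  (forall n i j, exists c, E n i j = mx_comb (@E n.+1) c /\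
     F n i j = mx_comb (@F n.+1) c) ->
  (forall x (e : R), 0 < e ->
     exists2 a, (exists n, mspan (@E n) a) & cnorm (x - a) <= e) ->
  (forall x (e : R), 0 < e ->
     exists2 a, (exists n, mspan (@F n) a) & cnorm (x - a) <= e) ->
  exists phi : star_isomorphism A B, forall n i j, phi (E n i j) = F n i j.
Proof.
move=> Em Fm E1 F1 EF Ed Fd.
have FE n i j : exists c, F n i j = mx_comb (@F n.+1) c /\ E n i j = mx_comb (@E n.+1) c.
  by have [c []] := EF n i j; exists c.
have S1 := tower_rel_iso Em Fm E1 F1 EF Ed.
have S2 := tower_rel_iso Fm Em F1 E1 FE Fd.
have [|phi hphi] := isometric_rel_ext S1.
  case: S2 => h1 h2 h3 h4 h5 h6 h7.
  have sw y x : tower_rel F E y x <-> tower_rel E F x y.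
    by split=> -[n [c []]]; exists n, c.
  split.
  - by move=> x y x' y' /sw s /sw s'; apply/sw; exact: h1.
  - by move=> c x y /sw s; apply/sw; exact: h2.
  - by move=> x y x' y' /sw s /sw s'; apply/sw; exact: h3.
  - by move=> x y /sw s; apply/sw; exact: h4.
  - exact/sw.
  - by move=> x y /sw; exact: h6.
  - by move=> x e /(h7 x)[a [b [/sw s n]]]; exists a, b.
exists phi => n i j; apply: hphi; exists n, (fun k l => ((k == i) && (l == j))%:R).
by rewrite !mx_comb_delta.
Qed.

End Extension.

(** * Cocycles *)

Section Cocycles.
Variables (R : realType) (A : cstarAlgType R) (f : flow A).
Implicit Types (x y : A) (s t : R) (u v : R -> A).

Lemma unitary_norm x : unitary x -> cnorm x = 1.
Proof. by case=> h _; exact: cnorm_isom. Qed.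

Lemma unitaryM x y : unitary x -> unitary y -> unitary (x * y).
Proof.
move=> [x1 x2] [y1 y2]; split; rewrite starM.
  by rewrite -mulrA (mulrA (star x)) x1 mul1r.
by rewrite -mulrA (mulrA y) y2 mul1r.
Qed.

Lemma unitaryS x : unitary x -> unitary (star x).
Proof. by case=> h h'; split; rewrite starK. Qed.

Lemma unitary_mull x y : unitary x -> cnorm (x * y) = cnorm y.
Proof.
move=> ux; apply/le_anti/andP; split.
  by have := cnormM_le x y; rewrite (unitary_norm ux) mul1r.
have := cnormM_le (star x) (x * y); rewrite mulrA ux.1 mul1r.
by rewrite (unitary_norm (unitaryS ux)) mul1r.
Qed.

Lemma unitary_mulr x y : unitary x -> cnorm (y * x) = cnorm y.
Proof.
by move=> ux; rewrite -cnorm_star starM unitary_mull ?cnorm_star//; exact: unitaryS.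
Qed.

Lemma unitary1 : unitary (1 : A).
Proof. by split; rewrite star1 mulr1. Qed.

Section OneCocycle.
Variable u : R -> A.
Hypothesis uc : cocycle f u.

Lemma coc_unitary t : unitary (u t).
Proof. by case: uc. Qed.
Lemma cocD s t : u (s + t) = u s * f s (u t).
Proof. by case: uc => _ _ ->. Qed.

Lemma coc0 : u 0 = 1.
Proof.
have := cocD 0 0; rewrite addr0 flow0 => h.
by have := (coc_unitary 0).1; rewrite {2}h mulrA (coc_unitary 0).1 mul1r.
Qed.

Lemma coc_distD s t : cnorm (u (s + t) - u s) = cnorm (u t - 1).
Proof.
have -> : u (s + t) - u s = u s * f s (u t - 1).
  by rewrite flowB flow1 cocD mulrBr mulr1.
by rewrite unitary_mull ?flow_cnorm//; exact: coc_unitary.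
Qed.

(** Both orders of the cocycle law for s + t are compared. The bound is uniform in [t], so means of
    [u] over a grid hardly move under the flow at short times. *)
Lemma coc_flow s t : cnorm (f s (u t) - u t) <= 2 * cnorm (u s - 1).
Proof.
rewrite -(unitary_mull _ (coc_unitary s)).
have -> : u s * (f s (u t) - u t) = (u (t + s) - u t) - (u s - 1) * u t.
  by rewrite (addrC t) cocD; ncring.
rewrite (le_trans (cnormB_le _ _))// coc_distD (unitary_mulr _ (coc_unitary t)).
lra.
Qed.

Lemma coc_small (e : R) : 0 < e ->
  exists2 d : R, 0 < d & forall s, `|s| < d -> cnorm (u s - 1) < e.
Proof.
move=> e0; have [_ /continuous_cnorm/(_ 0 e e0)[d d0 h] _] := uc.
by exists d => // s sd; rewrite cnormB -coc0; apply: h; rewrite sub0r normrN.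
Qed.

Lemma coc_neg t : u (- t) = f (- t) (star (u t)).
Proof.
have := cocD (- t) t; rewrite addNr coc0 => h.
rewrite -[LHS]mulr1 -(flow1 f (- t)) -(coc_unitary t).2 flowM mulrA -h.
by rewrite mul1r.
Qed.

Lemma perturb_morphism t : star_morphism (perturb f u t).
Proof.
have [u1 u2] := coc_unitary t.
split; rewrite /perturb.
- move=> c x y; rewrite flowDD flowZ mulrDr mulrDl.
  by rewrite -scalerAr -scalerAl.
- by move=> x y; rewrite flowM -!mulrA (mulrA (star (u t))) u1 mul1r.
- by rewrite flow1 mulr1.
- by move=> x; rewrite flowS !starM starK mulrA.
Qed.

Lemma perturb_bij t : bijective (perturb f u t).
Proof.
have [u1 u2] := coc_unitary t.
exists (fun x => f (- t) (star (u t) * x * u t)) => x; rewrite /perturb.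
  by rewrite -!mulrA u1 mulr1 mulrA u1 mul1r flowK.
by rewrite flowVK -!mulrA u2 mulr1 mulrA u2 mul1r.
Qed.

Lemma perturb0 x : perturb f u 0 x = x.
Proof. by rewrite /perturb coc0 flow0 star1 mulr1 mul1r. Qed.

Lemma perturbD s t x : perturb f u (s + t) x = perturb f u s (perturb f u t x).
Proof. by rewrite /perturb cocD flowD !flowM starM flowS !mulrA. Qed.

Lemma conj_dist (a b x y : A) : cnorm a <= 1 -> cnorm b <= 1 ->
  cnorm (a * x * star a - b * y * star b) <=
  2 * cnorm (a - b) * cnorm x + cnorm (x - y).
Proof.
move=> a1 b1.
have -> : a * x * star a - b * y * star b =
    (a - b) * x * star a + b * x * (star a - star b) + b * (x - y) * star b.
  by ncring.
rewrite -starB; have sa : cnorm (star a) <= 1 by rewrite cnorm_star.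
have sb : cnorm (star b) <= 1 by rewrite cnorm_star.
apply: le_trans (cnormD_le _ _) _; apply: lerD.
  apply: le_trans (cnormD_le _ _) _.
  have h1 := le_trans (cnormMr_le _ sa) (_ : _ <= cnorm (a - b) * cnorm x).
  have {}h1 : cnorm ((a - b) * x * star a) <= cnorm (a - b) * cnorm x.
    by apply: h1; rewrite mulr1 cnormM_le.
  have h2 : cnorm (b * x * star (a - b)) <= cnorm x * cnorm (a - b).
    rewrite (le_trans (cnormM_le _ _))// cnorm_star ler_wpM2r ?cnorm_ge0//.
    by rewrite (le_trans (cnormMl_le _ b1))// mul1r.
  lra.
rewrite (le_trans (cnormMr_le _ sb))// mulr1.
by rewrite (le_trans (cnormMl_le _ b1))// mul1r.
Qed.

Lemma perturb_continuous x : continuous (fun t => perturb f u t x : normed A).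
Proof.
apply/continuous_cnorm => t e e0.
have x0 : 0 < 4 * (cnorm x + 1) by have := cnorm_ge0 x; lra.
have e2 : 0 < e / 2 by lra.
have [_ /continuous_cnorm/(_ t _ (divr_gt0 e0 x0))[d d0 h] _] := uc.
have [d' d'0 h'] := flow_cont f x t e2.
exists (Num.min d d'); first by rewrite lt_min d0.
move=> s; rewrite lt_min => /andP[/h + /h'].
rewrite ltr_pdivlMr// /perturb => n1 n2.
have n1t : cnorm (u t) <= 1 by rewrite (unitary_norm (coc_unitary t)).
have n1s : cnorm (u s) <= 1 by rewrite (unitary_norm (coc_unitary s)).
have := conj_dist (f t x) (f s x) n1t n1s; rewrite flow_cnorm.
by have := cnorm_ge0 (u t - u s); have := cnorm_ge0 x; nra.
Qed.

Definition perturb_flow : flow A :=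
  Flow perturb_morphism perturb_bij perturb0 perturbD perturb_continuous.

Lemma coc_cobound w : unitary w -> cocycle f (fun t => star w * u t * f t w).
Proof.
move=> uw; split.
- move=> t; apply: unitaryM; last by split; rewrite -flowS -flowM ?uw.1 ?uw.2 flow1.
  by apply: unitaryM; [exact: unitaryS|exact: coc_unitary].
- apply/continuous_cnorm => t e e0; have e2 : 0 < e / 2 by lra.
  have [_ /continuous_cnorm/(_ t _ e2)[d d0 h] _] := uc.
  have [d' d'0 h'] := flow_cont f w t e2.
  exists (Num.min d d'); first by rewrite lt_min d0.
  move=> s; rewrite lt_min => /andP[/h n1 /h' n2].
  have -> : star w * u t * f t w - star w * u s * f s w =
      star w * ((u t - u s) * f t w + u s * (f t w - f s w)) by ncring.
  rewrite (unitary_mull _ (unitaryS uw)) (le_lt_trans (cnormD_le _ _))//.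
  rewrite (unitary_mull _ (coc_unitary s)) unitary_mulr; first lra.
  by split; rewrite -flowS -flowM ?uw.1 ?uw.2 flow1.
- move=> s t; rewrite !flowM -flowD -!mulrA (mulrA (f s w)) -flowM uw.2 flow1 mul1r.
  by rewrite (mulrA (u s)) -cocD.
Qed.

End OneCocycle.

(** Multiplication by unitaries and the flow are isometric, so the error of each step is added
    without amplification. *)
Lemma coc_dist_mul u v (tau : R) j : cocycle f u -> cocycle f v ->
  cnorm (u (tau *+ j) - v (tau *+ j)) <= j%:R * cnorm (u tau - v tau).
Proof.
move=> uc vc; elim: j => [|j IH].
  by rewrite !mulr0n (coc0 uc) (coc0 vc) subrr cnorm0 mul0r.
rewrite mulrSr (cocD uc) (cocD vc).
have -> : u (tau *+ j) * f (tau *+ j) (u tau) - v (tau *+ j) * f (tau *+ j) (v tau) =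
   (u (tau *+ j) - v (tau *+ j)) * f (tau *+ j) (u tau) +
    v (tau *+ j) * f (tau *+ j) (u tau - v tau) by rewrite flowB; ncring.
rewrite (le_trans (cnormD_le _ _))// (unitary_mull _ (coc_unitary vc _)) flow_cnorm.
rewrite unitary_mulr; first by rewrite -natr1; lra.
have [u1 u2] := coc_unitary uc tau.
by split; rewrite -flowS -flowM ?u1 ?u2 flow1.
Qed.

Lemma coc1 : cocycle f (fun=> 1).
Proof.
split=> [t||s t]; [exact: unitary1| |by rewrite flow1 mulr1].
by apply/continuous_cnorm => t e e0; exists 1 => // s _; rewrite subrr cnorm0.
Qed.

Lemma coc_mul_small u (tau : R) j : cocycle f u ->
  cnorm (u (tau *+ j) - 1) <= j%:R * cnorm (u tau - 1).
Proof. by move=> uc; exact: (coc_dist_mul tau j uc coc1). Qed.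

Lemma coc_continuous u : (forall t, unitary (u t)) ->
  (forall s t, u s * f s (u t) = u (s + t)) ->
  (forall e : R, 0 < e -> exists2 d : R, 0 < d & forall s, `|s| < d -> cnorm (u s - 1) < e) ->
  cocycle f u.
Proof.
move=> uu uD u0; split => //; apply/continuous_cnorm => t e e0.
have [d d0 h] := u0 e e0; exists d => // s sd.
have -> : u t - u s = - (u t * f t (u (s - t) - 1)).
  by rewrite flowB flow1 mulrBr mulr1 uD subrKC opprB.
rewrite cnormN unitary_mull// flow_cnorm h// distrC.
by rewrite -normrN opprB distrC.
Qed.

End Cocycles.

(** With [y] the mean of a cocycle, [d] its slope and [m] the mesh, this is the change of
    [star y * y] under the flow over one mesh step: [m] times a bounded element. *)
Lemma gram_step (R : realType) (A : cstarAlgType R) (y d : A) (m : R) :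
  star y * y - star (y + m%:C *: d) * (y + m%:C *: d) =
  m%:C *: - (star y * d + star d * y + m%:C *: (star d * d)).
Proof.
rewrite starD starZ conjR scalerN !scalerDr.
rewrite mulrDl !mulrDr -!scalerAr -!scalerAl.
by ncring.
Qed.

(** * Smoothing a cocycle by a coboundary *)

Section Smoothing.
Variables (R : realType) (A : cstarAlgType R) (f : flow A) (u : R -> A).
Hypothesis uc : cocycle f u.
Variable eta : R.
Hypothesis eta0 : 0 < eta.

Lemma cnormZR (r : R) (x : A) : cnorm (r%:C *: x) = `|r| * cnorm x.
Proof. by rewrite cnormZE normcR. Qed.

Definition mesh (n : nat) : R := eta / n.+1%:R.

Lemma mesh_gt0 n : 0 < mesh n.
Proof. by rewrite divr_gt0// ltr0Sn. Qed.

Lemma mesh_le n : mesh n <= eta.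
Proof. by rewrite ler_pdivrMr ?ltr0Sn// ler_peMr ?ler1n// ltW. Qed.

Lemma mesh_small (d : R) : 0 < d -> exists N, forall n, (N <= n)%N -> mesh n < d.
Proof.
move=> d0; exists (Num.bound (eta / d)) => n nN.
rewrite ltr_pdivrMr ?ltr0Sn// mulrC -ltr_pdivrMr//.
apply: lt_le_trans (archi_boundP (ltW (divr_gt0 eta0 d0))) _.
by rewrite ler_nat (leq_trans nN).
Qed.

(* Bounded sequences on which the flow acts asymptotically trivially up to the
   time [mesh n]. *)
Definition tame (x : nat -> A) : Prop :=
  (exists M, forall n, cnorm (x n) <= M) /\
  forall k : R, 0 < k -> exists N, forall n, (N <= n)%N -> forall s,
    `|s| <= mesh n -> cnorm (f s (x n) - x n) <= k.

Lemma tameD x y : tame x -> tame y -> tame (fun n => x n + y n).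
Proof.
move=> [[M hM] hx] [[M' hM'] hy]; split.
  by exists (M + M') => n; rewrite (le_trans (cnormD_le _ _))// lerD.
move=> k k0; have k2 : 0 < k / 2 by lra.
have [N hN] := hx _ k2; have [N' hN'] := hy _ k2.
exists (maxn N N') => n; rewrite geq_max => /andP[Nn N'n] s sn.
rewrite flowDD opprD addrACA (le_trans (cnormD_le _ _))//.
by have := hN n Nn s sn; have := hN' n N'n s sn; lra.
Qed.

Lemma tameM x y : tame x -> tame y -> tame (fun n => x n * y n).
Proof.
move=> [[M hM] hx] [[M' hM'] hy].
have M0 : 0 <= M := le_trans (cnorm_ge0 _) (hM 0%N).
have M'0 : 0 <= M' := le_trans (cnorm_ge0 _) (hM' 0%N).
split; first by exists (M * M') => n; rewrite cnormMM_le.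
move=> k k0; have p : 0 < M + M' + 1 by lra.
have [N hN] := hx _ (divr_gt0 k0 p); have [N' hN'] := hy _ (divr_gt0 k0 p).
exists (maxn N N') => n; rewrite geq_max => /andP[Nn N'n] s sn.
have -> : f s (x n * y n) - x n * y n =
    (f s (x n) - x n) * f s (y n) + x n * (f s (y n) - y n) by rewrite flowM; ncring.
rewrite (le_trans (cnormD_le _ _))//.
have fy : cnorm (f s (y n)) <= M' by rewrite flow_cnorm.
have := cnormMM_le (hN n Nn s sn) fy; have := cnormMM_le (hM n) (hN' n N'n s sn).
have : k / (M + M' + 1) * M' + M * (k / (M + M' + 1)) <= k.
  rewrite [M * _]mulrC -mulrDr mulrAC ler_pdivrMr// ler_pM2l//; lra.
lra.
Qed.

Lemma tameS x : tame x -> tame (fun n => star (x n)).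
Proof.
move=> [[M hM] hx]; split; first by exists M => n; rewrite cnorm_star.
move=> k /hx[N hN]; exists N => n Nn s sn.
by rewrite flowS -starB cnorm_star hN.
Qed.

Lemma tame_const x : tame (fun=> x).
Proof.
split; first by exists (cnorm x).
move=> k /(flow_cont0 f x)[d d0 h]; have [N hN] := mesh_small d0.
by exists N => n Nn s sn; rewrite ltW// h// (le_lt_trans sn)// hN.
Qed.

Lemma tameN x : tame x -> tame (fun n => - x n).
Proof.
move=> [[M hM] hx]; split; first by exists M => n; rewrite cnormN.
move=> k /hx[N hN]; exists N => n Nn s sn.
have -> : f s (- x n) - - x n = - (f s (x n) - x n).
  by rewrite (smN (flow_morphism f s)); ncring.
by rewrite cnormN hN.
Qed.

Lemma tame_mesh x : tame x -> tame (fun n => (mesh n)%:C *: x n).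
Proof.
move=> [[M hM] hx].
have M0 : 0 <= M := le_trans (cnorm_ge0 _) (hM 0%N).
have bound n (y : A) m : cnorm y <= m -> cnorm ((mesh n)%:C *: y) <= eta * m.
  move=> ym; rewrite cnormZR ger0_norm ?(ltW (mesh_gt0 n))//.
  by rewrite ler_pM ?cnorm_ge0 ?mesh_le// ltW// mesh_gt0.
split; first by exists (eta * M) => n; exact: bound.
move=> k k0; have [N hN] := hx _ (divr_gt0 k0 eta0).
exists N => n Nn s sn; rewrite flowZ -scalerBr.
by rewrite (le_trans (bound _ _ _ (hN n Nn s sn)))// mulrC divfK// gt_eqF.
Qed.

Lemma tame_shift x : tame x -> tame (fun n => f (mesh n) (x n)).
Proof.
move=> [[M hM] hx]; split; first by exists M => n; rewrite flow_cnorm.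
move=> k /hx[N hN]; exists N => n Nn s sn.
by rewrite -flowD (addrC s) flowD -flowB flow_cnorm hN.
Qed.

Lemma tame_bound x y (C : R) : (forall n, cnorm (x n) <= C) ->
  (forall n s, cnorm (f s (x n) - x n) <= C * cnorm (f s (y n) - y n)) ->
  tame y -> tame x.
Proof.
move=> hC h [_ hy]; split; first by exists C.
have C0 : 0 <= C := le_trans (cnorm_ge0 _) (hC 0%N).
have C1 : 0 < C + 1 by lra.
move=> k k0; have [N hN] := hy _ (divr_gt0 k0 C1).
exists N => n Nn s sn; rewrite (le_trans (h _ _))//.
have := hN n Nn s sn; rewrite ler_pdivlMr// => h'.
by have := cnorm_ge0 (f s (y n) - y n); nra.
Qed.

(** Subtracting the equation from its image under the flow yields a Sylvester equation for
    [f s (x n) - x n] with small right side, to which [sylvester_bound] applies again. *)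
Lemma tame_sylvester (a b x y : nat -> A) :
  (forall n, cnorm (a n - 1) <= 4^-1) -> (forall n, cnorm (b n - 1) <= 4^-1) ->
  tame a -> tame b -> tame y ->
  (forall n, a n * x n + x n * b n = y n) -> tame x.
Proof.
move=> a1 b1 ta tb ty e.
have [M hM] : exists M, forall n, cnorm (x n) <= M.
  case: ty => [[M hM] _]; exists M => n.
  by rewrite (le_trans (sylvester_bound (x n) (a1 n) (b1 n)))// e.
have M0 : 0 <= M := le_trans (cnorm_ge0 _) (hM 0%N).
split; first by exists M.
move=> k k0; have p : 0 < 2 * M + 1 by lra.
have kp := divr_gt0 k0 p.
have [N1 h1] := ta.2 _ kp; have [N2 h2] := tb.2 _ kp; have [N3 h3] := ty.2 _ kp.
exists (maxn N1 (maxn N2 N3)) => n; rewrite !geq_max => /and3P[n1 n2 n3] s sn.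
apply: le_trans (sylvester_bound _ (a1 n) (b1 n)) _.
have -> : a n * (f s (x n) - x n) + (f s (x n) - x n) * b n =
    (f s (y n) - y n) - (f s (a n) - a n) * f s (x n) - f s (x n) * (f s (b n) - b n).
  by rewrite -e flowDD !flowM; ncring.
rewrite (le_trans (cnormB_le _ _))//.
have fx : cnorm (f s (x n)) <= M by rewrite flow_cnorm.
have := cnormB_le (f s (y n) - y n) ((f s (a n) - a n) * f s (x n)).
have := cnormMM_le (h1 n n1 s sn) fx; have := cnormMM_le fx (h2 n n2 s sn).
have := h3 n n3 s sn.
have : k / (2 * M + 1) + k / (2 * M + 1) * M + M * (k / (2 * M + 1)) = k.
  by field; rewrite gt_eqF.
lra.
Qed.

Variable e0 : R.
Hypothesis e0_small : 32 * e0 <= 1.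
Hypothesis ue0 : forall s, `|s| <= eta -> cnorm (u s - 1) <= e0.

(** A Riemann sum over [0, [eta]) replaces the usual integral of the cocycle. *)
Definition coc_mean n : A :=
  (n.+1%:R^-1)%:C *: \sum_(j < n.+1) u (mesh n *+ j).
Definition coc_slope : A := (eta^-1)%:C *: (u eta - 1).
Local Notation y := coc_mean.
Local Notation D := coc_slope.

Lemma scale_meanE n (x : A) : x = (n.+1%:R^-1)%:C *: \sum_(j < n.+1) x.
Proof.
rewrite sumr_const card_ord -[x *+ _]scaler_nat scalerA.
have -> : ((n.+1%:R^-1)%:C * n.+1%:R : R[i]) = 1.
  by rewrite -(rmorph_nat (real_complex R)) -rmorphM /= mulVf ?pnatr_eq0.
by rewrite scale1r.
Qed.

Lemma mean_le n (F : 'I_n.+1 -> A) k : (forall j, cnorm (F j) <= k) ->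
  cnorm ((n.+1%:R^-1)%:C *: \sum_(j < n.+1) F j) <= k.
Proof.
move=> h; rewrite cnormZR ger0_norm ?invr_ge0// mulrC ler_pdivrMr ?ltr0Sn//.
rewrite (le_trans (cnorm_sum _ _ _))// mulr_natr -[n.+1 in leRHS]card_ord -sumr_const.
exact: ler_sum.
Qed.

Lemma mesh_mul n (j : nat) : (j <= n.+1)%N -> 0 <= mesh n *+ j <= eta.
Proof.
move=> jn; rewrite mulrn_wge0 ?(ltW (mesh_gt0 n))//=.
rewrite -[_ *+ j]mulr_natl /mesh mulrCA ler_piMr//; first exact: ltW.
by rewrite ler_pdivrMr ?ltr0Sn// mul1r ler_nat.
Qed.

Lemma coc_mean_near1 n : cnorm (y n - 1) <= e0.
Proof.
have -> : y n - 1 = (n.+1%:R^-1)%:C *: \sum_(j < n.+1) (u (mesh n *+ j) - 1).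
  by rewrite sumrB scalerBr -scale_meanE.
apply: mean_le => j.
by apply: ue0; have /andP[? ?] := mesh_mul (ltnW (ltn_ord j)); rewrite ger0_norm.
Qed.

Lemma coc_mean_le1 n : cnorm (y n) <= 1.
Proof. by apply: mean_le => j; rewrite (unitary_norm (coc_unitary uc _)). Qed.

Lemma coc_mean_tame : tame y.
Proof.
split; first by exists 1 => n; exact: coc_mean_le1.
move=> k k0; have k2 : 0 < k / 2 by lra.
have [d d0 h] := coc_small uc k2; have [N hN] := mesh_small d0.
exists N => n Nn s sn; rewrite flowZ flow_sum -scalerBr -sumrB.
apply: mean_le => j; rewrite (le_trans (coc_flow uc _ _))//.
have := h s; rewrite (le_lt_trans sn) ?hN// => /(_ isT); lra.
Qed.

(** The cocycle law shifts the grid by one point, so the difference telescopes to [u eta - 1]. The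
    slope is therefore exact and the same for all [n]. *)
Lemma coc_mean_step n : u (mesh n) * f (mesh n) (y n) = y n + (mesh n)%:C *: D.
Proof.
rewrite /D scalerA -rmorphM /= {3}/mesh mulrAC mulfV ?gt_eqF// mul1r.
rewrite flowZ flow_sum -scalerAr mulr_sumr -scalerDr; congr (_ *: _).
have -> : u eta = u (mesh n *+ n.+1) by rewrite -mulr_natr divfK ?pnatr_eq0.
under eq_bigr => j _ do rewrite -(cocD uc) -mulrS.
have := telescope_sumr (fun j => u (mesh n *+ j)) (leq0n n.+1).
rewrite big_mkord mulr0n (coc0 uc) => <-.
by rewrite sumrB addrC subrK.
Qed.

(** Here [a] is the modulus of the mean [y], [z] its inverse and w = y z the unitary part. By
    [coc_mean_step] the modified cocycle at the mesh is (a + mesh w* D) f(z), and a = f(a) + mesh q,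
    which yields H = (q + w* D) f(z). The remaining work is to show that [q] is tame. *)
Lemma coc_smooth_step : exists M (w H : nat -> A), forall n,
  [/\ unitary (w n), cnorm (w n - 1) <= 6 * e0, cnorm (H n) <= M,
      star (w n) * u (mesh n) * f (mesh n) (w n) = 1 + (mesh n)%:C *: H n &
      tame H].
Proof.
have e00 : 0 <= e0 := le_trans (cnorm_ge0 _) (coc_mean_near1 0).
have e0s := e0_small.
pose b n := star (y n) * y n.
have b1 n : cnorm (b n - 1) <= 2 * e0.
  have -> : b n - 1 = star (y n) * (y n - 1) + star (y n - 1).
    by rewrite starB star1; rewrite /b; ncring.
  rewrite (le_trans (cnormD_le _ _))// cnorm_star.
  have sy : cnorm (star (y n)) <= 1 by rewrite cnorm_star coc_mean_le1.
  have := cnormMl_le (y n - 1) sy; have := coc_mean_near1 n; lra.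
have b4 n : cnorm (b n - 1) <= 4^-1 by apply: le_trans (b1 n) _; lra.
have /choice[a ha] n := sqrt_near1 (b4 n).
have aa n : a n * a n = b n by case: (ha n).
have a1 n : cnorm (a n - 1) <= 2 * e0 by case: (ha n) => _ h _ _; rewrite (le_trans h).
have a4 n : cnorm (a n - 1) <= 4^-1 by apply: le_trans (a1 n) _; lra.
have sa n : star (a n) = a n by case: (ha n) => _ _ h _; apply: h; rewrite starM starK.
have /choice[z hz] n : exists z, [/\ z * a n = 1, a n * z = 1 & cnorm z <= 2].
  by apply: inv_near1; apply: le_trans (a4 n) _; lra.
have za n : z n * a n = 1 by case: (hz n).
have az n : a n * z n = 1 by case: (hz n).
have z2 n : cnorm (z n) <= 2 by case: (hz n).
have sz n : star (z n) = z n.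
  by rewrite -[LHS]mulr1 -(az n) mulrA -{1}(sa n) -starM az star1 mul1r.
pose w n := y n * z n.
have wa n : w n * a n = y n by rewrite /w -mulrA za mulr1.
have sww n : star (w n) * w n = 1.
  by rewrite /w starM sz -mulrA (mulrA (star _)) -/(b n) -aa !mulrA za mul1r az.
have wu n : unitary (w n).
  split; first exact: sww.
  have [|y' [_ yy' _]] := inv_near1 (a := y n).
    by apply: le_trans (coc_mean_near1 n) _; lra.
  have r : w n * (a n * y') = 1 by rewrite mulrA wa.
  have -> : star (w n) = a n * y'.
    by rewrite -[LHS]mulr1 -r (mulrA (star (w n)) (w n)) sww mul1r.
  exact: r.
have w1 n : cnorm (w n - 1) <= 6 * e0.
  have -> : w n - 1 = (y n - 1) * z n + z n * (1 - a n) + (z n * a n - 1).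
    by rewrite /w; ncring.
  rewrite za subrr addr0 (le_trans (cnormD_le _ _))//.
  have a1' : cnorm (1 - a n) <= 2 * e0 by rewrite cnormB.
  have := cnormMM_le (coc_mean_near1 n) (z2 n); have := cnormMM_le (z2 n) a1'; lra.
have ty := coc_mean_tame.
have tb : tame b by apply: tameM => //; exact: tameS.
have fa4 n s : cnorm (f s (a n) - 1) <= 4^-1.
  by rewrite -(flow1 f s) -flowB flow_cnorm.
have ta : tame a.
  apply: (@tame_bound _ b 2) => // n.
    by have := cnormD_le 1 (a n - 1); rewrite subrKC cnorm1; have := a4 n; lra.
  move=> s; have := sylvester_bound (f s (a n) - a n) (fa4 n s) (a4 n).
  have -> : f s (a n) * (f s (a n) - a n) + (f s (a n) - a n) * a n = f s (b n) - b n.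
    by rewrite -aa flowM; ncring.
  by have := cnorm_ge0 (f s (b n) - b n); lra.
have tz : tame z.
  apply: (@tame_bound _ a 4) => // n; first by have := z2 n; lra.
  move=> s; have -> : f s (z n) - z n = - (f s (z n) * (f s (a n) - a n) * z n).
    have fza : f s (z n) * f s (a n) = 1 by rewrite -flowM za flow1.
    have -> : f s (z n) * (f s (a n) - a n) * z n =
       f s (z n) * f s (a n) * z n - f s (z n) * (a n * z n) by ncring.
    by rewrite fza az mul1r mulr1 opprB.
  have fz : cnorm (f s (z n)) <= 2 by rewrite flow_cnorm.
  rewrite cnormN (le_trans (cnormMr_le _ (z2 n)))//.
  have := cnormMl_le (f s (a n) - a n) fz; lra.
have tw : tame w by exact: tameM.
have tD : tame (fun=> D) by exact: tame_const.
pose E n := - (star (y n) * D + star D * y n + (mesh n)%:C *: (star D * D)).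
have tE : tame E.
  apply: tameN; apply: tameD; [apply: tameD; apply: tameM|apply: tame_mesh] => //.
  - exact: tameS.
  - exact: tameS.
  - by apply: (@tameM (fun=> star D)) => //; exact: tame_const.
(* Division by the mesh could make [q] unbounded. The difference of the squares of [a n] and of its
   image is mesh times [E n], so [q] solves a Sylvester equation with tame right side [E] ([qE]). *)
pose q n := ((mesh n)^-1)%:C *: (a n - f (mesh n) (a n)).
have m0 n : ((mesh n)%:C : R[i]) != 0.
  by rewrite (inj_eq (@complexI _)) gt_eqF// mesh_gt0.
have mq n : (mesh n)%:C *: q n = a n - f (mesh n) (a n).
  by rewrite /q scalerA -rmorphM /= mulfV ?gt_eqF ?mesh_gt0// scale1r.
have qE n : a n * q n + q n * f (mesh n) (a n) = E n.
  apply: (scalerI (m0 n)); rewrite scalerDr scalerAr scalerAl mq.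
  have -> : a n * (a n - f (mesh n) (a n)) + (a n - f (mesh n) (a n)) * f (mesh n) (a n)
      = a n * a n - f (mesh n) (a n) * f (mesh n) (a n) by ncring.
  rewrite -flowM aa {2}/b flowM flowS.
  have -> : star (f (mesh n) (y n)) * f (mesh n) (y n) =
      star (y n + (mesh n)%:C *: D) * (y n + (mesh n)%:C *: D).
    rewrite -coc_mean_step starM -mulrA (mulrA (star (u _))).
    by rewrite (coc_unitary uc _).1 mul1r.
  exact: gram_step.
have tq : tame q.
  apply: (@tame_sylvester a (fun n => f (mesh n) (a n)) q E) => //.
  exact: tame_shift.
pose H n := (q n + star (w n) * D) * f (mesh n) (z n).
have tH : tame H.
  apply: tameM; last exact: tame_shift.
  by apply: tameD => //; apply: tameM => //; exact: tameS.
have [[M hM] _] := tH.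
exists M, w, H => n; split => //.
have fw : f (mesh n) (w n) = f (mesh n) (y n) * f (mesh n) (z n) by rewrite -flowM.
rewrite fw !mulrA -(mulrA (star (w n))) coc_mean_step mulrDr -{1}(wa n).
rewrite mulrA sww mul1r /H scalerAl scalerDr mq mulrDl -scalerAr.
have faz : f (mesh n) (a n) * f (mesh n) (z n) = 1 by rewrite -flowM az flow1.
rewrite (mulrDl _ _ (f (mesh n) (z n))) mulrBl faz; ncring.
Qed.

End Smoothing.

(* [w] is the unitary part of the mean of [u] along a fine grid of a short interval;
   moving [u] by the coboundary of [w] makes it Lipschitz at the scale [tau]. *)
Lemma coc_smooth (R : realType) (A : cstarAlgType R) (f : flow A) (u : R -> A)
    (e : R) : cocycle f u -> 0 < e ->
  exists M, forall k : R, 0 < k -> exists (tau : R) (w H : A),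
    [/\ 0 < tau <= k, unitary w, cnorm (w - 1) <= e, cnorm H <= M &
        star w * u tau * f tau w = 1 + tau%:C *: H /\
        forall s, `|s| <= tau -> cnorm (f s H - H) <= k].
Proof.
move=> uc e0; pose e1 := Num.min (32^-1) (e / 6).
have e10 : 0 < e1 by rewrite lt_min; apply/andP; split; lra.
have [d d0 hd] := coc_small uc e10.
have eta0 : 0 < d / 2 by lra.
have ue s : `|s| <= d / 2 -> cnorm (u s - 1) <= e1.
  by move=> sd; apply/ltW/hd; lra.
have e132 : 32 * e1 <= 1.
  by have : e1 <= 32^-1 by [rewrite ge_min lexx]; lra.
have e1e : e1 <= e / 6 by rewrite ge_min lexx orbT.
have [M [w [H hH]]] := coc_smooth_step uc eta0 e132 ue.
exists M => k k0; have [_ _ _ _ [_ tH]] := hH 0%N.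
have [N1 h1] := tH k k0; have [N2 h2] := mesh_small eta0 k0.
have [wu w1 HM eq _] := hH (maxn N1 N2).
exists (mesh (d / 2) (maxn N1 N2)), (w (maxn N1 N2)), (H (maxn N1 N2)).
split => //; first by rewrite mesh_gt0// ltW// h2// leq_maxr.
  by lra.
by split => // s sn; apply: h1 sn; rewrite leq_maxl.
Qed.

(** * Cocycles inside an invariant matrix algebra *)

Section DiagonalExp.
Variables (R : realType) (A : cstarAlgType R) (I : finType) (e : I -> I -> A).
Hypotheses (em : munits e) (e1 : unital e).
Variable a : I -> R.

Definition diag_exp (t : R) : A := mu_diag e (fun i => expi (t * a i)).

Lemma mu_diag1 : mu_diag e (fun=> 1) = 1.
Proof. by rewrite -[RHS]e1; apply: eq_bigr => i _; rewrite scale1r. Qed.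

Lemma diag_expD s t : diag_exp (s + t) = diag_exp s * diag_exp t.
Proof. by rewrite /diag_exp mu_diagM//; apply: eq_bigr => i _; rewrite mulrDl expiD. Qed.

Lemma diag_expS t : star (diag_exp t) = diag_exp (- t).
Proof. by rewrite /diag_exp mu_diagS//; apply: eq_bigr => i _; rewrite mulNr expiN. Qed.

Lemma diag_exp0 : diag_exp 0 = 1.
Proof. by rewrite -mu_diag1; apply: eq_bigr => i _; rewrite mul0r expi0. Qed.

Lemma diag_exp_unitary t : unitary (diag_exp t).
Proof. by split; rewrite diag_expS -diag_expD ?addNr ?subrr diag_exp0. Qed.

Lemma diag_exp_conj t i j :
  diag_exp t * e i j * star (diag_exp t) = expi (t * (a i - a j)) *: e i j.
Proof.
rewrite diag_expS mu_diagMl// -scalerAl mu_diagMr// scalerA -expiD.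
by congr (expi _ *: _); ring.
Qed.

Lemma diag_exp_derive (k : R) : 0 < k -> exists2 d : R, 0 < d & forall s, `|s| < d ->
  cnorm (diag_exp s - 1 - s%:C *: mu_diag e (fun i => 'i * (a i)%:C)) <= k * `|s|.
Proof.
move=> k0.
have [i|d d0 hd] := @finite_radius R I (fun i s =>
  Normc.normc (expi (s * a i) - 1 - s%:C * ('i * (a i)%:C)) <= k * `|s|).
  have a0 : 0 < `|a i| + 1 by rewrite ltr_pwDr.
  have [d d0 h] := expi_derive (divr_gt0 k0 a0).
  exists (d / (`|a i| + 1)); first exact: divr_gt0.
  move=> s; rewrite ltr_pdivlMr// => sd.
  have -> : s%:C * ('i * (a i)%:C) = 'i * (s * a i)%:C :> R[i].
    by rewrite rmorphM /=; ring.
  apply: le_trans (h _ _) _.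
    by rewrite normrM (le_lt_trans _ sd)// ler_wpM2l//; lra.
  rewrite normrM mulrAC ler_pdivrMr// -!mulrA ler_pM2l// ler_wpM2l//.
  by lra.
exists d => // s sd.
rewrite mu_diagZ -mu_diag1 !mu_diagB; apply: mu_diag_le => //.
  by rewrite mulr_ge0// ltW.
by move=> i; exact: hd.
Qed.

Lemma diag_exp_cont (k : R) : 0 < k -> exists2 d : R, 0 < d & forall s, `|s| < d ->
  cnorm (diag_exp s - 1) < k.
Proof.
move=> k0; set X := mu_diag e (fun i => 'i * (a i)%:C).
have [d d0 h] := diag_exp_derive ltr01.
have p : 0 < cnorm X + 2 by have := cnorm_ge0 X; lra.
exists (Num.min d (k / (cnorm X + 2))); first by rewrite lt_min d0 divr_gt0.
move=> s; rewrite lt_min => /andP[/h h1]; rewrite ltr_pdivlMr// => h2.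
rewrite -(subrK (s%:C *: X) (diag_exp s - 1)).
rewrite (le_lt_trans (cnormD_le _ _))// cnormZR.
move: h1; rewrite -/X; set Y := cnorm (_ - _ - _) => h1.
by have := normr_ge0 s; have := cnorm_ge0 X; nra.
Qed.

End DiagonalExp.

Section MatrixCocycle.
Variables (R : realType) (A : cstarAlgType R) (f : flow A).
Variables (I : finType) (e : I -> I -> A).
Hypotheses (em : munits e) (e1 : unital e).
Hypothesis fe : forall t x, mspan e x -> mspan e (f t x).

(* If the flow is Ad exp(it a) on the matrix algebra, the cocycle is
   exp(it (a - i h)) exp(-it a). *)
Lemma mspan_cocycle h : mspan e h -> star h = - h ->
  exists V : R -> A, [/\ cocycle f V, forall t, mspan e (V t) &
    forall k : R, 0 < k -> exists2 d : R, 0 < d & forall s, `|s| < d ->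
      cnorm (V s - 1 - s%:C *: h) <= k * `|s|].
Proof.
move=> hs sh; have [g [a [gm ge g1 hg]]] := flow_diag em fe.
have gu : unital g by rewrite /unital g1.
pose ga := mu_diag g (fun i => (a i)%:C).
pose K := ga - 'i *: h.
have sK : star K = K.
  rewrite /K starB starZ sh conjCi scaleNr scalerN opprK mu_diagS//.
  by congr (_ + _); apply: eq_bigr => i _; rewrite conjR.
have Ks : mspan e K.
  by apply: mspanB; [rewrite -ge; exact: mspan_diag|exact: mspanZ].
have [|p [k [pm pe p1 Kp]]] := normal_diag em Ks; first by rewrite sK.
have pu : unital p by rewrite /unital p1.
pose b i := complex.Re (k i).
have kb i : k i = (b i)%:C.
  have : mu_diag p (fun i => Num.conj (k i)) = mu_diag p k.
    by rewrite -(mu_diagS pm) -Kp sK.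
  move/(mu_diag_inj pm)/(_ i); rewrite /b; case: (k i) => x y /= [].
  by move=> /eqP; rewrite eq_sym -subr_eq0 opprK -mulr2n mulrn_eq0 /= => /eqP ->.
pose D := diag_exp g a; pose W := diag_exp p b.
have Du t : unitary (D t) by exact: diag_exp_unitary.
have Wu t : unitary (W t) by exact: diag_exp_unitary.
have fD t x : mspan e x -> f t x = D t * x * star (D t).
  rewrite -ge; apply: (mspanP (S := fun x => f t x = D t * x * star (D t))).
  - by rewrite flow_z mulr0 mul0r.
  - by move=> x' y hx hy; rewrite flowDD hx hy mulrDr mulrDl.
  - by move=> c x' hx; rewrite flowZ hx -scalerAr -scalerAl.
  - by move=> i j; rewrite hg diag_exp_conj.
have Ds t : mspan e (D t) by rewrite -ge; exact: mspan_diag.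
have Ws t : mspan e (W t) by rewrite -pe; exact: mspan_diag.
pose V t := W t * star (D t).
have Vs t : mspan e (V t) by apply: mspanM => //; exact: mspanS.
have Vu t : unitary (V t) by apply: unitaryM => //; exact: unitaryS.
pose X := 'i *: K; pose Y := - ('i *: ga).
have XY : X + Y = h.
  by rewrite /X /Y /K scalerBr scalerA -expr2 sqrCi scaleN1r opprK addrAC subrr add0r.
have EX : X = mu_diag p (fun i => 'i * (b i)%:C).
  by rewrite /X Kp mu_diagZ; apply: eq_bigr => i _; rewrite kb.
have EY : Y = - mu_diag g (fun i => 'i * (a i)%:C).
  by rewrite /Y /ga mu_diagZ.
have Vd (k0 : R) : 0 < k0 -> exists2 d : R, 0 < d & forall s, `|s| < d ->
      cnorm (V s - 1 - s%:C *: h) <= k0 * `|s|.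
  move=> k00; have k3 : 0 < k0 / 3 by lra.
  have [d1 d10 h1] := diag_exp_derive pm pu b k3.
  have [d2 d20 h2] := diag_exp_derive gm gu a k3.
  have X0 : 0 < 3 * (cnorm X + 1) by have := cnorm_ge0 X; lra.
  have [d3 d30 h3] := diag_exp_cont gm gu a (divr_gt0 k00 X0).
  exists (Num.min d1 (Num.min d2 d3)); first by rewrite !lt_min d10 d20.
  move=> s; rewrite !lt_min => /and3P[/h1 n1]; rewrite -(normrN s) => /h2 n2 /h3 n3.
  rewrite /V diag_expS// -/(D (- s)) -XY.
  move: n1 n2 n3; rewrite -/(W s) -/(D (- s)) -EX => n1.
  have -> : (- s)%:C *: mu_diag g (fun i => 'i * (a i)%:C) = s%:C *: Y.
    by rewrite EY scalerN rmorphN scaleNr.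
  rewrite normrN => n2; rewrite ltr_pdivlMr// => n3.
  have -> : W s * D (- s) - 1 - s%:C *: (X + Y) =
     (W s - 1 - s%:C *: X) * D (- s) + (D (- s) - 1 - s%:C *: Y) +
     (s%:C *: X) * (D (- s) - 1).
    by rewrite scalerDr; ncring.
  rewrite (le_trans (cnormD_le _ _))//.
  have b1 := cnormD_le ((W s - 1 - s%:C *: X) * D (- s)) (D (- s) - 1 - s%:C *: Y).
  rewrite (unitary_mulr _ (Du (- s))) in b1.
  have b2 : cnorm (s%:C *: X * (D (- s) - 1)) <= `|s| * (cnorm X * cnorm (D (- s) - 1)).
    by rewrite -scalerAl cnormZR ler_wpM2l// cnormM_le.
  have b3 : `|s| * (cnorm X * cnorm (D (- s) - 1)) <= `|s| * (k0 / 3).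
    rewrite ler_wpM2l//; have := cnorm_ge0 X; have := cnorm_ge0 (D (- s) - 1).
    nra.
  move: b1 b2 b3 n1 n2; set z1 := cnorm _; set z2 := cnorm _; set z3 := cnorm _.
  set z4 := cnorm (s%:C *: X * _); set z5 := _ * (_ * cnorm _).
  lra.
exists V; split => //; apply: coc_continuous => //.
  move=> s t; rewrite fD ?Vs// /V.
  have -> : W s * star (D s) * (D s * (W t * star (D t)) * star (D s)) =
      W s * (star (D s) * D s) * W t * (star (D t) * star (D s)) by ncring.
  by rewrite (Du s).1 mulr1 -diag_expD// -starM -diag_expD// (addrC s).
move=> k0 k00; have [d d0 hd] := Vd 1 ltr01.
have h0 : 0 < cnorm h + 2 by have := cnorm_ge0 h; lra.
exists (Num.min d (k0 / (cnorm h + 2))); first by rewrite lt_min d0 divr_gt0.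
move=> s; rewrite lt_min => /andP[/hd n1]; rewrite ltr_pdivlMr// => n2.
rewrite -(subrK (s%:C *: h) (V s - 1)) (le_lt_trans (cnormD_le _ _))// cnormZR.
move: n1; set z := cnorm (_ - _ - _) => n1.
by have := normr_ge0 s; have := cnorm_ge0 h; nra.
Qed.

End MatrixCocycle.

(** * Approximating a cocycle by one in the tower *)

Section CocycleApprox.
Variables (R : realType) (A : cstarAlgType R) (f : flow A).

Lemma first_order_step (a b : R) (p q h g : A) :
  p * q - 1 - (a + b)%:C *: h = (p - 1 - a%:C *: h) + p * (q - 1 - b%:C *: g) +
    b%:C *: ((p - 1) * g) + b%:C *: (g - h).
Proof.
have h1 : b%:C *: ((p - 1) * g) = b%:C *: (p * g) - b%:C *: g.
  by rewrite mulrBl mul1r scalerBr.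
have h2 : p * (b%:C *: g) = b%:C *: (p * g) by rewrite -scalerAr.
by rewrite h1 rmorphD scalerDl scalerBr !mulrBr mulr1 h2; ncring.
Qed.

(** The derivative at 0 controls [V] only up to a time depending on [V], whereas [tau] is fixed
    before [V] is known. The cocycle law carries the estimate along a fine grid up to [tau]; the
    price is the motion of [h] under the flow, and the bound involves only [M], [k] and the time. *)
Lemma coc_first_order (V : R -> A) (h : A) (M k tau : R) : cocycle f V ->
  (forall k : R, 0 < k -> exists2 d : R, 0 < d & forall s, `|s| < d ->
      cnorm (V s - 1 - s%:C *: h) <= k * `|s|) ->
  cnorm h <= M -> 0 < k <= 1 ->
  (forall s, `|s| <= tau -> cnorm (f s h - h) <= k) ->
  forall s : R, 0 <= s <= tau ->
    cnorm (V s - 1) <= s * (M + 1) /\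
    cnorm (V s - 1 - s%:C *: h) <= s * (2 * k + s * (M + 1) * M).
Proof.
move=> Vc Vd hM /andP[k0 k1] hk s /andP[s0 st].
have M0 : 0 <= M := le_trans (cnorm_ge0 _) hM.
have [d d0 hd] := Vd k k0.
have [->|sn0] := eqVneq s 0.
  rewrite (coc0 Vc) subrr !mul0r cnorm0 scale0r sub0r oppr0 cnorm0; lra.
have sp : 0 < s by rewrite lt_neqAle eq_sym sn0.
have [N hN] := mesh_small sp d0.
pose sg := mesh s N.
have sg0 : 0 < sg by exact: mesh_gt0.
have sgE : sg *+ N.+1 = s by rewrite -mulr_natr divfK ?pnatr_eq0.
have V1 : cnorm (V sg - 1 - sg%:C *: h) <= k * sg.
  by rewrite -{3}(ger0_norm (ltW sg0)) hd// ger0_norm ?hN// ltW.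
have V2 : cnorm (V sg - 1) <= sg * (M + 1).
  rewrite -(subrK (sg%:C *: h) (V sg - 1)) (le_trans (cnormD_le _ _))//.
  have b1 : cnorm (sg%:C *: h) <= sg * M.
    by rewrite cnormZR ger0_norm ?ler_pM2l// ltW.
  have b2 : k * sg <= sg by rewrite ler_piMl// ltW.
  by rewrite (le_trans (lerD V1 b1))// mulrDr mulr1; lra.
have Vj j : cnorm (V (sg *+ j) - 1) <= (sg *+ j) * (M + 1).
  rewrite (le_trans (coc_mul_small _ _ Vc))// -[sg *+ j]mulr_natl -mulrA.
  by rewrite ler_wpM2l.
split; first by rewrite -sgE.
have key j : (j <= N.+1)%N ->
    cnorm (V (sg *+ j) - 1 - (sg *+ j)%:C *: h) <= (sg *+ j) * (2 * k + s * (M + 1) * M).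
  elim: j => [_|j IH jN].
    by rewrite !mulr0n (coc0 Vc) subrr scale0r subrr cnorm0 mul0r.
  have {}IH := IH (ltnW jN).
  set sj := sg *+ j in IH *.
  have sj0 : 0 <= sj by rewrite mulrn_wge0// ltW.
  have sjs : sj <= s by rewrite -sgE /sj -[sg *+ j]mulr_natl -[leRHS]mulr_natl ler_wpM2r
      ?(ltW sg0)// ler_nat ltnW.
  rewrite mulrSr -/sj (cocD Vc).
  have -> : V sj * f sj (V sg) - 1 - (sj + sg)%:C *: h =
      (V sj - 1 - sj%:C *: h) + V sj * f sj (V sg - 1 - sg%:C *: h) +
      sg%:C *: ((V sj - 1) * f sj h) + sg%:C *: (f sj h - h).
    by rewrite !flowB flow1 flowZ (first_order_step _ _ _ _ _ (f sj h)).
  set x1 := V sj - 1 - sj%:C *: h in IH *.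
  rewrite (le_trans (cnormD_le _ _))//.
  have b1 : cnorm (sg%:C *: (f sj h - h)) <= sg * k.
    rewrite cnormZR ger0_norm ?(ltW sg0)// ler_pM2l// hk// ger0_norm//.
    exact: le_trans sjs st.
  have b2 : cnorm (sg%:C *: ((V sj - 1) * f sj h)) <= sg * (s * (M + 1) * M).
    rewrite cnormZR ger0_norm ?(ltW sg0)// ler_pM2l// cnormMM_le ?flow_cnorm//.
    by rewrite (le_trans (Vj j))// ler_wpM2r//; lra.
  have b3 : cnorm (V sj * f sj (V sg - 1 - sg%:C *: h)) <= k * sg.
    by rewrite (unitary_mull _ (coc_unitary Vc sj)) flow_cnorm.
  move: b1 b2 b3; set x2 := V sj * _; set x3 := _ *: (_ * _); set x4 := _ *: (_ - _).
  move=> b1 b2 b3.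
  have := cnormD_le (x1 + x2) x3; have := cnormD_le x1 x2; nra.
by have := key _ (leqnn N.+1); rewrite sgE.
Qed.

Definition full_tower (C : nat -> set A) : Prop :=
  [/\ forall m, exists (I : finType) (e : I -> I -> A),
        [/\ munits e, unital e & mspan e = C m],
      forall m, C m `<=` C m.+1 &
      forall x (e : R), 0 < e -> exists m y, C m y /\ cnorm (x - y) <= e].

Definition flow_inv (g : flow A) (C : nat -> set A) :=
  forall m t x, C m x -> C m (g t x).

(** The smoothed cocycle [v] is 1 + tau H at [tau]. A skew element [h] of the tower close to [H]
    generates [V], which agrees with [v] to first order at [tau]; this agreement propagates along
    the multiples of [tau]. The bound [M] is obtained before [k] and [tau] are chosen. *)
Lemma coc_approx (C : nat -> set A) (u : R -> A) (eps : R) :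
  full_tower C -> flow_inv f C -> cocycle f u -> 0 < eps ->
  exists m (V : R -> A), [/\ cocycle f V, forall t, C m (V t) &
    forall t : R, -1 <= t <= 1 -> cnorm (u t - V t) <= eps].
Proof.
move=> [Cm _ Cd] fC uc eps0.
have e8 : 0 < eps / 8 by lra.
have [M hM] := coc_smooth uc e8.
have M0 : 0 <= M.
  by have [tau [w [H [_ _ _ HM _]]]] := hM 1 ltr01; exact: le_trans (cnorm_ge0 _) HM.
(* [k * Q] bounds the distance from [h] to [H]. In [T], one [Q] is for this distance and 6 [Q] for
   the motion of [h], bounded by 3 k Q and doubled in [coc_first_order]; the product is its
   second-order term, and M + 2 bounds the growth of [V] within one step. *)
pose Q := 1 + M ^+ 2; pose T := 7 * Q + (M + 2) * (M + 1) + (M + 2).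
have Q1 : 1 <= Q by have := sqr_ge0 M; rewrite /Q; lra.
have T0 : 0 < T by rewrite /T; nra.
have [d d0 hd] := coc_small uc e8.
have [k [k0 kd kT kQ]] : exists k : R,
    [/\ 0 < k, k < d, k * T <= eps / 8 & 3 * (k * Q) <= 1].
  exists (Num.min (d / 2) (Num.min (eps / 8 / T) (3 * Q)^-1)); split.
  - rewrite !lt_min; apply/and3P; split; [lra|exact: divr_gt0|].
    by rewrite invr_gt0; lra.
  - by rewrite gt_min; apply/orP; left; lra.
  - by rewrite -ler_pdivlMr// !ge_min lexx !orbT.
  - rewrite mulrCA -ler_pdivlMr ?mul1r ?ge_min ?lexx ?orbT//; lra.
have [tau [w [H [/andP[tau0 tauk] wu w1 HM [eq oscH]]]]] := hM k k0.
pose v t := star w * u t * f t w.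
have vc : cocycle f v by exact: coc_cobound.
have v_tau : v tau = 1 + tau%:C *: H by [].
(* Unitarity of 1 + tau H makes [H] skew-adjoint up to the second-order term tau H* H. *)
have HH : cnorm (H + star H) <= k * M ^+ 2.
  have : H + star H = - (tau%:C *: (star H * H)).
    have tc : (tau%:C : R[i]) != 0 by rewrite (inj_eq (@complexI _)) gt_eqF.
    apply: (scalerI tc).
    have := (coc_unitary vc tau).1; rewrite v_tau starD star1 starZ conjR.
    move=> h; have : (1 + tau%:C *: star H) * (1 + tau%:C *: H) - 1 = 0 by rewrite h subrr.
    rewrite mulrDl !mulrDr !mulr1 !mul1r -!scalerAl -!scalerAr !scalerN scalerDr.
    by move=> h'; apply/eqP; rewrite -subr_eq0 opprK -h'; apply/eqP; ncring.
  move=> ->; rewrite cnormN cnormZR ger0_norm ?(ltW tau0)//.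
  have sH : cnorm (star H) <= M by rewrite cnorm_star.
  by rewrite expr2 ler_pM ?cnorm_ge0 ?(ltW tau0)// cnormMM_le.
have [m [x [Cx xH]]] := Cd H k k0.
have [I [e [em e1 eC]]] := Cm m.
pose h := (2^-1 : R[i]) *: (x - star x).
have conj2 : Num.conj (2^-1 : R[i]) = 2^-1 by rewrite fmorphV rmorph_nat.
have sh : star h = - h.
  by rewrite /h starZ conj2 starB starK -scalerN opprB.
have hs : mspan e h.
  by apply: mspanZ; apply: mspanB; rewrite ?eC//; rewrite -eC; apply: mspanS => //; rewrite eC.
have hH : cnorm (h - H) <= k * Q.
  have -> : h - H = (2^-1 : R[i]) *: ((x - H) - star (x - H) - (H + star H)).
    rewrite /h starB -{1}(half_half H) -scalerDr -scalerBr; congr (_ *: _).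
    by ncring.
  have n1 : cnorm (x - H - star (x - H)) <= k + k.
    by rewrite (le_trans (cnormB_le _ _))// cnorm_star (cnormB x H) lerD.
  have n2 := le_trans (cnormB_le _ _) (lerD n1 HH).
  rewrite cnormZE normc_half mulrC ler_pdivrMr// (le_trans n2)// /Q.
  have : 0 <= k * M ^+ 2 by rewrite mulr_ge0 ?sqr_ge0// ltW.
  by lra.
have hM1 : cnorm h <= M + 1.
  by have := cnormD_le (h - H) H; rewrite subrK; lra.
have osch s : `|s| <= tau -> cnorm (f s h - h) <= 3 * (k * Q).
  move=> /oscH oH.
  have -> : f s h - h = f s (h - H) + (f s H - H) + (H - h) by rewrite flowB; ncring.
  have := cnormD_le (f s (h - H) + (f s H - H)) (H - h).
  have := cnormD_le (f s (h - H)) (f s H - H).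
  rewrite flow_cnorm (cnormB H h); have : k <= k * Q by rewrite ler_peMr// ltW.
  lra.
have fe t y : mspan e y -> mspan e (f t y) by rewrite eC; exact: fC.
have [V [Vc Vs Vd]] := mspan_cocycle em e1 fe hs sh.
exists m, V; split => // [t|]; first by rewrite -eC.
have k'0 : 0 < 3 * (k * Q) <= 1.
  by rewrite kQ andbT mulr_gt0// mulr_gt0//; lra.
have fo := coc_first_order Vc Vd hM1 k'0 osch.
(* The factor [tau] compensates the 1 / [tau] steps needed to reach time 1. *)
have vV : cnorm (v tau - V tau) <= tau * (eps / 8).
  have tt : 0 <= tau <= tau by rewrite ltW//=.
  have [_ V2] := fo tau tt.
  have -> : v tau - V tau = tau%:C *: (H - h) - (V tau - 1 - tau%:C *: h).
    by rewrite v_tau scalerBr; ncring.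
  have := cnormB_le (tau%:C *: (H - h)) (V tau - 1 - tau%:C *: h).
  rewrite cnormZR ger0_norm ?(ltW tau0)// (cnormB H).
  have : tau * cnorm (h - H) <= tau * (k * Q) by rewrite ler_pM2l.
  have : tau * (M + 1 + 1) * (M + 1) <= k * ((M + 2) * (M + 1)).
    by rewrite -mulrA (_ : M + 1 + 1 = M + 2) ?ler_wpM2r//; [nra|ring].
  have : tau * (k * T) <= tau * (eps / 8) by rewrite ler_pM2l.
  have : 0 <= tau * (k * (M + 2)) by rewrite !mulr_ge0//; lra.
  move: V2; set z := cnorm (_ - _ - _); rewrite /T.
  have := tau0; nra.
(* Within one step both cocycles are close to 1, and no finer comparison is made. The final budget
   is eps/4 for the coboundary, eps/8 at grid points and eps/2 here. *)
have small s : 0 <= s <= tau -> cnorm (v s - V s) <= eps / 2.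
  move=> st; have [V1 _] := fo s st; move/andP: st => [s0 st].
  have us : cnorm (u s - 1) <= eps / 8.
    by apply/ltW/hd; rewrite ger0_norm//; apply: le_lt_trans kd; exact: le_trans tauk.
  have -> : v s - V s = (star w - 1) * (u s * f s w) + (u s - 1) * f s w + f s (w - 1)
     - (V s - 1) by rewrite flowB flow1 /v; ncring.
  have fwu : unitary (f s w) by split; rewrite -flowS -flowM ?wu.1 ?wu.2 flow1.
  have uu := coc_unitary uc s.
  have := cnormB_le ((star w - 1) * (u s * f s w) + (u s - 1) * f s w + f s (w - 1)) (V s - 1).
  have := cnormD_le ((star w - 1) * (u s * f s w) + (u s - 1) * f s w) (f s (w - 1)).
  have := cnormD_le ((star w - 1) * (u s * f s w)) ((u s - 1) * f s w).
  rewrite (unitary_mulr _ fwu) (unitary_mulr _ (unitaryM uu fwu)) flow_cnorm.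
  have -> : cnorm (star w - 1) = cnorm (w - 1) by rewrite -[in LHS](star1 A) -starB cnorm_star.
  have : s * (M + 1 + 1) <= k * T.
    apply: ler_pM => //; [lra|exact: le_trans st tauk|].
    by rewrite /T; nra.
  move: V1; lra.
have uv t : cnorm (u t - v t) <= eps / 4.
  have -> : u t - v t = (1 - star w) * u t + star w * u t * f t (1 - w).
    by rewrite flowB flow1 /v; ncring.
  rewrite (le_trans (cnormD_le _ _))// (unitary_mulr _ (coc_unitary uc t)).
  rewrite (unitary_mull _ (unitaryM (unitaryS wu) (coc_unitary uc t))) flow_cnorm.
  have -> : cnorm (1 - star w) = cnorm (w - 1).
    by rewrite -[in LHS](star1 A) -starB cnorm_star cnormB.
  by rewrite (cnormB 1); lra.
have pos t : 0 <= t <= 1 -> cnorm (u t - V t) <= eps.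
  move=> /andP[t0 t1]; rewrite (le_trans (cdist_tri (v t) _ _))//.
  have /andP[] := truncn_itv (divr_ge0 t0 (ltW tau0)).
  set j := Num.truncn _; rewrite ler_pdivlMr// ltr_pdivrMr// -natr1 => j1 j2.
  pose s := t - tau *+ j.
  have sE : t = tau *+ j + s by rewrite /s subrKC.
  have st : 0 <= s <= tau by rewrite /s -[tau *+ j]mulr_natl; apply/andP; split; lra.
  have -> : v t - V t = (v (tau *+ j) - V (tau *+ j)) * f (tau *+ j) (v s) +
     V (tau *+ j) * f (tau *+ j) (v s - V s).
    by rewrite sE (cocD vc) (cocD Vc) flowB; ncring.
  have := cnormD_le ((v (tau *+ j) - V (tau *+ j)) * f (tau *+ j) (v s))
    (V (tau *+ j) * f (tau *+ j) (v s - V s)).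
  have fvu : unitary (f (tau *+ j) (v s)).
    by split; rewrite -flowS -flowM ?(coc_unitary vc s).1 ?(coc_unitary vc s).2 flow1.
  rewrite (unitary_mulr _ fvu) (unitary_mull _ (coc_unitary Vc _)) flow_cnorm.
  have : cnorm (v (tau *+ j) - V (tau *+ j)) <= eps / 8.
    rewrite (le_trans (coc_dist_mul _ _ vc Vc))//.
    apply: (@le_trans _ _ (j%:R * (tau * (eps / 8)))); first by rewrite ler_wpM2l.
    rewrite mulrA ler_piMl//; lra.
  have := small s st; have := uv t; lra.
move=> t /andP[t1 t2]; have [t0|t0] := leP 0 t; first by apply: pos; rewrite t0.
have nt : 0 <= - t <= 1 by apply/andP; split; lra.
have := pos _ nt; rewrite -(opprK t) (coc_neg uc) (coc_neg Vc) opprK.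
by rewrite -flowB flow_cnorm -starB cnorm_star.
Qed.

End CocycleApprox.

Lemma injective_card (F : fieldType) (I Q : finType) (T : I -> Q -> F) :
  (forall v : I -> F, (forall q, \sum_i v i * T i q = 0) -> forall i, v i = 0) ->
  (#|I| <= #|Q|)%N.
Proof.
move=> h; pose M : 'M[F]_(#|I|, #|Q|) := \matrix_(a, b) T (enum_val a) (enum_val b).
suff /eqP <- : row_free M by exact: rank_leq_col.
rewrite -kermx_eq0; apply/eqP/row_matrixP => r; rewrite row0.
have : row r (kermx M) *m M = 0 by rewrite -row_mul mulmx_ker row0.
set v := row r _ => /rowP vM; apply/rowP => a; rewrite [RHS]mxE -[a]enum_valK.
apply: (h (fun i => v 0 (enum_rank i))) => q.
have := vM (enum_rank q); rewrite !mxE => vq; rewrite -[RHS]vq.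
rewrite [RHS](reindex enum_rank) /=; last by exists enum_val => i _; rewrite ?enum_rankK ?enum_valK.
by apply: eq_bigr => b _; rewrite !mxE !enum_rankK.
Qed.

(** * Sizes of matrix subalgebras *)

Section Cardinals.
Variables (R : realType) (A : cstarAlgType R).

Lemma mspan_card_le (I J : finType) (e : I -> I -> A) (g : J -> J -> A) :
  munits e -> munits g -> mspan e `<=` mspan g -> (#|I| <= #|J|)%N.
Proof.
move=> em gm eg.
have /choice[c hc] (p : I * I) : exists c, e p.1 p.2 = mx_comb g c.
  by apply: eg; exact: mspan_mu.
suff : (#|{: I * I}| <= #|{: J * J}|)%N.
  by rewrite !card_prod !mulnn leq_sqr.
apply: (injective_card (T := fun p q => c p q.1 q.2)) => v hv [i j].
have : mx_comb e (fun i j => v (i, j)) = mx_comb e (fun _ _ => 0).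
  rewrite [RHS]/mx_comb [RHS]big1 => [|k _]; last first.
    by rewrite big1// => l _; rewrite scale0r.
  rewrite /mx_comb pair_big /=.
  under eq_bigr => p _ do rewrite (hc p) mx_combZ.
  rewrite exchange_big big1// => k _; rewrite exchange_big big1// => l _.
  rewrite -scaler_suml (_ : \sum_i _ = 0) ?scale0r// -[RHS](hv (k, l)).
  by apply: eq_bigr => -[].
by move/(mx_comb_inj em)/(_ i j).
Qed.

Lemma mspan_card (I J : finType) (e : I -> I -> A) (g : J -> J -> A) :
  munits e -> munits g -> mspan e = mspan g -> #|I| = #|J|.
Proof.
by move=> em gm eg; apply/eqP; rewrite eqn_leq !(mspan_card_le em gm, mspan_card_le gm em)// eg.
Qed.

Lemma mu_diag_real (I : finType) (e : I -> I -> A) (z : I -> R[i]) :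
  munits e -> star (mu_diag e z) = mu_diag e z -> forall i, z i = (complex.Re (z i))%:C.
Proof.
move=> em; rewrite mu_diagS// => /(mu_diag_inj em) h i.
have := h i; case: (z i) => x y /= [].
by move=> /eqP; rewrite eq_sym -subr_eq0 opprK -mulr2n mulrn_eq0 /= => /eqP ->.
Qed.

(** The eigenvalues of the self-adjoint part [y] of [x] are rounded at 1/2. An eigenvalue r
    satisfies |r (r - 1)| <= 4k and one factor is at least 1/2 in modulus, so rounding costs at most
    8k; the last k is the distance from [y] to [q]. *)
Lemma near_projection (I : finType) (e : I -> I -> A) (x q : A) (k : R) :
  munits e -> mspan e x -> q * q = q -> star q = q -> cnorm q <= 1 ->
  k <= 32^-1 -> cnorm (x - q) <= k ->
  exists (g : I -> I -> A) (b : pred I), [/\ munits g, mspan g = mspan e,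
    \sum_i g i i = \sum_i e i i & cnorm (mu_diag g (fun i => (b i)%:R) - q) <= 9 * k].
Proof.
move=> em xs qq sq q1 k32 xq.
have k0 : 0 <= k := le_trans (cnorm_ge0 _) xq.
pose y := (2^-1 : R[i]) *: (x + star x).
have ys : mspan e y by apply: mspanZ; apply: mspanD => //; exact: mspanS.
have conj2 : Num.conj (2^-1 : R[i]) = 2^-1 by rewrite fmorphV rmorph_nat.
have sy : star y = y by rewrite /y starZ conj2 starD starK addrC.
have yq : cnorm (y - q) <= k.
  have -> : y - q = (2^-1 : R[i]) *: ((x - q) + star (x - q)).
    rewrite starB sq -{1}(half_half q) -scalerDr -scalerBr; congr (_ *: _).
    by ncring.
  rewrite cnormZE normc_half.
  by have := cnormD_le (x - q) (star (x - q)); rewrite cnorm_star; lra.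
have yy : cnorm (y * y - y) <= 4 * k.
  have -> : y * y - y = (y - q) * (y - q) + (y - q) * q + q * (y - q) - (y - q).
    by rewrite !mulrBl !mulrBr qq; ncring.
  have := cnormB_le ((y - q) * (y - q) + (y - q) * q + q * (y - q)) (y - q).
  have := cnormD_le ((y - q) * (y - q) + (y - q) * q) (q * (y - q)).
  have := cnormD_le ((y - q) * (y - q)) ((y - q) * q).
  have := cnormMM_le yq yq; have := cnormMM_le yq q1; have := cnormMM_le q1 yq.
  have : k * k <= k by rewrite ler_piMr//; lra.
  lra.
have [|g [z [gm ge g1 yz]]] := normal_diag em ys; first by rewrite sy.
have zr : forall i, z i = (complex.Re (z i))%:C.
  by apply: (mu_diag_real gm); rewrite -yz sy.
pose b i := 2^-1 < complex.Re (z i).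
exists g, b; split => //.
suff : cnorm (mu_diag g (fun i => (b i)%:R) - y) <= 8 * k.
  move=> h; apply: le_trans (cdist_tri y _ _) _; lra.
rewrite yz mu_diagB; apply: mu_diag_le => // [|i]; first by rewrite mulr_ge0.
have : cnorm (mu_diag g (fun i => z i * z i - z i)) <= 4 * k.
  by rewrite -mu_diagB -mu_diagM// -yz.
move=> /(le_trans (mu_diag_coef gm _ i)) /=.
set r := complex.Re (z i).
have -> : (b i)%:R - z i = ((b i)%:R - r)%:C :> R[i].
  by rewrite rmorphB rmorph_nat /= (zr i).
have -> : z i * z i - z i = (r * r - r)%:C :> R[i].
  by rewrite rmorphB rmorphM /= (zr i).
rewrite !normcR ler_norml => /andP[h1 h2]; rewrite ler_norml /b -/r.
case: (ltP 2^-1 r) => hr /=; apply/andP; split; nra.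
Qed.

(* For a projection [q] of [C m'] near a diagonal unit of [E], the spaces [q (C m')]
   to the power [K] and [C m'] embed into each other, so that [#|I|] is [#|K|]
   times the rank of [q]. *)
Lemma unital_card_dvd (C : nat -> set A) (K : finType) (E : K -> K -> A) :
  full_tower C -> munits E -> unital E ->
  exists m, forall m', (m <= m')%N -> forall (I : finType) (e : I -> I -> A),
    munits e -> unital e -> mspan e = C m' -> (#|K| %| #|I|)%N.
Proof.
move=> [_ Cup Cd] Em E1; pose o := unital_nonempty E1.
pose N : R := #|K|%:R; have N0 : 1 <= N.
  by rewrite ler1n; apply/card_gt0P; exists o.
(* Each of the [#|K|] error terms in both counts below is at most 13 k, so their sum is at most
   13/64. *)
have [k [k0 kN]] : exists k : R, 0 < k /\ 64 * (k * N) = 1.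
  have N1 : N != 0 by rewrite gt_eqF//; lra.
  exists (64 * N)^-1; rewrite invr_gt0 invfM -mulrA mulVf// mulr1 mulfV//.
  by split => //; lra.
have k64 : 64 * k <= 1 by nra.
have Cmono n m : (n <= m)%N -> C n `<=` C m.
  elim: m => [|m IH]; first by rewrite leqn0 => /eqP ->.
  rewrite leq_eqVlt => /orP[/eqP ->//|]; rewrite ltnS => /IH h.
  exact: subset_trans h (Cup m).
have [m [x hx]] : exists m (x : K -> A), forall i, C m (x i) /\ cnorm (E o i - x i) <= k.
  have /choice[mx hmx] i : exists mx : nat * A, C mx.1 mx.2 /\ cnorm (E o i - mx.2) <= k.
    by have [m [y h]] := Cd (E o i) k k0; exists (m, y).
  exists (\max_i (mx i).1)%N, (fun i => (mx i).2) => i; have [h1 h2] := hmx i.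
  by split => //; apply: Cmono h1; exact: leq_bigmax.
exists m => m' mm' I e em e1 eC.
have xs i : mspan e (x i) by rewrite eC; apply: Cmono mm' _ _; case: (hx i).
have xE i : cnorm (x i - E o i) <= k by rewrite cnormB; case: (hx i).
have k32 : k <= 32^-1 by lra.
have E00 : cnorm (E o o) <= 1 by rewrite mu_norm.
have [g [b [gm ge g1 pE]]] := near_projection em (xs o) (muMM Em o o o) (muS Em o o) E00 k32 (xE o).
set p := mu_diag g _ in pE.
pose J : finType := {i : I | b i}.
have pg (l : I) j : p * g l j = (b l)%:R *: g l j by rewrite /p mu_diagMl.
have gu : unital g by rewrite /unital g1.
pose i0 := unital_nonempty gu.
have xg i : exists c, x i = mx_comb g c.
  by have := xs i; rewrite -ge.
have /choice[c hc] := xg.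
have xv i j : x i * g j i0 = \sum_l c i l j *: g l i0.
  rewrite (hc i) /mx_comb mulr_suml; apply: eq_bigr => l _.
  rewrite mulr_suml (bigD1 j)//= big1 ?addr0 => [|q /negPf qj].
    by rewrite -scalerAl (muMM gm).
  by rewrite -scalerAl (muM gm) qj scaler0.
have sxv i l : star (x i) * g l i0 = \sum_j Num.conj (c i l j) *: g j i0.
  rewrite (hc i) mx_combS// /mx_comb mulr_suml; apply: eq_bigr => j _.
  rewrite mulr_suml (bigD1 l)//= big1 ?addr0 => [|q /negPf ql].
    by rewrite -scalerAl (muMM gm).
  by rewrite -scalerAl (muM gm) ql scaler0.
have col_inj (v : I -> R[i]) : \sum_j v j *: g j i0 = 0 -> forall j, v j = 0.
  move=> hv j; have := congr1 (fun y => g j j * y) hv; rewrite mulr0 mulr_sumr.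
  rewrite (bigD1 j)//= big1 ?addr0 => [|q /negPf qj].
    rewrite -scalerAr (muMM gm) => /eqP; rewrite scaler_eq0 (negPf (mu_neq0 gm _ _)) orbF.
    by move/eqP.
  by rewrite -scalerAr (muM gm) eq_sym qj scaler0.
have p1 : cnorm p <= 1.
  by apply: mu_diag_le => // i; case: (b i); rewrite ?Normc.normc1 ?Normc.normc0.
have x2 i : cnorm (x i) <= 1 + k.
  by have := cnormD_le (x i - E o i) (E o i); rewrite subrK mu_norm//; have := xE i; lra.
have kk : k * k <= k by rewrite ler_piMr//; lra.
(* A vector [V] with p x_i V = 0 for all i is killed by the sum of the x_i* p x_i, which is within
   1/2 of 1. *)
have le1 : (#|I| <= #|{: K * J}|)%N.
  apply: (injective_card (T := fun (j : I) (q : K * J) => c q.1 (val q.2) j)) => v hv.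
  apply: col_inj; set V := \sum_j _.
  have pxV i : p * (x i * V) = 0.
    rewrite /V mulr_sumr; under eq_bigr => j _ do rewrite -scalerAr xv scaler_sumr.
    rewrite exchange_big mulr_sumr big1// => l _.
    rewrite mulr_sumr; under eq_bigr => j _ do rewrite scalerA -scalerAr pg.
    rewrite -scaler_suml; case bl : (b l); last by rewrite scale0r scaler0.
    by rewrite (hv (i, exist _ l bl)) scale0r.
  have Z : cnorm (\sum_i (star (E o i) * E o o * E o i - star (x i) * p * x i)) <= 2^-1.
    rewrite (le_trans (cnorm_sum _ _ _))//.
    apply: (@le_trans _ _ (\sum_(i : K) (13 * k))); last first.
      by rewrite sumr_const -[_ *+ _]mulr_natl -/N; lra.
    apply: ler_sum => i _.
    have -> : star (E o i) * E o o * E o i - star (x i) * p * x i =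
      - (star (x i - E o i) * E o o * E o i + star (x i) * (p - E o o) * E o i
         + star (x i) * p * (x i - E o i)) by rewrite starB; ncring.
    rewrite cnormN.
    have sx : cnorm (star (x i - E o i)) <= k by rewrite cnorm_star.
    have sx2 : cnorm (star (x i)) <= 1 + k by rewrite cnorm_star.
    have Ei : cnorm (E o i) <= 1 by rewrite mu_norm.
    have := cnormMM_le (cnormMM_le sx E00) Ei.
    have := cnormMM_le (cnormMM_le sx2 pE) Ei.
    have := cnormMM_le (cnormMM_le sx2 p1) (xE i).
    set y1 := star (x i) * p * _; set y2 := star (x i) * _ * _; set y3 := _ * E o o * _.
    have := cnormD_le (y3 + y2) y1; have := cnormD_le y3 y2; nra.
  have Z1 : \sum_i star (E o i) * E o o * E o i = 1.
    by rewrite -E1; apply: eq_bigr => i _; rewrite (muS Em) !(muMM Em).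
  have Z2 : (\sum_i star (x i) * p * x i) * V = 0.
    by rewrite mulr_suml big1// => i _; rewrite -!mulrA pxV mulr0.
  apply/eqP; rewrite -cnorm_eq0 eq_le cnorm_ge0 andbT.
  have : cnorm V <= 2^-1 * cnorm V.
    rewrite -{1}[V]mul1r -[1 * V]subr0 -Z2 -Z1 -mulrBl -sumrB.
    exact: cnormMl_le.
  by have := cnorm_ge0 V; lra.
(* Conversely the map sending a family (W_i) in the range of [p] to the sum of the x_i* W_i is
   injective, since p x_j x_i* p is close to [p] for i = j and to 0 otherwise. *)
have le2 : (#|{: K * J}| <= #|I|)%N.
  apply: (injective_card (T := fun (q : K * J) (j : I) => Num.conj (c q.1 (val q.2) j))) => w hw.
  pose W i := \sum_(l : J) w (i, l) *: g (val l) i0.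
  have pW i : p * W i = W i.
    rewrite mulr_sumr; apply: eq_bigr => l _.
    by rewrite -scalerAr pg (valP l) scale1r.
  have sW : \sum_i star (x i) * W i = 0.
    under eq_bigr => i _.
      rewrite mulr_sumr; under eq_bigr => l _ do rewrite -scalerAr sxv scaler_sumr.
      over.
    rewrite pair_big /= exchange_big big1// => j _.
    under eq_bigr => q _ do rewrite scalerA.
    rewrite -scaler_suml -[RHS](scale0r (g j i0)); congr (_ *: _).
    by rewrite -[RHS](hw j); apply: eq_bigr => -[].
  have bound i j : cnorm ((i == j)%:R *: p - p * x j * star (x i) * p) <= 13 * k.
    have EE : E o j * star (E o i) = (i == j)%:R *: E o o.
      rewrite (muS Em) (muM Em) eq_sym; case: eqP => _; rewrite ?scale1r ?scale0r//.
    have -> : (i == j)%:R *: p - p * x j * star (x i) * p =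
      p * ((i == j)%:R *: (p - E o o)) * p
      - p * ((x j - E o j) * star (E o i) + x j * star (x i - E o i)) * p.
      have pp : p * p = p.
        rewrite /p mu_diagM//; apply: eq_bigr => l _.
        by case: (b l); rewrite ?mulr1 ?mulr0.
      rewrite scalerBr -EE starB mulrBr -scalerAr pp mulrBl -scalerAl pp.
      by ncring.
    have h1 : cnorm ((i == j)%:R *: (p - E o o)) <= 9 * k.
      by case: eqP => _; rewrite ?scale1r// scale0r cnorm0 mulr_ge0// ltW.
    have sx : cnorm (star (x i - E o i)) <= k by rewrite cnorm_star.
    have sE : cnorm (star (E o i)) <= 1 by rewrite cnorm_star mu_norm.
    have h2 := le_trans (cnormD_le _ _) (lerD (cnormMM_le (xE j) sE) (cnormMM_le (x2 j) sx)).
    have h3 := cnormMM_le (cnormMM_le p1 h1) p1.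
    have h4 := cnormMM_le (cnormMM_le p1 h2) p1.
    by rewrite (le_trans (cnormB_le _ _))//; nra.
  have Wj j : cnorm (W j) <= 13 * k * \sum_i cnorm (W i).
    have -> : W j = \sum_i ((i == j)%:R *: p - p * x j * star (x i) * p) * W i.
      under eq_bigr => i _ do rewrite mulrBl -scalerAl -[p * x j * _ * _ * _]mulrA pW.
      rewrite sumrB [X in _ - X](_ : _ = 0) ?subr0.
        rewrite (bigD1 j)//= eqxx scale1r big1 ?addr0// => i /negPf ->.
        by rewrite scale0r.
      under eq_bigr => i _ do rewrite -mulrA.
      by rewrite -mulr_sumr sW mulr0.
    rewrite (le_trans (cnorm_sum _ _ _))// mulr_sumr ler_sum// => i _.
    exact: cnormMl_le.
  have S0 : \sum_i cnorm (W i) = 0.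
    apply/eqP; rewrite eq_le sumr_ge0 ?andbT => [|i _]; last exact: cnorm_ge0.
    set S := \sum_i _ in Wj *.
    have : S <= N * (13 * k * S).
      rewrite {1}/S /N mulr_natl -sumr_const; exact: ler_sum.
    have : 0 <= S by apply: sumr_ge0 => i _; exact: cnorm_ge0.
    have -> : N * (13 * k * S) = 13 * (k * N) * S by ring.
    nra.
  have W0 i : W i = 0.
    apply: cnorm0_eq0; apply/eqP; rewrite eq_le cnorm_ge0 andbT -S0 (bigD1 i)//=.
    by rewrite lerDl sumr_ge0// => j _; exact: cnorm_ge0.
  move=> [i l]; have := congr1 (fun y => g (val l) (val l) * y) (W0 i).
  rewrite mulr0 mulr_sumr (bigD1 l)//= big1 ?addr0 => [|q /negPf ql].
    rewrite -scalerAr (muMM gm) => /eqP; rewrite scaler_eq0 (negPf (mu_neq0 gm _ _)) orbF.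
    by move/eqP.
  by rewrite -scalerAr (muM gm) (inj_eq val_inj) eq_sym ql scaler0.
have : #|I| = (#|K| * #|J|)%N by apply/eqP; rewrite eqn_leq -card_prod le1 le2.
by move=> ->; rewrite dvdn_mulr.
Qed.

End Cardinals.

(** * Tensor products *)

Section Isomorphisms.
Variables (R : realType) (A B : cstarAlgType R).

Lemma sm_munits (f : A -> B) (I : finType) (e : I -> I -> A) :
  star_morphism f -> munits e -> unital e ->
  munits (fun i j => f (e i j)) /\ unital (fun i j => f (e i j)).
Proof.
move=> fm em e1; have u1 : unital (fun i j => f (e i j)).
  by rewrite /unital -(sm_sum fm) e1 (sm1 fm).
split => //; split.
- by move=> i j k l; rewrite -(smM fm) (muM em); case: ifP => // _; rewrite (sm0 fm).
- by move=> i j; rewrite -(smS fm) (muS em).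
- move=> i; apply/negP => /eqP f0; have := oner_neq0 B.
  rewrite -u1 big1 ?eqxx// => j _.
  by rewrite -(muMM em j i j) -(muMM em j i i) !(smM fm) f0 mulr0 mul0r.
Qed.

Lemma star_iso_inv_morphism (phi : star_isomorphism A B) :
  star_morphism (star_iso_inv phi).
Proof.
have fm := star_iso_morphism phi.
have K := star_iso_funK phi; have K' := star_iso_invK phi.
split.
- by move=> c x y; apply: (can_inj K); rewrite (smD fm) (smZ fm) !K'.
- by move=> x y; apply: (can_inj K); rewrite (smM fm) !K'.
- by apply: (can_inj K); rewrite (sm1 fm) K'.
- by move=> x; apply: (can_inj K); rewrite (smS fm) !K'.
Qed.

Lemma star_iso_cnorm (phi : star_isomorphism A B) x : cnorm (phi x) = cnorm x.
Proof.
apply/le_anti; rewrite (sm_contr (star_iso_morphism phi))/=.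
by rewrite -{1}(star_iso_funK phi x) (sm_contr (star_iso_inv_morphism phi)).
Qed.

Lemma star_iso_inv_cnorm (phi : star_isomorphism A B) x :
  cnorm (star_iso_inv phi x) = cnorm x.
Proof. by rewrite -{2}(star_iso_invK phi x) star_iso_cnorm. Qed.

Lemma sm_eq_dense (f g : A -> B) (S : set A) : star_morphism f -> star_morphism g ->
  (forall x (e : R), 0 < e -> exists2 y, S y & cnorm (x - y) <= e) ->
  (forall y, S y -> f y = g y) -> forall x, f x = g x.
Proof.
move=> fm gm Sd fg x; apply: small_eq => e e0; have e2 : 0 < e / 2 by lra.
have [y Sy xy] := Sd x _ e2.
rewrite (le_trans (cdist_tri (f y) _ _))// -(smB fm) (fg y Sy) -(smB gm).
have := sm_contr fm (x - y); have := sm_contr gm (y - x); rewrite (cnormB y); lra.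
Qed.

End Isomorphisms.

Section TensorBasics.
Variables (R : realType) (A B : cstarAlgType R) (T : tensor_product A B).
Implicit Types (a : A) (b : B).

Lemma tensDl a a' b : tens T (a + a') b = tens T a b + tens T a' b.
Proof. by have := tens_linear_l T b 1 a a'; rewrite !scale1r. Qed.
Lemma tensDr a b b' : tens T a (b + b') = tens T a b + tens T a b'.
Proof. by have := tens_linear_r T a 1 b b'; rewrite !scale1r. Qed.
Lemma tens0l b : tens T 0 b = 0.
Proof. by apply: (addrI (tens T 0 b)); rewrite -tensDl !addr0. Qed.
Lemma tens0r a : tens T a 0 = 0.
Proof. by apply: (addrI (tens T a 0)); rewrite -tensDr !addr0. Qed.
Lemma tensZl (c : R[i]) a b : tens T (c *: a) b = c *: tens T a b.
Proof. by have := tens_linear_l T b c a 0; rewrite !addr0 tens0l addr0. Qed.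
Lemma tensZr (c : R[i]) a b : tens T a (c *: b) = c *: tens T a b.
Proof. by have := tens_linear_r T a c b 0; rewrite !addr0 tens0r addr0. Qed.

Lemma tens_l_morphism : star_morphism (fun a => tens T a 1).
Proof.
split.
- by move=> c x y; rewrite tensDl tensZl.
- by move=> x y; rewrite -tensM mulr1.
- exact: tens11.
- by move=> x; rewrite -tens_star star1.
Qed.

Lemma tens_r_morphism : star_morphism (fun b => tens T 1 b).
Proof.
split.
- by move=> c x y; rewrite tensDr tensZr.
- by move=> x y; rewrite -tensM mulr1.
- exact: tens11.
- by move=> x; rewrite -tens_star star1.
Qed.

Lemma tensE a b : tens T a b = tens T a 1 * tens T 1 b.
Proof. by rewrite -tensM mulr1 mul1r. Qed.

Lemma tens_comm a b : tens T a 1 * tens T 1 b = tens T 1 b * tens T a 1.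
Proof. by rewrite -!tensM !mulr1 !mul1r. Qed.

Lemma tens_cnorm a b : cnorm (tens T a b) <= cnorm a * cnorm b.
Proof.
rewrite tensE cnormMM_le//; first exact: (sm_contr tens_l_morphism).
exact: (sm_contr tens_r_morphism).
Qed.

(** The linear span as the intersection of all subspaces containing the elementary tensors:
    membership is then its own induction principle. *)
Definition tspan (S1 : set A) (S2 : set B) : set T :=
  [set x | forall S : set T, S 0 -> (forall x y, S x -> S y -> S (x + y)) ->
     (forall (c : R[i]) x, S x -> S (c *: x)) ->
     (forall a b, S1 a -> S2 b -> S (tens T a b)) -> S x].

Lemma tspan_tens S1 S2 a b : S1 a -> S2 b -> tspan S1 S2 (tens T a b).
Proof. by move=> h h' S _ _ _; exact. Qed.

Lemma tspan0 S1 S2 : tspan S1 S2 0.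
Proof. by []. Qed.

Lemma tspanD S1 S2 x y : tspan S1 S2 x -> tspan S1 S2 y -> tspan S1 S2 (x + y).
Proof.
move=> hx hy S S0 SD SZ St.
have h1 := hx _ S0 SD SZ St; have h2 := hy _ S0 SD SZ St; exact: SD.
Qed.

Lemma tspanZ S1 S2 (c : R[i]) x : tspan S1 S2 x -> tspan S1 S2 (c *: x).
Proof. move=> hx S S0 SD SZ St; have h1 := hx _ S0 SD SZ St; exact: SZ. Qed.

Section TensorUnits.
Variables (I J : finType) (e : I -> I -> A) (g : J -> J -> B).
Hypotheses (em : munits e) (e1 : unital e) (gm : munits g) (g1 : unital g).

Definition tens_units : I * J -> I * J -> T :=
  mu_prod (fun i j => tens T (e i j) 1) (fun p q => tens T 1 (g p q)).

Lemma tens_units_munits : munits tens_units /\ unital tens_units.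
Proof.
have [h1 h2] := sm_munits tens_l_morphism em e1.
have [h3 h4] := sm_munits tens_r_morphism gm g1.
by split; [apply: mu_prod_munits => // *; exact: tens_comm|exact: mu_prod_unital].
Qed.

Lemma tspan_units : mspan tens_units = tspan (mspan e) (mspan g).
Proof.
have [h1 h2] := sm_munits tens_l_morphism em e1.
have [h3 h4] := sm_munits tens_r_morphism gm g1.
have [tm _] := tens_units_munits.
apply/seteqP; split.
  apply: mspanP; [exact: tspan0|exact: tspanD|exact: tspanZ|].
  move=> [i p] [j q]; rewrite /tens_units /mu_prod /= -tensE.
  by apply: tspan_tens; exact: mspan_mu.
move=> x; apply; [exact: mspan0|exact: mspanD|exact: mspanZ|].
move=> a b ha hb; rewrite tensE; apply: mspanM => //.
  move: a ha; apply: mspanP.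
  - by rewrite tens0l; exact: mspan0.
  - by move=> x1 x2; rewrite tensDl; exact: mspanD.
  - by move=> c x1; rewrite tensZl; exact: mspanZ.
  - move=> i j; rewrite (mu_prod_l (fun i j => tens T (e i j) 1) h4 i j).
    by apply: mspan_sum => k _; exact: (mspan_mu tens_units (i, k) (j, k)).
move: b hb; apply: mspanP.
- by rewrite tens0r; exact: mspan0.
- by move=> x1 x2; rewrite tensDr; exact: mspanD.
- by move=> c x1; rewrite tensZr; exact: mspanZ.
- move=> i j; rewrite (mu_prod_r (fun p q => tens T 1 (g p q)) h2 i j).
  by apply: mspan_sum => k _; exact: (mspan_mu tens_units (k, i) (k, j)).
Qed.

End TensorUnits.

Lemma tower_mono (D : cstarAlgType R) (C : nat -> set D) : full_tower C ->
  forall n m, (n <= m)%N -> C n `<=` C m.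
Proof.
move=> [_ Cup _] n m; elim: m => [|m IH]; first by rewrite leqn0 => /eqP ->.
rewrite leq_eqVlt => /orP[/eqP ->//|]; rewrite ltnS => /IH h.
exact: subset_trans h (Cup m).
Qed.

Lemma tensor_tower (C1 : nat -> set A) (C2 : nat -> set B) :
  full_tower C1 -> full_tower C2 -> full_tower (fun m => tspan (C1 m) (C2 m)).
Proof.
move=> t1 t2; have mono1 := tower_mono t1; have mono2 := tower_mono t2.
have [h1 _ d1] := t1; have [h2 _ d2] := t2.
have up n m : (n <= m)%N -> tspan (C1 n) (C2 n) `<=` tspan (C1 m) (C2 m).
  move=> nm x; apply; [exact: tspan0|exact: tspanD|exact: tspanZ|].
  by move=> a b ha hb; apply: tspan_tens; [exact: mono1 nm _ ha|exact: mono2 nm _ hb].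
split.
- move=> m; have [I [e [em e1 <-]]] := h1 m; have [J [g [gm g1 <-]]] := h2 m.
  exists (I * J)%type, (tens_units e g).
  by have [? ?] := tens_units_munits em e1 gm g1; split => //; exact: tspan_units.
- by move=> m; exact: up.
pose D : set T := [set x | forall e : R, 0 < e -> exists m y,
  tspan (C1 m) (C2 m) y /\ cnorm (x - y) <= e].
have DD x y : D x -> D y -> D (x + y).
  move=> hx hy e e0; have e2 : 0 < e / 2 by lra.
  have [m [x' [mx nx]]] := hx _ e2; have [m' [y' [my ny]]] := hy _ e2.
  exists (maxn m m'), (x' + y'); split.
    by apply: tspanD; [exact: up (leq_maxl _ _) _ mx|exact: up (leq_maxr _ _) _ my].
  by rewrite opprD addrACA (le_trans (cnormD_le _ _))//; lra.
have D0 : D 0.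
  by move=> e e0; exists 0%N, 0; rewrite subrr cnorm0 ltW//; split => //; exact: tspan0.
have Dt a b : D (tens T a b).
  move=> e e0; have a0 := cnorm_ge0 a; have b0 := cnorm_ge0 b.
  pose k := cnorm a + cnorm b + 1; have k0 : 0 < k by rewrite /k; lra.
  pose d := Num.min 1 (e / k).
  have dp : 0 < d by rewrite lt_min ltr01 divr_gt0.
  have dk : d * k <= e by rewrite -ler_pdivlMr// ge_min lexx orbT.
  have d1' : d <= 1 by rewrite ge_min lexx.
  have [m [a' [ma na]]] := d1 a d dp; have [m' [b' [mb nb]]] := d2 b d dp.
  exists (maxn m m'), (tens T a' b'); split.
    by apply: tspan_tens; [exact: mono1 (leq_maxl _ _) _ ma|exact: mono2 (leq_maxr _ _) _ mb].
  have -> : tens T a b - tens T a' b' = tens T (a - a') b + tens T a' (b - b').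
    rewrite -(scaleN1r a') -(scaleN1r b') tensDl tensDr tensZl tensZr.
    by rewrite !scaleN1r addrA subrK.
  have n1 := le_trans (tens_cnorm (a - a') b) (ler_wpM2r b0 na).
  have a1 : cnorm a' <= cnorm a + 1.
    by have := cnormD_le a (a' - a); rewrite subrKC cnormB; lra.
  have n2 := le_trans (tens_cnorm a' (b - b')) (ler_pM (cnorm_ge0 _) (cnorm_ge0 _) a1 nb).
  rewrite (le_trans (cnormD_le _ _))// (le_trans (lerD n1 n2))//.
  by rewrite (le_trans _ dk)// /k; nra.
move=> x e e0; have e2 : 0 < e / 2 by lra.
have /dense_cnorm/(_ x _ e2)[y [n [a [b ->]]] xy] := @tens_dense _ _ _ T.
have Dy : D (\sum_(k < n) tens T (a k) (b k)) by apply: (big_ind D).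
have [m [z [mz yz]]] := Dy _ e2.
exists m, z; split => //; apply: (le_trans (cdist_tri _ _ _) (le_trans (lerD (ltW xy) yz) _)).
lra.
Qed.

Lemma tensor_flow_inv (g : flow A) (h : flow B) (d : flow T) C1 C2 :
  is_tensor_flow g h d -> flow_inv g C1 -> flow_inv h C2 ->
  flow_inv d (fun m => tspan (C1 m) (C2 m)).
Proof.
move=> dE gi hi m t x hx.
apply: (hx [set y | tspan (C1 m) (C2 m) (d t y)]) => /=.
- by rewrite flow_z; exact: tspan0.
- by move=> y z hy hz; rewrite flowDD; exact: tspanD.
- by move=> c y hy; rewrite flowZ; exact: tspanZ.
- by move=> a b ha hb; rewrite dE; apply: tspan_tens; [exact: gi|exact: hi].
Qed.

End TensorBasics.

(** * A flow absorbing all spectral patterns *)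

Definition flow_units (R : realType) (A : cstarAlgType R) (f : flow A) (I : finType)
    (e : I -> I -> A) (a : I -> R) : Prop :=
  [/\ munits e, unital e &
      forall t i j, f t (e i j) = expi (t * (a i - a j)) *: e i j].

(* Up to an error in the eigenvalues, the flow contains every inner flow of every
   unital matrix subalgebra of [A], far out in the tower. *)
Definition flow_slots (R : realType) (A : cstarAlgType R) (f : flow A)
    (C : nat -> set A) : Prop :=
  forall (J : finType) (E : J -> J -> A) (c : J -> R) (eps : R) M,
    munits E -> unital E -> 0 < eps ->
    exists m (G : J -> J -> A) (c' : J -> R),
      [/\ flow_units f G c', forall p q, C m (G p q),
          forall p q x, C M x -> G p q * x = x * G p q &
          forall p, `|c' p - c p| <= eps].

Lemma dependent_seq (T : Type) (P : nat -> T -> Prop) (S : nat -> T -> T -> Prop) x0 :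
  P 0%N x0 -> (forall n x, P n x -> exists2 y, P n.+1 y & S n x y) ->
  exists s : nat -> T, s 0%N = x0 /\ forall n, P n (s n) /\ S n (s n) (s n.+1).
Proof.
move=> P0 PS.
have /choice[g hg] (nx : nat * T) : exists y, P nx.1 nx.2 -> P nx.1.+1 y /\ S nx.1 nx.2 y.
  have [h|h] := pselect (P nx.1 nx.2); last by exists x0.
  by have [y ? ?] := PS _ _ h; exists y.
pose s := fix s n := if n is m.+1 then g (m, s m) else x0.
exists s; split => //.
have sP n : P n (s n) by elim: n => [//|n /(hg (n, s n))[]].
by move=> n; split => //; have [] := hg (n, s n) (sP n).
Qed.

Section FlowUnits.
Variables (R : realType) (A : cstarAlgType R) (f : flow A).

Lemma flow_units_prod (I J : finType) (e : I -> I -> A) (a : I -> R)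
    (g : J -> J -> A) (b : J -> R) :
  flow_units f e a -> flow_units f g b ->
  (forall i j p q, e i j * g p q = g p q * e i j) ->
  flow_units f (mu_prod e g) (fun p => a p.1 + b p.2).
Proof.
move=> [em e1 ea] [gm g1 gb] eg; split; [exact: mu_prod_munits|exact: mu_prod_unital|].
move=> t [i p] [j q]; rewrite /mu_prod /= flowM ea gb -scalerAl -scalerAr scalerA -expiD.
by congr (expi _ *: _); ring.
Qed.

Lemma flow_units_conj (I : finType) (e : I -> I -> A) a t x :
  flow_units f e a -> mspan e x ->
  f t x = diag_exp e a t * x * star (diag_exp e a t).
Proof.
move=> [em e1 ea]; move: x; apply: mspanP.
- by rewrite flow_z mulr0 mul0r.
- by move=> x y hx hy; rewrite flowDD hx hy mulrDr mulrDl.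
- by move=> c x hx; rewrite flowZ hx -scalerAr -scalerAl.
- by move=> i j; rewrite ea (diag_exp_conj em).
Qed.

(** When the spectrum of [h] consists of copies of [c] indexed by [L], summing over [L] is the
    embedding of the smaller matrix algebra with multiplicity [#|L|]. *)
Lemma flow_units_block (K J L : finType) (h : K -> K -> A) (v : K -> R)
    (c : J -> R) (b : J * L -> K) :
  flow_units f h v -> bijective b -> (forall x l, v (b (x, l)) = c x) ->
  flow_units f (fun x y => \sum_l h (b (x, l)) (b (y, l))) c.
Proof.
move=> [hm h1 hv] bb vc; have binj := bij_inj bb; have [b' bK b'K] := bb.
pose o := (b' (unital_nonempty h1)).2.
split; last first.
- move=> t x y; rewrite flow_sum scaler_sumr; apply: eq_bigr => l _.
  by rewrite hv !vc.
- rewrite /unital pair_big /= -[RHS]h1 [RHS](reindex b) /=; last exact: onW_bij.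
  by apply: eq_bigr => -[x l].
have mulE x y z w : (\sum_l h (b (x, l)) (b (y, l))) * (\sum_l h (b (z, l)) (b (w, l)))
    = if y == z then \sum_l h (b (x, l)) (b (w, l)) else 0.
  rewrite mulr_suml; case: eqP => [->|/eqP yz].
    apply: eq_bigr => l _; rewrite mulr_sumr (bigD1 l)//= (muMM hm) big1 ?addr0//.
    move=> k kl; rewrite (muM hm) (inj_eq binj) xpair_eqE eqxx /= eq_sym (negPf kl).
    by [].
  rewrite big1// => l _; rewrite mulr_sumr big1// => k _.
  by rewrite (muM hm) (inj_eq binj) xpair_eqE (negPf yz).
split=> [x y z w|x y|x]; first exact: mulE.
  by rewrite star_sum; apply: eq_bigr => l _; rewrite (muS hm).
apply/negP => /eqP G0; have := mu_neq0 hm (b (x, o)) (b (x, o)).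
have <- : (\sum_l h (b (x, l)) (b (x, l))) * h (b (x, o)) (b (x, o)) =
    h (b (x, o)) (b (x, o)).
  rewrite mulr_suml (bigD1 o)//= (muMM hm) big1 ?addr0// => k ko.
  by rewrite (muM hm) (inj_eq binj) xpair_eqE eqxx /= (negPf ko).
by rewrite G0 mul0r eqxx.
Qed.

(** The coefficients are explicit and do not depend on the units: two towers built from the same
    index types thus have the same inclusions, and a nonzero coefficient joins only pairs with the
    same second index. *)
Lemma mu_prod_refine (I J : finType) (e : I -> I -> A) (g : J -> J -> A) i j :
  unital g -> e i j = mx_comb (mu_prod e g)
    (fun k l => ((k.1 == i) && (l.1 == j) && (k.2 == l.2))%:R).
Proof.
move=> g1.
rewrite (mu_prod_l e g1 i j) /mx_comb.
under [RHS]eq_bigr => k _.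
  rewrite -(pair_bigA _ (fun x y => ((k.1 == i) && (x == j) && (k.2 == y))%:R *:
    mu_prod e g k (x, y))) /= exchange_big /=.
  over.
rewrite -(pair_bigA _ (fun x y => \sum_z \sum_w (((x == i) && (w == j) && (y == z))%:R *:
    mu_prod e g (x, y) (w, z)))) /= exchange_big /=; apply: eq_bigr => p _.
rewrite (bigD1 i)//= [X in _ + X]big1 ?addr0; last first.
  move=> x /negPf xi; rewrite big1// => z _; rewrite big1// => w _.
  by rewrite xi scale0r.
rewrite (bigD1 p)//= [X in _ + X]big1 ?addr0; last first.
  move=> z /negPf zp; rewrite big1// => w _.
  by rewrite (eq_sym p) zp andbF scale0r.
rewrite (bigD1 j)//= [X in _ + X]big1 ?addr0; last first.
  by move=> w /negPf wj; rewrite wj andbF scale0r.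
by rewrite !eqxx scale1r.
Qed.

End FlowUnits.

Section DiagonalFlow.
Variables (R : realType) (A : cstarAlgType R) (K : nat -> finType).
Variables (e : forall n, K n -> K n -> A) (a : forall n, K n -> R).
Hypotheses (em : forall n, munits (@e n)) (e1 : forall n, unital (@e n)).
Hypothesis er : forall n i j, exists c, @e n i j = mx_comb (@e n.+1) c /\
  forall k l, c k l != 0 -> @a n.+1 k - @a n.+1 l = @a n i - @a n j.
Hypothesis ed : forall x (d : R), 0 < d ->
  exists2 y, (exists n, mspan (@e n) y) & cnorm (x - y) <= d.

Let F t n i j := expi (t * (@a n i - @a n j)) *: @e n i j.

Let Fm t n : munits (@F t n).
Proof.
split=> [i j k l|i j|i].
- rewrite /F -scalerAl -scalerAr scalerA (muM (em n)).
  case: eqP => [->|_]; last by rewrite scaler0.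
  by rewrite -expiD; congr (expi _ *: _); ring.
- rewrite /F starZ (muS (em n)) -expiN; congr (expi _ *: _); ring.
- by rewrite /F subrr mulr0 expi0 scale1r (mu_neq0 (em n)).
Qed.

Let F1 t n : unital (@F t n).
Proof.
rewrite /unital -[RHS](e1 n); apply: eq_bigr => i _.
by rewrite /F subrr mulr0 expi0 scale1r.
Qed.

Let iso t : exists phi : star_isomorphism A A, forall n i j, phi (@e n i j) = @F t n i j.
Proof.
apply: (tower_iso em (Fm t) e1 (F1 t)) => //.
- move=> n i j; have [c [hc ha]] := er i j; exists c; split => //.
  rewrite /F hc /mx_comb scaler_sumr; apply: eq_bigr => k _.
  rewrite scaler_sumr; apply: eq_bigr => l _; rewrite !scalerA.
  have [->|/ha ->] := eqVneq (c k l) 0; first by rewrite mulr0 mul0r.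
  by rewrite mulrC.
- move=> x d d0; have [y [n hy] xy] := ed x d0; exists y => //; exists n.
  move: y hy {xy}; apply: mspanP;
    [exact: mspan0|exact: mspanD|exact: mspanZ|move=> i j].
  have -> : @e n i j = expi (- (t * (a i - a j))) *: @F t n i j.
    by rewrite /F scalerA -expiD addNr expi0 scale1r.
  by apply: mspanZ; exact: mspan_mu.
Qed.

(** For fixed [t] the units multiplied by their phases form a tower with the same inclusions,
    because a nonzero coefficient joins only pairs with equal eigenvalue differences ([er]). So
    [tower_iso] yields the automorphism at time [t]; the group law and continuity are checked on the
    dense union. *)
Lemma diagonal_flow : exists f : flow A, forall n, flow_units f (@e n) (@a n).
Proof.
have /choice[p hp] := iso.
have pm t := star_iso_morphism (p t).
have pE n t x : mspan (@e n) x ->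
    p t x = diag_exp (@e n) (@a n) t * x * star (diag_exp (@e n) (@a n) t).
  move: x; apply: mspanP.
  - by rewrite (sm0 (pm t)) mulr0 mul0r.
  - by move=> x y hx hy; rewrite (smD (pm t)) hx hy mulrDr mulrDl.
  - by move=> c x hx; rewrite (smZ (pm t)) hx -scalerAr -scalerAl.
  - by move=> i j; rewrite hp (diag_exp_conj (em n)).
have pS n t x : mspan (@e n) x -> mspan (@e n) (p t x).
  move=> hx; rewrite (pE n)//; apply: mspanM => //; last first.
    by apply: mspanS => //; exact: mspan_diag.
  by apply: mspanM => //; exact: mspan_diag.
pose S : set A := [set y | exists n, mspan (@e n) y].
have p0 x : p 0 x = x.
  apply: (sm_eq_dense (g := id) (pm 0) _ ed); first by split.
  by move=> y [n hy]; rewrite (pE n)// diag_exp0// star1 mulr1 mul1r.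
have pD s t x : p (s + t) x = p s (p t x).
  have pc : star_morphism (fun x => p s (p t x)).
    split.
    - by move=> c y z; rewrite (smD (pm t)) (smZ (pm t)) (smD (pm s)) (smZ (pm s)).
    - by move=> y z; rewrite (smM (pm t)) (smM (pm s)).
    - by rewrite (sm1 (pm t)) (sm1 (pm s)).
    - by move=> y; rewrite (smS (pm t)) (smS (pm s)).
  apply: (sm_eq_dense (pm (s + t)) pc ed) => y [n hy].
  rewrite (pE n)// (pE n s) ?(pE n t)//; last by have := pS n t y hy; rewrite (pE n).
  by rewrite diag_expD// starM !mulrA.
have pb t : bijective (p t) by exists (star_iso_inv (p t)); [exact: star_iso_funK|exact: star_iso_invK].
have pcont x : continuous (fun t : R => p t x : normed A).
  apply/continuous_cnorm => t d d0; have d5 : 0 < d / 5 by lra.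
  have [y [n hy] xy] := ed x d5.
  pose k := cnorm y + 1; have k0 : 0 < k by rewrite /k; have := cnorm_ge0 y; lra.
  have [r r0 hr] := diag_exp_cont (em n) (e1 n) (@a n) (divr_gt0 d5 k0).
  exists r => // s ts.
  have -> : p t x - p s x = p s (p (t - s) x - x).
    by rewrite (smB (pm s)) -pD subrKC.
  rewrite star_iso_cnorm.
  have h1 : cnorm (p (t - s) x - p (t - s) y) <= d / 5.
    by rewrite -(smB (pm _)) star_iso_cnorm.
  have h2 : cnorm (p (t - s) y - y) <= 2 * (d / 5).
    rewrite (pE n)//; set U := diag_exp _ _ _.
    have U1 : cnorm U <= 1.
      by rewrite unitary_norm//; exact: diag_exp_unitary.
    have h11 : cnorm (1 : A) <= 1 by rewrite cnorm1.
    have := conj_dist y y U1 h11; rewrite star1 mulr1 mul1r subrr cnorm0 addr0.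
    move=> hc; rewrite (le_trans hc)//; have hU := ltW (hr _ ts); rewrite -/U in hU.
    have yk : cnorm y <= k by rewrite /k; lra.
    have h3 := ler_pM (cnorm_ge0 _) (cnorm_ge0 _) hU yk.
    rewrite divfK ?gt_eqF// in h3.
    by rewrite -mulrA (le_trans (ler_wpM2l _ h3))//; lra.
  have h3 := cdist_tri (p (t - s) y) (p (t - s) x) x.
  have h4 := cdist_tri y (p (t - s) y) x.
  by rewrite (cnormB x) in xy; lra.
exists (Flow pm pb p0 pD pcont) => n; split => // t i j; exact: hp.
Qed.

End DiagonalFlow.

(** With the trivial flow, [flow_complement] gives plain relative commutants. *)
Definition id_flow (R : realType) (A : cstarAlgType R) : flow A.
Proof.
apply: (@Flow R A (fun _ x => x)) => //; first by exists id.
by move=> x; apply/continuous_cnorm => t e e0; exists 1 => // s _; rewrite subrr cnorm0.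
Defined.

Lemma matrix_tower_full (R : realType) (A : cstarAlgType R) (An : nat -> set A) :
  matrix_tower An -> full_tower An.
Proof.
move=> [hA up A1 Ad]; split => // [m|x e e0]; last first.
  have /dense_cnorm/(_ x e e0)[y [m _ my] xy] := Ad; exists m, y.
  by split => //; exact: ltW.
have An1 : An m 1 by elim: m => [//|m /up].
have [k [e [[k0 el ei er] [eM eS]]]] := hA m.
have e0 : e 0 = 0 by have := el (-1) 0 0; rewrite scaler0 addr0 scaleN1r addNr.
have eD M N : e (M + N) = e M + e N by have := el 1 M N; rewrite !scale1r.
have eZ c M : e (c *: M) = c *: e M by have := el c M 0; rewrite e0 !addr0.
have esum (J : Type) (r : seq J) (P : pred J) F :
    e (\sum_(j <- r | P j) F j) = \sum_(j <- r | P j) e (F j).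
  exact: (big_morph e eD e0).
(* The homomorphism is not assumed unital, but its range contains the unit of the algebra. *)
have e1 : e 1%:M = 1.
  have [M _ hM] : range e 1 by rewrite er.
  by rewrite -[e 1%:M]mulr1 -hM -eM mul1mx.
exists 'I_k, (fun i j => e (delta_mx i j)); split.
- split => [i j p q|i j|i].
  + by rewrite -eM mul_delta_mx_cond; case: eqP => _; rewrite ?mulr1n ?mulr0n.
  + rewrite -eS trmx_delta; congr e; apply/matrixP => p q; rewrite !mxE.
    by case: andP => _; rewrite ?rmorph0 ?rmorph1.
  + rewrite -e0 (inj_eq ei); apply/negP => /eqP /matrixP/(_ i i).
    by rewrite !mxE !eqxx => /eqP; rewrite oner_eq0.
- by rewrite /unital -esum -[RHS]e1 -mx1_sum_delta.
- rewrite -er; apply/seteqP; split => [x [c ->]|x [M _ <-]].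
    exists (\matrix_(i, j) c i j) => //.
    rewrite [X in e X]matrix_sum_delta esum; apply: eq_bigr => i _.
    by rewrite esum; apply: eq_bigr => j _; rewrite eZ mxE.
  exists (fun i j => M i j); rewrite [X in e X]matrix_sum_delta esum.
  by apply: eq_bigr => i _; rewrite esum; apply: eq_bigr => j _; rewrite eZ.
Qed.

Lemma subtower (R : realType) (A : cstarAlgType R) (C : nat -> set A) (g : nat -> nat) :
  full_tower C -> (forall n, (g n < g n.+1)%N) -> full_tower (C \o g).
Proof.
move=> tC gi; have [Cm _ Cd] := tC; split => [m|m|x e e0]; first exact: Cm.
- exact: tower_mono tC _ _ (ltnW (gi m)).
- have [m [y [my xy]]] := Cd x e e0; exists m, y; split => //=.
  have h : (m <= g m)%N by elim: m {my} => // m IH; exact: leq_ltn_trans (gi m).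
  exact: tower_mono tC _ _ h y my.
Qed.

(** By divisibility the enumeration of [K] splits into whole periods of length [#|J|]: the remainder
    of an index is the position in the list, the quotient the copy. *)
Lemma block_pattern (J K : finType) (c : J -> rat) : (#|J| %| #|K|)%N -> J ->
  exists (L : finType) (b : J * L -> K), bijective b /\
    forall x l, nth 0 [seq c x | x <- enum J] (enum_rank (b (x, l)) %% #|J|) = c x.
Proof.
move=> JK x0; have J0 : (0 < #|J|)%N by apply/card_gt0P; exists x0.
pose q := (#|K| %/ #|J|)%N.
have qE : (q * #|J| = #|K|)%N by rewrite divnK.
have bd (p : J * 'I_q) : (enum_rank p.1 + p.2 * #|J| < #|K|)%N.
  rewrite -qE (@leq_trans (p.2.+1 * #|J|))%N//; last by rewrite leq_mul2r ltn_ord orbT.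
  by rewrite mulSn ltn_add2r.
pose b p := enum_val (Ordinal (bd p)) : K.
have modE x l : (enum_rank (b (x, l)) %% #|J|)%N = enum_rank x.
  by rewrite /b enum_valK /= addnC modnMDl modn_small.
exists 'I_q, b; split.
  apply: inj_card_bij; last by rewrite card_prod card_ord mulnC qE.
  move=> [x l] [y k] xy; have xy' : x = y.
    by apply: enum_rank_inj; apply: val_inj; rewrite /= -(modE x l) -(modE y k) xy.
  congr (_, _) => //; move/enum_val_inj: xy => /(congr1 val) /=; rewrite xy' => /eqP.
  by rewrite eqn_add2l eqn_pmul2r// => /eqP/val_inj.
by move=> x l; rewrite modE (nth_map x) -?cardE// nth_enum_rank.
Qed.

Lemma rat_approx (R : realType) (c e : R) : 0 < e -> exists r : rat, `|ratr r - c| <= e.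
Proof.
move=> e0; have [|r] := @rat_in_itvoo R (c - e) (c + e); first lra.
by rewrite in_itv /= => /andP[h1 h2]; exists r; rewrite ler_distl; lra.
Qed.

Record stage (R : realType) (A : cstarAlgType R) := Stage {
  idx : finType; un : idx -> idx -> A; ev : idx -> R }.

Section SlotFlow.
Variables (R : realType) (A : cstarAlgType R) (AA : tensor_product A A).
Hypotheses (hA : UHF_algebra A) (hAA : isomorphic AA A).

(** The tensor square of a level, carried to [A] by the isomorphism, is a unital matrix subalgebra
    of squared size; by [unital_card_dvd] this size divides those of all sufficiently late
    levels. *)
Lemma square_subtower (C : nat -> set A) : full_tower C -> exists g : nat -> nat,
  (forall n, (g n < g n.+1)%N) /\
  forall n (I J : finType) (e : I -> I -> A) (f : J -> J -> A),
    munits e -> munits f -> unital f -> mspan e = C (g n) -> mspan f = C (g n.+1) ->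
    (#|I| * #|I| %| #|J|)%N.
Proof.
move=> tC; have [phi _] := hAA.
have /choice[h hh] n : exists m, (n < m)%N /\
    forall (I J : finType) (e : I -> I -> A) (f : J -> J -> A),
    munits e -> munits f -> unital f -> mspan e = C n -> mspan f = C m ->
    (#|I| * #|I| %| #|J|)%N.
  have [Cm _ _] := tC; have [I [e [em e1 he]]] := Cm n.
  have [tm t1] := tens_units_munits AA em e1 em e1.
  have [tm' t1'] := sm_munits (star_iso_morphism phi) tm t1.
  have [m hm] := unital_card_dvd tC tm' t1'.
  exists (maxn m n.+1); split; first exact: leq_maxr.
  move=> I' J e' f em' fm f1 he' hf.
  rewrite (mspan_card em' em) ?he ?he'// -card_prod.
  exact: (hm (maxn m n.+1) (leq_maxl _ _) J f fm f1 hf).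
exists (fun n => iter n h 0%N); split => [n|n I J e f em fm f1 he hf].
  by have [] := hh (iter n h 0%N).
have [_ hI] := hh (iter n h 0%N); exact: hI he hf.
Qed.

(** The 2-adic valuation takes each value at arbitrarily large numbers, so each list recurs
    infinitely often. *)
Let list_at n : seq rat := odflt [::] (unpickle (logn 2 n)).

Let list_often (s : seq rat) M : exists2 n, (M <= n)%N & list_at n = s.
Proof.
exists (2 ^ pickle s * M.*2.+1)%N.
  rewrite (@leq_trans M.*2.+1)%N ?leq_pmull ?expn_gt0//.
  by rewrite -addnn ltnW// ltnS leq_addr.
by rewrite /list_at lognM ?expn_gt0// pfactorK// logn_coprime ?addn0 ?pickleK// coprime2n /= odd_double.
Qed.

Lemma slot_flow : exists (f : flow A) (D : nat -> set A),
  [/\ UHF_flow f, full_tower D, flow_inv f D & flow_slots f D].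
Proof.
have [An tA] := hA; have tC := matrix_tower_full tA.
have [g [gi gd]] := square_subtower tC.
pose D := An \o g; have tD : full_tower D := subtower tC gi.
(* For an empty list the default of [nth] applies and all eigenvalues are 0. *)
pose nu (K : finType) n (p : K) : R := ratr (nth 0 (list_at n)
  (enum_rank p %% size (list_at n))).
pose P n (s : stage A) := [/\ munits (@un R A s), unital (@un R A s) & mspan (@un R A s) = D n].
pose S n (s s' : stage A) := exists (K : finType) (H : K -> K -> A),
  [/\ s' = Stage (mu_prod (@un R A s) H) (fun p => ev p.1 + nu K n p.2),
      munits H /\ unital H, forall i j p q, @un R A s i j * H p q = H p q * @un R A s i j,
      (#|idx s| %| #|K|)%N & forall p q, D n.+1 (H p q)].
have [Dm Dup Dd] := tD.
have [I0 [e0 [em0 e10 he0]]] := Dm 0%N.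
have [|n [I e a] [/= em e1 he]|s [s0 hs]] :=
    @dependent_seq (stage A) P S (Stage e0 (fun=> 0)); first by [].
  have [J [f [fm f1 hf]]] := Dm n.+1.
  have ef i j : mspan f (e i j).
    by rewrite hf; apply: Dup; rewrite -he; exact: mspan_mu.
  have fid t k l : id_flow A t (e k l) = expi (t * (0 - 0)) *: e k l.
    by rewrite subrr mulr0 expi0 scale1r.
  have [//|K [H [_ [[Hm H1] eH Hf HC _]]]] :=
    flow_complement (f := id_flow A) (b := fun=> 0) fm _ em e1 ef fid.
  have pm : munits (mu_prod e H) by exact: mu_prod_munits.
  have p1 := mu_prod_unital e1 H1.
  exists (Stage (mu_prod e H) (fun p => a p.1 + nu K n p.2)).
    by split => //; rewrite /= HC.
  exists K, H; split => //; last by move=> p q; rewrite -hf.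
  have I0' : (0 < #|I|)%N by apply/card_gt0P; exists (unital_nonempty e1).
  (* The next level has size [#|I| * #|K|] and is divisible by the square of [#|I|]; cancelling one
     factor leaves the divisibility wanted for [K]. *)
  have := gd n _ _ _ _ em pm p1 he; rewrite HC hf => /(_ erefl).
  by rewrite card_prod dvdn_pmul2l.
have hP n : P n (s n) by have [] := hs n.
have [n|n|n i j|x d d0|f hf] := @diagonal_flow R A (fun n => idx (s n))
   (fun n => @un R A (s n)) (fun n => @ev R A (s n)).
- by have [] := hP n.
- by have [] := hP n.
- have [_ [K [H [-> [Hm H1] eH _ _]]]] := hs n.
  eexists; split; first exact: mu_prod_refine.
  move=> [k p] [l q] /=; case: (boolP (_ && _)) => [|_]; last by rewrite eqxx.
  by move=> /andP[/andP[/eqP -> /eqP ->] /eqP ->] _; ring.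
- have [m [y [my xy]]] := Dd x d d0; exists y => //; exists m.
  by have [_ _ ->] := hP m.
have fD : flow_inv f D.
  move=> n t x; have [em e1 <-] := hP n => hx.
  rewrite (flow_units_conj t (hf n) hx); apply: mspanM => //; last first.
    by apply: mspanS => //; exact: mspan_diag.
  by apply: mspanM => //; exact: mspan_diag.
exists f, D; split => //.
  exists D.
    have [h1 h2 h3 h4] := tA; split => //.
    - by move=> n; exact: h1.
    - exact: tower_mono tC _ _ (leq0n _) _ h3.
    - apply/dense_cnorm => x e e0'; have e2 : 0 < e / 2 by lra.
      have [m [y [my xy]]] := Dd x _ e2; exists y; first by exists m.
      by lra.
  move=> n t; apply/seteqP; split => [_ [x hx <-]|x hx]; first exact: fD.
  by exists (f (- t) x); [exact: fD|rewrite flowVK].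
move=> J E c eps M Em E1 eps0.
have /choice[r hr] x := rat_approx (c x) eps0.
have [m0 hm0] := unital_card_dvd tD Em E1.
have [n Mn hn] := list_often [seq r x | x <- enum J] (maxn m0 M).
have [[em e1 he] [K [H [sE [Hm H1] eH dK HD]]]] := hs n.
(* [n] is large enough for [#|J|] to divide the size of level [n], which divides [#|K|]. *)
have JK : (#|J| %| #|K|)%N.
  apply: dvdn_trans dK; apply: (hm0 n) he => //.
  exact: leq_trans (leq_maxl _ _) Mn.
have [L [b [bb hb]]] := block_pattern r JK (unital_nonempty E1).
have fH : flow_units f H (nu K n).
  split => // t p q; have := hf n.+1; rewrite sE => -[_ _ hE].
  rewrite (mu_prod_r H e1) flow_sum scaler_sumr; apply: eq_bigr => i _.
  by rewrite hE /=; congr (expi _ *: _); ring.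
exists n.+1, (fun x y => \sum_l H (b (x, l)) (b (y, l))), (fun x => ratr (r x)).
split.
- apply: (flow_units_block fH bb) => x l.
  by rewrite /nu hn size_map -cardE hb.
- move=> p q; rewrite -/(D _); have [I [f' [_ _ h']]] := Dm n.+1.
  by rewrite -h'; apply: mspan_sum => l _; rewrite h'; exact: HD.
- move=> p q x hx; rewrite mulr_suml mulr_sumr; apply: eq_bigr => l _.
  symmetry; apply: (mspan_comm (e := @un R A (s n))); first by move=> i j; exact: eH.
  rewrite he; apply: tower_mono tD _ _ _ x hx.
  exact: leq_trans (leq_maxr _ _) Mn.
- exact: hr.
Qed.

End SlotFlow.

(** * Back and forth *)

Section Slots.
Variables (R : realType) (A : cstarAlgType R).

Lemma shift_tower (C : nat -> set A) n : full_tower C -> full_tower (fun m => C (n + m)%N).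
Proof.
move=> tC; have [Cm Cup Cd] := tC; split => [m|m|x e e0]; first exact: Cm.
  by rewrite addnS; exact: Cup.
have [m [y [my xy]]] := Cd x e e0; exists m, y; split => //.
exact (tower_mono tC (leq_addl n m) my).
Qed.

Lemma perturb_inv (f : flow A) (V : R -> A) (Vc : cocycle f V) (C : nat -> set A) n :
  full_tower C -> flow_inv f C -> (forall t, C n (V t)) ->
  flow_inv (perturb_flow Vc) (fun m => C (n + m)%N).
Proof.
move=> tC fC VC m t x hx; have [Cm _ _] := tC.
have hV : C (n + m)%N (V t) := tower_mono tC (leq_addr m n) (VC t).
have hf := fC (n + m)%N t x hx; rewrite /perturb_flow /= /perturb.
have [I [e [em e1 he]]] := Cm (n + m)%N; rewrite -he in hV hf *.
by apply: mspanM => //; [exact: mspanM|exact: mspanS].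
Qed.

(** Slots chosen to commute with level n + M commute with the cocycle, which lies in level n, so the
    perturbation acts on them like [f]. *)
Lemma perturb_slots (f : flow A) (V : R -> A) (Vc : cocycle f V) (C : nat -> set A) n :
  full_tower C -> (forall t, C n (V t)) -> flow_slots f C ->
  flow_slots (perturb_flow Vc) (fun m => C (n + m)%N).
Proof.
move=> tC VC fs J E c eps M Em E1 eps0.
have [m [G [c' [[Gm G1 fG] GC Gx hc]]]] := fs J E c eps (n + M)%N Em E1 eps0.
exists m, G, c'; split => //; last first.
  by move=> p q; exact (tower_mono tC (leq_addl n m) (GC p q)).
split => // t i j; rewrite /perturb_flow /= /perturb fG -scalerAr -scalerAl.
have hV : C (n + M)%N (V t) := tower_mono tC (leq_addr M n) (VC t).
by rewrite -Gx// -mulrA (coc_unitary Vc t).2 mulr1.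
Qed.

End Slots.

(** The slots are 1 (x) G with [G] a slot of [h]. The isomorphism turns the given units into units
    of [B]; nothing is carried back, because only the index type and the eigenvalues pass to the
    conclusion. *)
Lemma tensor_slots (R : realType) (A B : cstarAlgType R) (T : tensor_product A B)
    (phi : star_isomorphism T B) (g : flow A) (h : flow B) (d : flow T)
    (C1 : nat -> set A) (C2 : nat -> set B) :
  is_tensor_flow g h d -> flow_slots h C2 -> C1 0%N 1 ->
  (forall m, C1 0%N `<=` C1 m) ->
  flow_slots d (fun m => @tspan R A B T (C1 m) (C2 m)).
Proof.
move=> dE hs C11 C1m J E c eps M Em E1 eps0.
have [Em' E1'] := sm_munits (star_iso_morphism phi) Em E1.
have [m [G [c' [[Gm G1 fG] GC Gx hc]]]] := hs J _ c eps M Em' E1' eps0.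
have [Gm' G1'] := sm_munits (tens_r_morphism T) Gm G1.
exists m, (fun p q => tens T 1 (G p q)), c'; split => //.
- split => // t i j; by rewrite dE flow1 fG tensZr.
- by move=> p q; apply: tspan_tens => //; exact: C1m.
- move=> p q x hx; apply: (hx [set x | tens T 1 (G p q) * x = x * tens T 1 (G p q)]) => /=.
  + by rewrite mulr0 mul0r.
  + by move=> y z hy hz; rewrite mulrDl mulrDr hy hz.
  + by move=> k y hy; rewrite -scalerAl -scalerAr hy.
  + by move=> a b ha hb; rewrite -!tensM mul1r mulr1 Gx.
Qed.

Section BackAndForth.
Variables (R : realType) (A : cstarAlgType R).

(** One direction of the intertwining: [E] is completed to a whole far level by its relative
    commutant [H], and the spectrum of [H] is imitated by a slot [G] of the other flow commuting
    with [F]. Only the side of [C] exhausts a level, so the roles have to alternate. *)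
Lemma half_step (f g : flow A) (C D : nat -> set A) (I : finType)
    (E F : I -> I -> A) (a : I -> R) (eps : R) M m k :
  full_tower C -> flow_inv f C -> full_tower D -> flow_slots g D ->
  flow_units f E a -> (forall i j, C m (E i j)) ->
  munits F -> (forall i j, D k (F i j)) -> 0 < eps ->
  exists (J : finType) (H G : J -> J -> A) (c d : J -> R),
    [/\ flow_units f H c, flow_units g G d & forall p, `|c p - d p| <= eps] /\
    [/\ forall i j p q, E i j * H p q = H p q * E i j,
        forall i j p q, F i j * G p q = G p q * F i j,
        exists2 n, (M <= n)%N & mspan (mu_prod E H) = C n &
        exists n, forall p q, D n (G p q)].
Proof.
move=> tC fC tD gs [Em E1 fE] EC Fm FD eps0; have [Cm _ _] := tC.
pose n := maxn M m; have [K [e [em e1 he]]] := Cm n.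
have eE i j : mspan e (E i j).
  by rewrite he; exact (tower_mono tC (leq_maxr _ _) (EC i j)).
have ef t x : mspan e x -> mspan e (f t x) by rewrite he; exact: fC.
have [J [H [c [[Hm H1] EH eH EHe fH]]]] := flow_complement em ef Em E1 eE fE.
have [l [G [d [Gf GD Gx hd]]]] := gs J H c eps k Hm H1 eps0.
exists J, H, G, c, d; split; split => //.
- by move=> p; rewrite distrC.
- by move=> i j p q; rewrite Gx.
- by exists n; [exact: leq_maxl|rewrite EHe].
- by exists l.
Qed.

(** Read through [phi], both flows are implemented on the span by diagonal unitaries in the same
    units, so only the differences of eigenvalues matter. *)
Lemma conj_flow_dist (f g : flow A) (phi : star_isomorphism A A) (I : finType)
    (E F : I -> I -> A) (a b : I -> R) (d k : R) t x :
  flow_units f E a -> flow_units g F b -> (forall i j, phi (E i j) = F i j) ->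
  (forall i, `|a i - b i| <= d) -> `|t| <= 1 ->
  0 <= k -> (forall h, `|h| <= d -> Normc.normc (expi h - 1) <= k) ->
  mspan E x -> cnorm (f t x - conj_by phi g t x) <= 2 * k * cnorm x.
Proof.
move=> fE gF EF ab t1 k0 hk hx; have [Em E1 _] := fE; have [Fm F1 gb] := gF.
have pm := star_iso_inv_morphism phi.
have -> : conj_by phi g t x = diag_exp E b t * x * star (diag_exp E b t).
  rewrite /conj_by; move: x hx; apply: mspanP.
  - by rewrite (sm0 (star_iso_morphism phi)) flow_z (sm0 pm) mulr0 mul0r.
  - move=> x y hx hy; rewrite (smD (star_iso_morphism phi)) flowDD (smD pm) hx hy.
    by rewrite mulrDr mulrDl.
  - move=> c x hx; rewrite (smZ (star_iso_morphism phi)) flowZ (smZ pm) hx.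
    by rewrite -scalerAr -scalerAl.
  - move=> i j; rewrite EF gb (smZ pm) -EF star_iso_funK diag_exp_conj//.
rewrite (flow_units_conj t fE hx).
have ua : cnorm (diag_exp E a t) <= 1 by rewrite unitary_norm//; exact: diag_exp_unitary.
have ub : cnorm (diag_exp E b t) <= 1 by rewrite unitary_norm//; exact: diag_exp_unitary.
rewrite (le_trans (conj_dist x x ua ub))// subrr cnorm0 addr0.
rewrite ler_wpM2r ?cnorm_ge0// ler_wpM2l// mu_diagB//.
apply: mu_diag_le => // i; rewrite expi_dist; apply: hk.
by rewrite -mulrBr normrM (le_trans (ler_piMl _ t1))// normr_ge0.
Qed.

Record pair_stage := PairStage {
  idx2 : finType; unl : idx2 -> idx2 -> A; unr : idx2 -> idx2 -> A;
  evl : idx2 -> R; evr : idx2 -> R }.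

Theorem back_and_forth (f g : flow A) (C D : nat -> set A) (eps : R) :
  full_tower C -> flow_inv f C -> flow_slots f C ->
  full_tower D -> flow_inv g D -> flow_slots g D -> 0 < eps ->
  exists phi : star_isomorphism A A, forall t : R, -1 <= t <= 1 ->
    forall x, cnorm (f t x - conj_by phi g t x) <= eps * cnorm x.
Proof.
move=> tC fC fs tD gD gs eps0.
have e2 : 0 < eps / 2 by lra.
have [r r0 hr] := expi_cont e2.
(* Partial sums of the eigenvalue errors, halved at each step, with total r / 2. *)
pose err n : R := r / 2 * (1 - (2 ^+ n)^-1).
have errS n : err n + r / 2 / 2 ^+ n.+1 = err n.+1.
  have h : 2 ^+ n != 0 :> R by rewrite expf_neq0// pnatr_eq0.
  rewrite /err exprS; field. by [].
have err_small n : err n < r.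
  have h : 0 < (2 ^+ n)^-1 :> R by rewrite invr_gt0 exprn_gt0.
  rewrite /err; nra.
pose P n (s : pair_stage) : Prop := [/\ flow_units f (@unl s) (@evl s),
  flow_units g (@unr s) (@evr s),
  exists m, forall i j, C m (@unl s i j), exists m, forall i j, D m (@unr s i j) &
  forall i, `|@evl s i - @evr s i| <= err n].
(* Even steps fill a level of [C], odd steps a level of [D]; this makes both limit towers dense, as
   an isomorphism onto requires. *)
pose S n (s s' : pair_stage) := exists (J : finType) (H G : J -> J -> A) (c d : J -> R),
  [/\ s' = PairStage (mu_prod (@unl s) H) (mu_prod (@unr s) G)
        (fun p => evl p.1 + c p.2) (fun p => evr p.1 + d p.2),
      unital H, unital G &
      if odd n then exists2 m, (n <= m)%N & mspan (mu_prod (@unr s) G) = D m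
      else exists2 m, (n <= m)%N & mspan (mu_prod (@unl s) H) = C m].
have u1 (h : flow A) (hC : nat -> set A) : full_tower hC ->
   [/\ flow_units h (fun _ _ : unit => 1) (fun=> 0) & exists m, hC m 1].
  move=> [hm _ _]; split.
    split.
    - split => [[] [] [] []|_ _|_]; rewrite ?mulr1 ?star1 ?oner_neq0//.
    - by rewrite /unital big_const card_unit /= addr0.
    - by move=> t _ _; rewrite flow1 subrr mulr0 expi0 scale1r.
  by exists 0%N; have [I [e [em e1 <-]]] := hm 0%N; rewrite -e1; apply: mspan_sum => i _; exact: mspan_mu.
have [uf [mC hmC]] := u1 f C tC; have [ug [mD hmD]] := u1 g D tD.
have inTower (K L : finType) (e : K -> K -> A) (h : L -> L -> A) (Q : nat -> set A) :
    full_tower Q -> (exists m, forall i j, Q m (e i j)) ->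
    (exists m, forall i j, Q m (h i j)) ->
    exists m, forall i j, Q m (mu_prod e h i j).
  move=> tQ [m1 h1] [m2 h2]; exists (maxn m1 m2) => i j; have [Qm _ _] := tQ.
  have q1 := tower_mono tQ (leq_maxl m1 m2) (h1 i.1 j.1).
  have q2 := tower_mono tQ (leq_maxr m1 m2) (h2 i.2 j.2).
  have [I [e0 [em _ he]]] := Qm (maxn m1 m2); rewrite -he in q1 q2 *.
  exact: mspanM.
have spanTower (K : finType) (e : K -> K -> A) (Q : nat -> set A) n :
    mspan e = Q n -> exists m, forall i j, Q m (e i j).
  by move=> he; exists n => i j; rewrite -he; exact: mspan_mu.
have [|n s|s [s0 hs]] := @dependent_seq pair_stage P S
   (PairStage (fun _ _ : unit => 1) (fun _ _ => 1) (fun=> 0) (fun=> 0)).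
- split => //; [by exists mC|by exists mD|].
  by move=> i /=; rewrite subrr normr0 /err expr0 invr1 subrr mulr0.
- case: s => I E F a b [/= fE gF [mE EC] [mF FD] ab].
  have d0 : 0 < r / 2 / 2 ^+ n.+1 by rewrite divr_gt0 ?exprn_gt0//; lra.
  have [Em E1 _] := fE; have [Fm F1 _] := gF.
  suff [J [H [G [c [d [[fH gG cd] [EH FG [HC GD hn]]]]]]]] :
    exists (J : finType) (H G : J -> J -> A) (c d : J -> R),
    [/\ flow_units f H c, flow_units g G d & forall p, `|c p - d p| <= r / 2 / 2 ^+ n.+1] /\
    [/\ forall i j p q, E i j * H p q = H p q * E i j,
        forall i j p q, F i j * G p q = G p q * F i j &
        [/\ exists m, forall i j, C m (mu_prod E H i j),
        exists m, forall i j, D m (mu_prod F G i j) &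
        if odd n then exists2 m, (n <= m)%N & mspan (mu_prod F G) = D m
        else exists2 m, (n <= m)%N & mspan (mu_prod E H) = C m]].
    exists (PairStage (mu_prod E H) (mu_prod F G) (fun p => a p.1 + c p.2)
       (fun p => b p.1 + d p.2)).
      split => //=; [exact: flow_units_prod|exact: flow_units_prod|].
      move=> [i p] /=; rewrite opprD addrACA (le_trans (ler_normD _ _))//.
      by rewrite -errS lerD.
    exists J, H, G, c, d; split => //; [by case: fH|by case: gG].
  case: (odd n).
    have [J [G [H [d [c [[gG fH cd] [FG EH [l nl hl] hH]]]]]]] :=
      half_step n tD gD tC fs gF FD Em EC d0.
    exists J, H, G, c, d; split; first by split => // p; rewrite distrC.
    split => //; split; last by exists l.
      by apply: inTower => //; exists mE.
    exact: spanTower hl.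
  have [J [H [G [c [d [[fH gG cd] [EH FG [l nl hl] hG]]]]]]] :=
    half_step n tC fC tD gs fE EC Fm FD d0.
  exists J, H, G, c, d; split => //; split => //; split; last by exists l.
    exact: spanTower hl.
  by apply: inTower => //; exists mF.
have hP n : P n (s n) by have [] := hs n.
have dense_of (Q : nat -> set A) (X : forall n, idx2 (s n) -> idx2 (s n) -> A) (b : bool) :
    full_tower Q ->
    (forall n, odd n = b -> exists2 m, (n <= m)%N & mspan (@X n.+1) = Q m) ->
    forall x (e : R), 0 < e ->
      exists2 y, (exists n, mspan (@X n) y) & cnorm (x - y) <= e.
  move=> tQ hX x e e0; have [_ _ Qd] := tQ.
  have [m [y [my xy]]] := Qd x e e0; exists y => //.
  (* The first convenient step of parity [b] that is not before [m]. *)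
  have [|l nl hl] := hX (b + m.*2)%N; first by rewrite oddD odd_double addbF oddb.
  exists (b + m.*2).+1; rewrite hl; apply: (tower_mono tQ _ my).
  by rewrite (leq_trans _ nl)// -addnn addnA leq_addl.
have dC : forall x (e : R), 0 < e ->
    exists2 y, (exists n, mspan (@unl (s n)) y) & cnorm (x - y) <= e.
  apply: (dense_of C _ false tC) => n on.
  by have [_ [J [H [G [c [d [-> _ _]]]]]]] := hs n; rewrite on.
have [n|n|n|n|n i j|||phi hphi] := @tower_iso R A A (fun n => idx2 (s n))
  (fun n => @unl (s n)) (fun n => @unr (s n)).
- by have [[]] := hP n.
- by have [_ []] := hP n.
- by have [[]] := hP n.
- by have [_ []] := hP n.
- have [_ [J [H [G [c [d [-> H1 G1 _]]]]]]] := hs n.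
  by eexists; split; exact: mu_prod_refine.
- exact: dC.
- apply: (dense_of D _ true tD) => n on.
  by have [_ [J [H [G [c [d [-> _ _]]]]]]] := hs n; rewrite on.
exists phi => t /andP[t0 t1] x.
have t1' : `|t| <= 1 by rewrite ler_norml t0.
have k0 : 0 <= eps / 2 by lra.
(* Replacing [x] by [y] costs [d] for each flow, and [eps * d] because the estimate is relative to
   [cnorm y]. *)
apply/ler_addgt0Pr => e e0; pose d := e / (2 + eps).
have d0 : 0 < d by rewrite divr_gt0//; lra.
have [y [n hy] xy] := dC x d d0.
have [fE gF _ _ ab] := hP n.
have hk h : `|h| <= err n -> Normc.normc (expi h - 1) <= eps / 2.
  by move=> hh; apply: hr; exact: le_lt_trans hh (err_small n).
have h1 := conj_flow_dist fE gF (hphi n) ab t1' k0 hk hy.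
have pm := star_iso_inv_morphism phi.
have h2 : cnorm (f t x - f t y) <= d by rewrite -flowB flow_cnorm.
have h3 : cnorm (conj_by phi g t y - conj_by phi g t x) <= d.
  rewrite /conj_by -(smB pm) star_iso_inv_cnorm -flowB flow_cnorm.
  by rewrite -(smB (star_iso_morphism phi)) star_iso_cnorm cnormB.
have h4 := cdist_tri (f t y) (f t x) (conj_by phi g t x).
have h5 := cdist_tri (conj_by phi g t y) (f t y) (conj_by phi g t x).
have h6 : cnorm y <= cnorm x + d.
  by have := cnormD_le x (y - x); rewrite subrKC (cnormB y) => /le_trans -> //; rewrite lerD2l.
have h7 : d * (2 + eps) = e by rewrite divfK// gt_eqF//; lra.
have h8 : eps * cnorm y <= eps * (cnorm x + d) by rewrite ler_wpM2l// ltW.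
rewrite (_ : 2 * (eps / 2) = eps) in h1; last by field.
lra.
Qed.

End BackAndForth.

(** * Universal flows up to almost conjugacy *)

Lemma opnorm_lt (R : realType) (A : cstarAlgType R) (f : A -> A) (e k : R) :
  e < k -> (forall x, cnorm (f x) <= e * cnorm x) -> 0 <= e ->
  (opnorm f < k%:E)%E.
Proof.
move=> ek fe e0; apply: (@le_lt_trans _ _ e%:E); last by rewrite lte_fin.
apply: ge_ereal_sup => _ [x x1 <-]; rewrite lee_fin (le_trans (fe x))//.
by rewrite ler_piMr.
Qed.

Section Universal.
Variables (R : realType) (A : cstarAlgType R) (AA : tensor_product A A).
Hypotheses (hA : UHF_algebra A) (hAA : isomorphic AA A).

Lemma conj_flow (B D : cstarAlgType R) (phi : star_isomorphism B D) (g : flow D) :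
  exists f : flow B, forall t x, f t x = conj_by phi g t x.
Proof.
have pm := star_iso_morphism phi; have pm' := star_iso_inv_morphism phi.
have K := star_iso_funK phi; have K' := star_iso_invK phi.
unshelve eexists (@Flow R B (conj_by phi g) _ _ _ _ _) => //.
- move=> t; split.
  + by move=> c x y; rewrite /conj_by (smD pm) (smZ pm) flowDD flowZ (smD pm') (smZ pm').
  + by move=> x y; rewrite /conj_by (smM pm) flowM (smM pm').
  + by rewrite /conj_by (sm1 pm) flow1 (sm1 pm').
  + by move=> x; rewrite /conj_by (smS pm) flowS (smS pm').
- move=> t; exists (conj_by phi g (- t)) => x; rewrite /conj_by K'.
    by rewrite flowK K.
  by rewrite flowVK K.
- by move=> x; rewrite /conj_by flow0 K.
- by move=> s t x; rewrite /conj_by K' flowD.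
- move=> x; apply/continuous_cnorm => t e e0.
  have [d d0 hd] := flow_cont g (phi x) t e0; exists d => // s /hd.
  by rewrite /conj_by -(smB pm') star_iso_inv_cnorm.
Qed.

(* Here [f] is a perturbation of [gamma (x) alpha] with [alpha] the flow of
   [slot_flow]; the slots come from the second tensor factor. *)
Lemma universal_model (gamma : flow A) (w : R -> A) (eps : R) :
  universal_UHF_flow AA gamma -> cocycle gamma w -> 0 < eps ->
  exists (phi : star_isomorphism AA A) (f : flow AA) (C : nat -> set AA),
    [/\ full_tower C, flow_inv f C, flow_slots f C &
      forall t : R, -1 <= t <= 1 -> forall x,
        cnorm (conj_by phi (perturb gamma w) t x - f t x) <= eps * cnorm x].
Proof.
move=> [[Ag tA gAg] gu] wc eps0.
have [alpha [D [ua tD aD sD]]] := slot_flow hA hAA.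
have [delta dE [phi [u [uc du]]]] := gu alpha ua.
have tg := matrix_tower_full tA.
have gi : flow_inv gamma Ag by move=> m t x hx; rewrite -(gAg m t); exists x.
have [h hh] := conj_flow phi gamma.
have pm := star_iso_morphism phi; have pm' := star_iso_inv_morphism phi.
have K := star_iso_funK phi; have K' := star_iso_invK phi.
pose C m := @tspan R A A AA (Ag m) (D m).
have tC : full_tower C := tensor_tower AA tg tD.
have dC : flow_inv delta C := tensor_flow_inv dE gi aD.
have sC : flow_slots delta C.
  have [phi0 _] := hAA; have [_ up A1 _] := tA.
  apply: (tensor_slots phi0 dE sD A1) => m.
  by elim: m => // m IH; exact: subset_trans IH (up m).
have uu t : unitary (u t) by have [] := uc.
(* [delta] is the transported [gamma] perturbed by [u]. Undoing [u] and then applying the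
   transported [w] expresses the perturbation of [gamma] as one of [delta]. *)
pose v t := star_iso_inv phi (w t) * star (u t).
have uw t : unitary (star_iso_inv phi (w t)).
  by have [w1 w2] := coc_unitary wc t; split; rewrite -(smS pm') -(smM pm') ?w1 ?w2 (sm1 pm').
have vc : cocycle delta v.
  split.
  - by move=> t; apply: unitaryM => //; exact: unitaryS.
  - apply/continuous_cnorm => t e e0; have e2 : 0 < e / 2 by lra.
    have /continuous_cnorm/(_ t _ e2)[d1 d10 h1] : continuous (u : R -> normed AA) by case: uc.
    have /continuous_cnorm/(_ t _ e2)[d2 d20 h2] : continuous (w : R -> normed A) by case: wc.
    exists (Num.min d1 d2); first by rewrite lt_min d10.
    move=> s; rewrite lt_min => /andP[/h1 s1 /h2 s2]; rewrite /v.
    have -> : star_iso_inv phi (w t) * star (u t) - star_iso_inv phi (w s) * star (u s) =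
      star_iso_inv phi (w t) * star (u t - u s) +
      star_iso_inv phi (w t - w s) * star (u s).
      by rewrite starB (smB pm'); ncring.
    rewrite (le_lt_trans (cnormD_le _ _))// (unitary_mull _ (uw t)) cnorm_star.
    by rewrite (unitary_mulr _ (unitaryS (uu s))) star_iso_inv_cnorm; lra.
  - move=> s t; have [_ _ ucD] := uc; have [_ _ wcD] := wc.
    rewrite du /perturb /conj_by /v -ucD -wcD (smM pm) K' (smM pm') !starM flowM.
    rewrite (smM pm').
    rewrite /conj_by !mulrA.
    rewrite -[_ * star (u s) * u s]mulrA (uu s).1 mulr1.
    rewrite (smS pm) flowS (smS pm') ; ncring.
have vE t x : conj_by phi (perturb gamma w) t x = perturb delta v t x.
  rewrite {1}/conj_by /perturb !(smM pm') (smS pm') du /perturb /v.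
  rewrite starM starK !mulrA -[_ * star (u t) * u t]mulrA (uu t).1 mulr1.
  by rewrite -[_ * star (u t) * u t]mulrA (uu t).1 mulr1.
have e2 : 0 < eps / 2 by lra.
have [n [V [Vc VC hV]]] := coc_approx tC dC vc e2.
exists phi, (perturb_flow Vc), (fun m => C (n + m)%N); split.
- exact: shift_tower.
- exact: perturb_inv.
- exact: perturb_slots.
- move=> t t1 x; rewrite vE /perturb_flow /= /perturb.
  have v1 : cnorm (v t) <= 1 by rewrite unitary_norm//; case: vc.
  have V1 : cnorm (V t) <= 1 by rewrite unitary_norm//; case: Vc.
  rewrite (le_trans (conj_dist _ _ v1 V1))// subrr cnorm0 addr0 flow_cnorm.
  by rewrite ler_wpM2r ?cnorm_ge0//; have := hV t t1; lra.
Qed.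

(** Carrying a cocycle on each side makes both claims instances: trivial cocycles for two universal
    flows, equal flows for a perturbation. *)
Lemma universal_almost_conjugate (g1 g2 : flow A) (w1 w2 : R -> A) :
  universal_UHF_flow AA g1 -> universal_UHF_flow AA g2 ->
  cocycle g1 w1 -> cocycle g2 w2 ->
  almost_conjugate (perturb g1 w1) (perturb g2 w2).
Proof.
move=> ug1 ug2 wc1 wc2 eps eps0; have e4 : 0 < eps / 4 by lra.
have [p1 [f1 [C1 [tC1 fC1 sC1 h1]]]] := universal_model ug1 wc1 e4.
have [p2 [f2 [C2 [tC2 fC2 sC2 h2]]]] := universal_model ug2 wc2 e4.
have [psi hpsi] := back_and_forth tC1 fC1 sC1 tC2 fC2 sC2 e4.
have K1 := star_iso_funK p1; have K1' := star_iso_invK p1.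
have K2 := star_iso_funK p2; have K2' := star_iso_invK p2.
have K := star_iso_funK psi; have K' := star_iso_invK psi.
have m1 := star_iso_morphism p1; have m1' := star_iso_inv_morphism p1.
have m2 := star_iso_morphism p2; have m := star_iso_morphism psi.
have m' := star_iso_inv_morphism psi.
pose F x := p2 (psi (star_iso_inv p1 x)).
pose F' y := p1 (star_iso_inv psi (star_iso_inv p2 y)).
have Fm : star_morphism F.
  split.
  - by move=> c x y; rewrite /F (smD m1') (smZ m1') (smD m) (smZ m) (smD m2) (smZ m2).
  - by move=> x y; rewrite /F (smM m1') (smM m) (smM m2).
  - by rewrite /F (sm1 m1') (sm1 m) (sm1 m2).
  - by move=> x; rewrite /F (smS m1') (smS m) (smS m2).
have FK : cancel F F' by move=> x; rewrite /F /F' K2 K K1'.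
have FK' : cancel F' F by move=> y; rewrite /F /F' K1 K' K2'.
exists (StarIso Fm FK FK') => t t1.
(* One quarter for each of the two models and one for the intertwining; the last quarter makes the
   inequality strict. *)
apply: (@opnorm_lt _ _ _ (3 * (eps / 4))); [lra| |lra].
move=> x; pose z := star_iso_inv p1 x.
have zx : cnorm z = cnorm x by exact: star_iso_inv_cnorm.
have a1 := h1 t t1 z; have a2 := h2 t t1 (psi z); have a3 := hpsi t t1 z.
have -> : cnorm (perturb g1 w1 t x - conj_by (StarIso Fm FK FK') (perturb g2 w2) t x) =
   cnorm (conj_by p1 (perturb g1 w1) t z -
     star_iso_inv psi (conj_by p2 (perturb g2 w2) t (psi z))).
  rewrite -(star_iso_inv_cnorm p1) (smB m1') /conj_by /= /F' K1 /z K1'.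
  by [].
have b1 := cdist_tri (f1 t z) (conj_by p1 (perturb g1 w1) t z)
  (star_iso_inv psi (conj_by p2 (perturb g2 w2) t (psi z))).
have b2 := cdist_tri (conj_by psi f2 t z) (f1 t z)
  (star_iso_inv psi (conj_by p2 (perturb g2 w2) t (psi z))).
have b3 : cnorm (conj_by psi f2 t z -
    star_iso_inv psi (conj_by p2 (perturb g2 w2) t (psi z))) <= eps / 4 * cnorm x.
  by rewrite {1}/conj_by -(smB m') star_iso_inv_cnorm cnormB -zx -(star_iso_cnorm psi z).
rewrite zx in a1 a3; lra.
Qed.

End Universal.

Theorem proposition3p4 (R : realType) (A : cstarAlgType R)
    (AA : tensor_product A A) (hA : UHF_algebra A) (hAA : isomorphic AA A) :
  (forall gamma1 gamma2 : flow A,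
      universal_UHF_flow AA gamma1 -> universal_UHF_flow AA gamma2 ->
      almost_conjugate gamma1 gamma2) /\
  (forall (gamma : flow A) (u : R -> A),
      universal_UHF_flow AA gamma -> cocycle gamma u ->
      almost_conjugate (perturb gamma u) gamma).
Proof.
have p1 (g : flow A) : perturb g (fun=> 1) = g.
  by apply/funext => t; apply/funext => x; rewrite /perturb star1 mulr1 mul1r.
split=> [g1 g2 h1 h2|g u hg uc].
  have := universal_almost_conjugate hA hAA h1 h2 (coc1 g1) (coc1 g2).
  by rewrite !p1.
by have := universal_almost_conjugate hA hAA hg hg uc (coc1 g); rewrite p1.
Qed.
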